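(* For $n\in\mathbb{N}$, let $f_n$ be centred inner functions with $|f_n'(0)|=\lambda_n=1-\mu_n$, and let $F_n=f_n\circ\cdots\circ f_1$. Then, for any shrinking target $(I_n)$ in $\partial\mathbb{D}$ that satisfies \[ \sum_{n=1}^\infty\mu_n|I_n|=\infty, \] the sequence $(F_n(\zeta))$ hits $(I_n)$ for almost all $\zeta\in\partial\mathbb{D}$.
   Context: $\mathbb{D}=\{z\in\mathbb{C}:|z|<1\}$. An inner function is a holomorphic map $f:\mathbb{D}\to\mathbb{D}$ whose radial boundary extension (also denoted $f$, defined at almost every point of $\partial\mathbb{D}$) takes values in $\partial\mathbb{D}$ almost everywhere. An inner function $f$ is centred if $f(0)=0$. Compositions on the boundary are compositions of radial boundary extensions, defined almost everywhere. ''Almost all'' refers to arc length (Lebesgue) measure on $\partial\mathbb{D}$. A target is a sequence $(I_n)_{n\in\mathbb{N}}$ of arcs of $\partial\mathbb{D}$, not necessarily nested and not necessarily shrinking in length; it is a shrinking target if $|I_n|\to0$ as $n\to\infty$, where $|I_n|$ is the length of $I_n$. For $\zeta\in\partial\mathbb{D}$, $(F_n(\zeta))$ hits $(I_n)$ if $F_n(\zeta)\in I_n$ for infinitely many $n$. *)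

(* Defs.v *)
From HB Require Import structures.
From mathcomp Require Import all_boot all_order all_algebra.
From mathcomp Require Import all_classical all_reals all_analysis.
From mathcomp Require Import complex.

Set Implicit Arguments.
Unset Strict Implicit.
Unset Printing Implicit Defensive.

Import Order.TTheory GRing.Theory Num.Theory.
Import numFieldNormedType.Exports.

Local Open Scope classical_set_scope.
Local Open Scope ring_scope.
Local Open Scope complex_scope.

Definition cis (R : realType) (t : R) : R[i] := cos t +i* sin t.

(* Arc length on the unit circle is Lebesgue measure transported along the
   bijective parametrization [t |-> cis t] of the circle by [0, 2 pi). *)
Definition arc_length (R : realType) (A : set R[i]) : \bar R :=
  lebesgue_measure [set t : R | 0 <= t < 2 * pi /\ A (cis t)].

Definition ae_circle (R : realType) (P : R[i] -> Prop) : Prop :=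
  {ae @lebesgue_measure R, forall t : R, 0 <= t < 2 * pi -> P (cis t)}.

(* Nondegenerate arcs; the booleans say which endpoints are included. *)
Definition is_arc (R : realType) (A : set R[i]) : Prop :=
  exists (a b : R) (ba bb : bool), [/\ a < b, b <= a + 2 * pi &
    A = @cis R @` [set` Interval (BSide ba a) (BSide bb b)]].

(* [R[i]^o] is R[i] as a normed space over itself, so that derivability means
   complex differentiability and limits are taken in the complex plane. *)
Definition holomorphic_on_disc (R : realType) (f : R[i] -> R[i]) : Prop :=
  forall z : R[i], `|z| < 1 -> derivable (f : R[i]^o -> R[i]^o) z 1.

Definition along_radius (R : realType) (f : R[i] -> R[i]) (zeta : R[i])
  : set_system R[i]^o := f (r%:C * zeta) @[r --> (1 : R)^'-].

(* Total; the value is meaningful only where the radial limit exists. *)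
Definition radial_extension (R : realType) (f : R[i] -> R[i]) (zeta : R[i])
  : R[i] := lim (along_radius f zeta).

(* Functions on the disc are represented by total functions on R[i], whose
   values outside the disc are irrelevant. *)
Definition inner_function (R : realType) (f : R[i] -> R[i]) : Prop :=
  [/\ forall z : R[i], `|z| < 1 -> `|f z| < 1,
      holomorphic_on_disc f &
      ae_circle (fun zeta =>
        cvg (along_radius f zeta) /\ `|radial_extension f zeta| = 1)].

Definition centred_inner (R : realType) (f : R[i] -> R[i]) : Prop :=
  inner_function f /\ f 0 = 0.

(* Sequences are indexed from 1: the terms of index 0 are never used, and
   boundary_comp f n is f_n o ... o f_1 on the boundary. *)
Fixpoint boundary_comp (R : realType) (f : nat -> R[i] -> R[i]) (n : nat)
    (zeta : R[i]) : R[i] :=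
  if n is m.+1 then radial_extension (f m.+1) (boundary_comp f m zeta) else zeta.

Definition target (R : realType) (I : nat -> set R[i]) : Prop :=
  forall n, (1 <= n)%N -> is_arc (I n).

Definition shrinking_target (R : realType) (I : nat -> set R[i]) : Prop :=
  target I /\ arc_length (I n) @[n --> \oo] --> 0%E.

Definition hits (R : realType) (x : nat -> R[i]) (I : nat -> set R[i]) : Prop :=
  forall N : nat, exists2 n : nat, (maxn 1 N <= n)%N & I n (x n).

(* Main.v *)
(* An inner function f sends harmonic measure seen from z to harmonic measure
   seen from f z: for bounded Borel phi, the Poisson average at z of phi o f is
   the Poisson average at f z of phi.  In particular a centred f preserves arc
   length, and Poisson kernels composed with the orbit satisfy
     E [(P_z (F_m) - 1) psi (F_{m+k})] = E [(P_{z'} - 1) psi],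
   where z' = f_{m+k} o ... o f_{m+1} (z).  Applying Harnack's inequality to
   f(z)/z, each f_n contracts |z| / (1 - |z|) by a factor 1 - mu_n / 3, so these
   correlations decay like prod (1 - mu_j / 3).
   An arc of length comparable to d contains the set where
   b = d (P_z - P_w / 2) is positive, with z and w at distance d/4 and d from the
   circle; moreover b <= 8 and E b = d / 2.  The decay bounds the variance of
   sum_n mu_n b_n (F_n) by a constant times sum_n mu_n d_n, so when this series
   diverges Chebyshev's inequality makes finitely many hits a null event. *)
Require Import Defs.
From HB Require Import structures.
From mathcomp Require Import all_boot all_order all_algebra.
From mathcomp Require Import all_classical all_reals all_analysis.
From mathcomp Require Import complex.
From mathcomp Require Import measurable_realfun ring lra.

Set Implicit Arguments.
Unset Strict Implicit.
Unset Printing Implicit Defensive.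

Import Order.TTheory GRing.Theory Num.Theory.
Import numFieldNormedType.Exports.

Local Open Scope classical_set_scope.
Local Open Scope ring_scope.
Local Open Scope complex_scope.

(** * Goursat's theorem on rectangles *)

Section Goursat.
Context (R : realType).
Implicit Types (F U W u w : R -> R -> R).

(** The transfer of harmonic measure has to be reached although [f] is holomorphic only in the open
    disc and its boundary values exist only almost everywhere. Integral formulas are therefore
    applied to dilates [f (r z)] with r < 1, which are holomorphic past the circle, and dominated
    convergence lets r tend to 1. This yields the identity for Poisson kernels alone; it extends to
    bounded Borel functions because a finite measure on the circle is determined by its Poisson
    integrals. The first factor of the correlation identity must be built from Poisson kernels, so
    the indicator of an arc is out of reach; hence the two-kernel function b. Its factor d offsets
    the size of |z| / (1 - |z|) near the circle, so that no constant depends on the length of the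
    arc. The products of the 1 - mu_j / 3 need not be summable, since mu_j may tend to 0 quickly.
    The weights mu_n are what makes the variance linear: the sum over j of mu_j times the product of
    1 - mu_l / 3 for j < l <= n is at most 3 for every sequence mu with values in [0, 1]. *)

Definition rect_diff F (s t h k : R) : R :=
  F (s + h) (t + k) - F (s + h) t - F s (t + k) + F s t.

(** Total differentiability at a single point, with no continuity of the partial derivatives: this
    is all that complex differentiability provides. *)
Definition has_gradient u (s0 t0 a b : R) : Prop :=
  forall e, 0 < e -> exists2 d, 0 < d & forall s t,
    `|s - s0| <= d -> `|t - t0| <= d ->
    `|u s t - u s0 t0 - a * (s - s0) - b * (t - t0)| <= e * (`|s - s0| + `|t - t0|).

Lemma MVT_bound (g dg : R -> R) (a b M : R) : a <= b ->
  (forall x, a <= x <= b -> is_derive x 1 g (dg x)) ->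
  (forall x, a <= x <= b -> `|dg x| <= M) -> `|g b - g a| <= M * (b - a).
Proof.
rewrite le_eqVlt => /predU1P[<- _ _|ab dgP dgM]; first by rewrite !subrr mulr0 normr0.
have [||x xab ->] := @MVT R g dg a b ab.
- by move=> x /[!in_itv]/= /andP[/ltW ? /ltW ?]; apply: dgP; apply/andP.
- apply: continuous_in_subspaceT => x /[!inE]/= /[!in_itv]/= xab.
  by apply: differentiable_continuous; apply/derivable1_diffP; have [] := dgP x xab.
rewrite normrM (ger0_norm (_ : 0 <= b - a)) ?subr_ge0 ?(ltW ab)//.
rewrite ler_wpM2r ?subr_ge0 ?(ltW ab)// dgM//.
by move: xab; rewrite in_itv/= => /andP[/ltW-> /ltW->].
Qed.

(** The function U(s + h, y) - U(s, y) - a h y of y has derivative u(s + h, y) - u(s, y) - a h. The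
    constant and the [b] term of the two expansions of [u] cancel there, which leaves two errors of
    size e (h + k); the mean value theorem supplies the last factor [k]. *)
Lemma rect_diff_near U u (s t h k s0 t0 a b e : R) :
  s <= s0 <= s + h -> t <= t0 <= t + k ->
  (forall y, t <= y <= t + k -> is_derive y 1 (U (s + h)) (u (s + h) y)) ->
  (forall y, t <= y <= t + k -> is_derive y 1 (U s) (u s y)) ->
  0 <= e ->
  (forall x y, `|x - s0| <= h -> `|y - t0| <= k ->
    `|u x y - u s0 t0 - a * (x - s0) - b * (y - t0)| <= e * (`|x - s0| + `|y - t0|)) ->
  `|rect_diff U s t h k - a * h * k| <= 2 * e * (h + k) * k.
Proof.
move=> /andP[ss0 s0h] /andP[tt0 t0k] dU1 dU0 e0 E.
have k0 : 0 <= k by lra.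
have h0 : 0 <= h by lra.
have -> : rect_diff U s t h k - a * h * k =
    (U (s + h) (t + k) - U s (t + k) - a * h * (t + k)) - (U (s + h) t - U s t - a * h * t).
  by rewrite /rect_diff; ring.
have {5}-> : k = t + k - t by ring.
apply: (@MVT_bound (fun y => U (s + h) y - U s y - a * h * y)
  (fun y => u (s + h) y - u s y - a * h)); first lra.
- move=> y yt; have d1 := dU1 y yt; have d0 := dU0 y yt.
  by apply: is_derive_eq; rewrite /GRing.scale/= mulr1.
- move=> y /andP[ty yk].
  have yt0 : `|y - t0| <= k by rewrite ler_norml; apply/andP; split; lra.
  have s1 : `|s + h - s0| <= h by rewrite ler_norml; apply/andP; split; lra.
  have s2 : `|s - s0| <= h by rewrite ler_norml; apply/andP; split; lra.
  have e1 := E _ _ s1 yt0.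
  have e2 := E _ _ s2 yt0.
  have e1' : e * (`|s + h - s0| + `|y - t0|) <= e * (h + k) by rewrite ler_wpM2l// lerD.
  have e2' : e * (`|s - s0| + `|y - t0|) <= e * (h + k) by rewrite ler_wpM2l// lerD.
  move: (le_trans e1 e1') (le_trans e2 e2'); rewrite !ler_norml.
  by move=> /andP[? ?] /andP[? ?]; apply/andP; split; nra.
Qed.

Lemma rect_diff_swap F (s t h k : R) :
  rect_diff (fun x y => F y x) t s k h = rect_diff F s t h k.
Proof. by rewrite /rect_diff; ring. Qed.

(** [rect_diff] is additive over the four quarters of a rectangle, so one quarter carries at least a
    quarter of the total. *)
Lemma bisect_rect F (s t h k c : R) : 0 <= h -> 0 <= k ->
  4 * c <= `|rect_diff F s t h k| ->
  exists p : R * R, [/\ s <= p.1 <= s + h / 2, t <= p.2 <= t + k / 2 &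
    c <= `|rect_diff F p.1 p.2 (h / 2) (k / 2)|].
Proof.
move=> h0 k0 H.
have E : rect_diff F s t h k =
   rect_diff F s t (h/2) (k/2) + rect_diff F (s + h/2) t (h/2) (k/2)
 + (rect_diff F s (t + k/2) (h/2) (k/2) + rect_diff F (s + h/2) (t + k/2) (h/2) (k/2)).
  rewrite /rect_diff.
  have -> : s + h / 2 + h / 2 = s + h by field.
  have -> : t + k / 2 + k / 2 = t + k by field.
  by ring.
rewrite E in H.
have H' := le_trans H (ler_normD _ _).
have H1 := ler_normD (rect_diff F s t (h/2) (k/2)) (rect_diff F (s + h/2) t (h/2) (k/2)).
have H2 := ler_normD (rect_diff F s (t + k/2) (h/2) (k/2)) (rect_diff F (s + h/2) (t + k/2) (h/2) (k/2)).
have [A1|A1] := leP c `|rect_diff F s t (h/2) (k/2)|.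
  by exists (s, t); split => //=; apply/andP; split; lra.
have [A2|A2] := leP c `|rect_diff F (s+h/2) t (h/2) (k/2)|.
  by exists (s+h/2, t); split => //=; apply/andP; split; lra.
have [A3|A3] := leP c `|rect_diff F s (t+k/2) (h/2) (k/2)|.
  by exists (s, t+k/2); split => //=; apply/andP; split; lra.
exists (s+h/2, t+k/2); split => //=; try (apply/andP; split; lra).
by lra.
Qed.

Lemma nested_itv (x : nat -> R) (h : R) : 0 <= h ->
  (forall n, x n <= x n.+1 <= x n + h / 2 ^+ n.+1) ->
  exists l, forall n, x n <= l <= x n + h / 2 ^+ n.
Proof.
move=> h0 xP.
have p0 n : 0 <= h / 2 ^+ n by rewrite mulr_ge0// invr_ge0 exprn_ge0.
have half n : h / 2 ^+ n = h / 2 ^+ n.+1 + h / 2 ^+ n.+1.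
  by rewrite exprS; field; rewrite expf_neq0.
have xm : nondecreasing_seq x.
  by apply/nondecreasing_seqP => n; have /andP[] := xP n.
have xd n m : x (n + m)%N + h / 2 ^+ (n + m) <= x n + h / 2 ^+ n.
  elim: m => [|m IH]; first by rewrite addn0.
  apply: le_trans IH; rewrite addnS.
  have /andP[_] := xP (n + m)%N; rewrite (half (n + m)%N); lra.
have xu n m : x m <= x n + h / 2 ^+ n.
  have := xd n m; have := p0 (n + m)%N.
  have := xm m (n + m)%N (leq_addl _ _); lra.
have cx : cvgn x.
  by apply: nondecreasing_is_cvgn => //; exists (x 0%N + h / 2 ^+ 0) => _ [m _ <-]; exact: xu.
exists (limn x) => n; apply/andP; split.
  exact: nondecreasing_cvgn_le.
by apply: limr_le => //; apply: nearW => m; exact: xu.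
Qed.

(* [U] and [W] are partial primitives of [u] in y and of [w] in x, so that the
   conclusion is an equality of iterated integrals of u_x = w_y; only
   differentiability is assumed, hence the bisection argument. *)
Theorem goursat U W u w (s t h k : R) : 0 <= h -> 0 <= k ->
  (forall x y, s <= x <= s + h -> t <= y <= t + k -> is_derive y 1 (U x) (u x y)) ->
  (forall x y, s <= x <= s + h -> t <= y <= t + k -> is_derive x 1 (W^~ y) (w x y)) ->
  (forall x y, s <= x <= s + h -> t <= y <= t + k ->
    exists a b c, has_gradient u x y a b /\ has_gradient w x y c a) ->
  rect_diff U s t h k = rect_diff W s t h k.
Proof.
move=> h0 k0 dU dW grad.
pose X x y := U x y - W x y.
suff : rect_diff X s t h k = 0 by rewrite /X /rect_diff; lra.
apply/eqP/negPn/negP => /eqP X0.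
have c0 : 0 < `|rect_diff X s t h k| by rewrite normr_gt0; exact/eqP.
set c := `|rect_diff X s t h k| in c0.
have half2 (y : R) n : y / 2 ^+ n.+1 = y / 2 ^+ n / 2.
  by rewrite exprSr; field; rewrite expf_neq0.
have p0 (y : R) n : 0 <= y -> 0 <= y / 2 ^+ n.
  by move=> y0; rewrite mulr_ge0// invr_ge0 exprn_ge0.
pose P n (p : R * R) := c / 4 ^+ n <= `|rect_diff X p.1 p.2 (h / 2 ^+ n) (k / 2 ^+ n)|.
(* The premise [P n p] stays under the existential so that [choice] yields a selector defined on all
   pairs. *)
have step n (p : R * R) : exists q : R * R, P n p -> [/\ P n.+1 q,
   p.1 <= q.1 <= p.1 + h / 2 ^+ n.+1 & p.2 <= q.2 <= p.2 + k / 2 ^+ n.+1].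
  have [Pp|nP] := pselect (P n p); last by exists p.
  have [|||q [q1 q2 q3]] := @bisect_rect X p.1 p.2 (h / 2 ^+ n) (k / 2 ^+ n) (c / 4 ^+ n.+1).
  - exact: p0.
  - exact: p0.
  - apply: le_trans Pp; rewrite exprS le_eqVlt; apply/orP; left; apply/eqP.
    by field; rewrite expf_neq0.
  by exists q => _; rewrite /P !half2.
have [next nextP] := choice (fun np : nat * (R * R) => step np.1 np.2).
pose p := fix p n := if n is m.+1 then next (m, p m) else (s, t).
have pP n : P n (p n).
  elim: n => [|n IH]; first by rewrite /P /= !expr0 !divr1.
  by have [] := nextP (n, p n) IH.
have p1 n : (p n).1 <= (p n.+1).1 <= (p n).1 + h / 2 ^+ n.+1 by have [] := nextP (n, p n) (pP n).
have p2 n : (p n).2 <= (p n.+1).2 <= (p n).2 + k / 2 ^+ n.+1 by have [] := nextP (n, p n) (pP n).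
have [s0 s0P] := nested_itv h0 p1.
have [t0 t0P] := nested_itv k0 p2.
have := s0P 0%N; have := t0P 0%N; rewrite /= expr0 !divr1 => t00 s00.
have in1 n : s <= (p n).1 /\ (p n).1 + h / 2 ^+ n <= s + h.
  elim: n => [|n [IH1 IH2]]; first by rewrite /= expr0 divr1.
  have /andP[] := p1 n; rewrite !half2; have := p0 h n h0; split; lra.
have in2 n : t <= (p n).2 /\ (p n).2 + k / 2 ^+ n <= t + k.
  elim: n => [|n [IH1 IH2]]; first by rewrite /= expr0 divr1.
  have /andP[] := p2 n; rewrite !half2; have := p0 k n k0; split; lra.
have [a [b [b' [gu gw]]]] := grad _ _ s00 t00.
(* The two errors add up to at most 2 e (h + k)^2 / 4^n, which for this [e] is c (h + k)^2 / (2 L^2)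
   / 4^n, strictly less than c / 4^n. The summand 1 keeps [L] positive for a degenerate
   rectangle. *)
pose L := h + k + 1; have L0 : 0 < L by rewrite /L; lra.
pose e := c / (4 * L ^+ 2); have e0 : 0 < e.
  by rewrite /e divr_gt0// mulr_gt0// exprn_gt0.
have [d1 d10 gu'] := gu e e0.
have [d2 d20 gw'] := gw e e0.
pose d := Num.min d1 d2.
have d0 : 0 < d by rewrite /d lt_min d10.
have [n Ln] : exists n, L / 2 ^+ n <= d.
  have : \forall n \near \oo, L / 2 ^+ n <= d.
    have : (L / 2 ^+ n) @[n --> \oo] --> 0.
      rewrite (_ : (fun n => L / 2 ^+ n) = geometric L 2^-1).
        by apply: cvg_geometric; rewrite ger0_norm; lra.
      by apply/funext => m; rewrite /geometric /= exprVn.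
    move=> /cvgr0Pnorm_le /(_ d d0); apply: filterS => n.
    by rewrite ger0_norm// p0// ltW.
  by case=> n _ /(_ n (leqnn n)); exists n.
have hn : h / 2 ^+ n <= d.
  by apply: le_trans Ln; rewrite ler_wpM2r ?invr_ge0 ?exprn_ge0// /L; lra.
have kn : k / 2 ^+ n <= d.
  by apply: le_trans Ln; rewrite ler_wpM2r ?invr_ge0 ?exprn_ge0// /L; lra.
have /andP[dd1 dd2] : (d <= d1) && (d <= d2) by rewrite /d !ge_min !lexx orbT.
have [i1 i1'] := in1 n; have [i2 i2'] := in2 n.
have hn0 := p0 h n h0; have kn0 := p0 k n k0.
have BU : `|rect_diff U (p n).1 (p n).2 (h / 2 ^+ n) (k / 2 ^+ n) - a * (h / 2 ^+ n) * (k / 2 ^+ n)|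
   <= 2 * e * (h / 2 ^+ n + k / 2 ^+ n) * (k / 2 ^+ n).
  apply: (@rect_diff_near U u _ _ _ _ s0 t0 a b e) => //.
  - by move=> y /andP[? ?]; apply: dU; apply/andP; split; lra.
  - by move=> y /andP[? ?]; apply: dU; apply/andP; split; lra.
  - exact: ltW.
  - by move=> x y ? ?; apply: gu'; lra.
(* The same estimate with the axes exchanged. The slope is again [a], by the relation between the
   two gradients, so the area terms cancel in [X]. *)
have BW : `|rect_diff W (p n).1 (p n).2 (h / 2 ^+ n) (k / 2 ^+ n) - a * (k / 2 ^+ n) * (h / 2 ^+ n)|
   <= 2 * e * (k / 2 ^+ n + h / 2 ^+ n) * (h / 2 ^+ n).
  rewrite -rect_diff_swap.
  apply: (@rect_diff_near (fun x y => W y x) (fun x y => w y x) _ _ _ _ t0 s0 a b' e) => //.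
  - by move=> y /andP[? ?]; apply: (dW y); apply/andP; split; lra.
  - by move=> y /andP[? ?]; apply: (dW y); apply/andP; split; lra.
  - exact: ltW.
  - move=> x y xt ys.
    rewrite (_ : w y x - _ - _ - _ = w y x - w s0 t0 - b' * (y - s0) - a * (x - t0)).
      by rewrite [`|x - t0| + _]addrC; apply: gw'; lra.
    by ring.
have Xn := pP n; rewrite /P in Xn.
have : c / 4 ^+ n <= 2 * e * (h / 2 ^+ n + k / 2 ^+ n) ^+ 2.
  apply: (le_trans Xn).
  rewrite (_ : rect_diff X _ _ _ _ =
    (rect_diff U (p n).1 (p n).2 (h / 2 ^+ n) (k / 2 ^+ n) - a * (h / 2 ^+ n) * (k / 2 ^+ n))
   - (rect_diff W (p n).1 (p n).2 (h / 2 ^+ n) (k / 2 ^+ n) - a * (k / 2 ^+ n) * (h / 2 ^+ n))).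
    apply: (le_trans (ler_normB _ _)); apply: (le_trans (lerD BU BW)).
    by rewrite le_eqVlt; apply/orP; left; apply/eqP; ring.
  by rewrite /rect_diff /X; ring.
have -> : h / 2 ^+ n + k / 2 ^+ n = (h + k) / 2 ^+ n by ring.
rewrite expr_div_n -exprM (mulnC n 2%N) exprM (_ : 2 ^+ 2 = 4 :> R); last by rewrite expr2; ring.
rewrite mulrA ler_pM2r ?invr_gt0 ?exprn_gt0//.
rewrite /e (_ : 2 * (c / (4 * L ^+ 2)) * (h + k) ^+ 2 = c * ((h + k) ^+ 2 / (2 * L ^+ 2))); last first.
  by field; rewrite gt_eqF.
rewrite -{1}[c]mulr1 ler_pM2l// ler_pdivlMr ?mulr_gt0 ?exprn_gt0// /L.
by apply/negP; rewrite -ltNge; nra.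
Qed.

End Goursat.

Notation normc := Normc.normc.

(** * Complex derivatives *)

Section Gradient.
Context (R : realType).

Lemma derive_expansion (g : R -> R) (x dg : R) : is_derive x 1 g dg ->
  forall e, 0 < e -> exists2 d, 0 < d & forall y, `|y - x| <= d ->
    `|g y - g x - dg * (y - x)| <= e * `|y - x|.
Proof.
move=> gP e e0.
have [gd gE] := gP.
have : h^-1 *: (g (h *: 1 + x) - g x) @[h --> 0^'] --> dg by rewrite -gE; exact: gd.
move=> /cvgrPdist_le /(_ e e0) [d /= d0 H].
exists (d / 2); first by rewrite divr_gt0.
move=> y yx; have [->|yx0] := eqVneq y x; first by rewrite !subrr mulr0 subr0 !normr0 mulr0.
have yx0' : y - x != 0 by rewrite subr_eq0.
have := H (y - x); rewrite /= sub0r normrN => /(_ _ _).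
have -> : (y - x) *: 1 + x = y by rewrite /GRing.scale/= mulr1 subrK.
rewrite -ler_pdivrMr ?normr_gt0// -normfV -normrM => G.
rewrite -normrN; rewrite (_ : - (_ / _) = dg - (y - x)^-1 * (g y - g x)); last by field.
by apply: G => //; lra.
Qed.

Lemma has_gradient_lip (u : R -> R -> R) (s0 t0 a b : R) : has_gradient u s0 t0 a b ->
  exists2 d, 0 < d & forall s t, `|s - s0| <= d -> `|t - t0| <= d ->
    `|u s t - u s0 t0| <= (`|a| + `|b| + 1) * (`|s - s0| + `|t - t0|).
Proof.
move=> /(_ 1 ltr01)[d d0 H]; exists d => // s t sd td.
have {}H := H _ _ sd td.
rewrite (_ : u s t - u s0 t0 = (u s t - u s0 t0 - a * (s - s0) - b * (t - t0)) +
  (a * (s - s0) + b * (t - t0))); last by ring.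
apply: (le_trans (ler_normD _ _)); apply: (le_trans (lerD H (ler_normD _ _))).
rewrite !normrM mul1r.
have := normr_ge0 a; have := normr_ge0 b; have := normr_ge0 (s - s0); have := normr_ge0 (t - t0).
by nra.
Qed.

Lemma has_gradient_prod (f g : R -> R) (s0 t0 df dg : R) :
  is_derive s0 1 f df -> is_derive t0 1 g dg ->
  has_gradient (fun s t => f s * g t) s0 t0 (df * g t0) (f s0 * dg).
Proof.
move=> fP gP e e0.
pose M := `|f s0| + `|df| + `|g t0| + `|dg| + 2.
have M1 : 1 <= M by rewrite /M; have := normr_ge0 (f s0); have := normr_ge0 df; have := normr_ge0 (g t0); have := normr_ge0 dg; lra.
have M0 : 0 < M by lra.
pose e' := Num.min 1 (e / (3 * (M * M))).
have e'0 : 0 < e' by rewrite lt_min ltr01 divr_gt0// !mulr_gt0.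
have e'1 : e' <= 1 by rewrite ge_min lexx.
have e'M : 3 * (e' * (M * M)) <= e.
  have : e' <= e / (3 * (M * M)) by rewrite ge_min lexx orbT.
  by rewrite ler_pdivlMr ?mulr_gt0//; lra.
have M2 : e' * M <= e' * (M * M) by rewrite ler_pM2l// ler_peMr// ltW.
clearbody e'.
have [d1 d10 H1] := derive_expansion fP e'0.
have [d2 d20 H2] := derive_expansion gP e'0.
(* [e'] is also used as a radius: the third error term [df * x * (g t - g t0)] is quadratic, and its
   smallness comes from [|y| <= e']. *)
exists (Num.min (Num.min d1 d2) e'); first by rewrite !lt_min d10 d20 e'0.
move=> s t; rewrite !le_min => /andP[/andP[s1 s2] s3] /andP[/andP[t1 t2] t3].
have {}H1 := H1 _ s1; have {}H2 := H2 _ t2.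
set x := s - s0 in H1 s1 s2 s3 *; set y := t - t0 in H2 t1 t2 t3 *.
rewrite (_ : _ - _ - _ - _ = (f s - f s0 - df * x) * g t + f s0 * (g t - g t0 - dg * y)
   + df * x * (g t - g t0)); last by ring.
have gt : `|g t - g t0| <= (`|dg| + 1) * `|y|.
  rewrite (_ : g t - g t0 = (g t - g t0 - dg * y) + dg * y); last by ring.
  apply: (le_trans (ler_normD _ _)); rewrite normrM.
  by have := normr_ge0 y; nra.
have x0 := normr_ge0 x; have y0 := normr_ge0 y.
have f0' := normr_ge0 (f s0); have g0' := normr_ge0 (g t0).
have df0 := normr_ge0 df; have dg0 := normr_ge0 dg.
have gM : `|g t| <= M.
  have : `|g t| <= `|g t0| + `|g t - g t0|.
    by rewrite -{1}(subrK (g t0) (g t)) addrC; exact: ler_normD.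
  by rewrite /M; nra.
have A1 : `|(f s - f s0 - df * x) * g t| <= e' * `|x| * M by rewrite normrM ler_pM.
have A2 : `|f s0 * (g t - g t0 - dg * y)| <= M * (e' * `|y|).
  by rewrite normrM ler_pM// /M; lra.
have A3 : `|df * x * (g t - g t0)| <= M * `|x| * (M * e').
  rewrite !normrM ler_pM ?mulr_ge0// ?ler_wpM2r//; first by rewrite /M; lra.
  apply: (le_trans gt); apply: ler_pM; rewrite ?addr_ge0// .
  by rewrite /M; lra.
apply: (le_trans (ler_normD _ _)); apply: (le_trans (lerD (ler_normD _ _) (lexx _))).
by nra.
Qed.

Lemma has_gradient_comp (f X Y : R -> R -> R) (s0 t0 p q a b c d : R) :
  has_gradient f (X s0 t0) (Y s0 t0) p q ->
  has_gradient X s0 t0 a b -> has_gradient Y s0 t0 c d ->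
  has_gradient (fun s t => f (X s t) (Y s t)) s0 t0
    (p * a + q * c) (p * b + q * d).
Proof.
move=> fg Xg Yg e e0.
have [dX dX0 LX] := has_gradient_lip Xg.
have [dY dY0 LY] := has_gradient_lip Yg.
set KX := `|a| + `|b| + 1 in LX; set KY := `|c| + `|d| + 1 in LY.
have KX1 : 1 <= KX by rewrite /KX; have := normr_ge0 a; have := normr_ge0 b; lra.
have KY1 : 1 <= KY by rewrite /KY; have := normr_ge0 c; have := normr_ge0 d; lra.
pose K := KX + KY + `|p| + `|q|.
have p0 := normr_ge0 p; have q0 := normr_ge0 q.
have K2 : 2 <= K by rewrite /K; lra.
pose e' := e / (2 * K).
have e'0 : 0 < e' by rewrite divr_gt0// mulr_gt0//; lra.
have eE : e = 2 * (e' * K) by rewrite /e'; field; rewrite gt_eqF//; lra.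
clearbody e'.
have [d1 d10 H1] := fg e' e'0.
have [d2 d20 H2] := Xg e' e'0.
have [d3 d30 H3] := Yg e' e'0.
pose d0 := d1 / (2 * K).
have d00 : 0 < d0 by rewrite divr_gt0// mulr_gt0//; lra.
have dE : d1 = 2 * (d0 * K) by rewrite /d0; field; rewrite gt_eqF//; lra.
clearbody d0.
exists (Num.min (Num.min dX dY) (Num.min (Num.min d2 d3) d0)).
  by rewrite !lt_min dX0 dY0 d20 d30 d00.
move=> s t; rewrite !le_min => /andP[/andP[s1 s2] /andP[/andP[s3 s4] s5]].
move=> /andP[/andP[t1 t2] /andP[/andP[t3 t4] t5]].
have {}LX := LX _ _ s1 t1; have {}LY := LY _ _ s2 t2.
have {}H2 := H2 _ _ s3 t3; have {}H3 := H3 _ _ s4 t4.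
set D := `|s - s0| + `|t - t0| in LX LY H2 H3 *.
have D0 : 0 <= D by rewrite addr_ge0.
have D1 : D <= 2 * d0 by rewrite /D; lra.
have {}H1 : `|f (X s t) (Y s t) - f (X s0 t0) (Y s0 t0) - p * (X s t - X s0 t0)
    - q * (Y s t - Y s0 t0)| <= e' * (`|X s t - X s0 t0| + `|Y s t - Y s0 t0|).
  by apply: H1; [apply: (le_trans LX)|apply: (le_trans LY)]; rewrite dE /K; nra.
rewrite (_ : _ - _ - _ - _ = (f (X s t) (Y s t) - f (X s0 t0) (Y s0 t0) - p * (X s t - X s0 t0)
    - q * (Y s t - Y s0 t0)) + (p * (X s t - X s0 t0 - a * (s - s0) - b * (t - t0))
    + q * (Y s t - Y s0 t0 - c * (s - s0) - d * (t - t0)))); last by ring.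
apply: (le_trans (ler_normD _ _)); apply: (le_trans (lerD H1 (ler_normD _ _))).
rewrite !normrM.
have B1 : `|p| * `|X s t - X s0 t0 - a * (s - s0) - b * (t - t0)| <= `|p| * (e' * D) by rewrite ler_wpM2l.
have B2 : `|q| * `|Y s t - Y s0 t0 - c * (s - s0) - d * (t - t0)| <= `|q| * (e' * D) by rewrite ler_wpM2l.
have B3 : e' * (`|X s t - X s0 t0| + `|Y s t - Y s0 t0|) <= e' * (KX * D + KY * D).
  by rewrite ler_pM2l// lerD.
apply: (le_trans (lerD B3 (lerD B1 B2))).
rewrite eE /K.
have : 0 <= e' * D by rewrite mulr_ge0// ltW.
by nra.
Qed.

End Gradient.

Section ComplexDerivative.
Context (R : realType).
Implicit Types (z w : R[i]) (f : R[i] -> R[i]).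

Lemma normcE z : `|z| = (normc z)%:C.
Proof. by []. Qed.

Lemma normc_ge0 z : 0 <= normc z.
Proof. by rewrite -lecR -normcE normr_ge0. Qed.

Lemma normcM z w : normc (z * w) = normc z * normc w.
Proof. exact: Normc.normcM. Qed.

Lemma normcD z w : normc (z + w) <= normc z + normc w.
Proof. by rewrite -lecR rmorphD/= -!normcE ler_normD. Qed.

Lemma normcN z : normc (- z) = normc z.
Proof. by apply: complexI; rewrite -!normcE normrN. Qed.

Lemma abs_Re_le z : `|complex.Re z| <= normc z.
Proof. by rewrite -lecR -normcE normc_ge_Re. Qed.

Lemma abs_Im_le z : `|complex.Im z| <= normc z.
Proof.
case: z => a b /=; rewrite -sqrtr_sqr ler_sqrt ?addr_ge0 ?sqr_ge0//.
by rewrite lerDr sqr_ge0.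
Qed.

Lemma normc_le_abs z : normc z <= `|complex.Re z| + `|complex.Im z|.
Proof.
case: z => a b /=; rewrite -[leRHS]ger0_norm ?addr_ge0//.
rewrite -sqrtr_sqr ler_sqrt ?sqr_ge0// sqrrD !real_normK ?num_real//.
by rewrite lerD2r lerDl mulrn_wge0// mulr_ge0.
Qed.

Lemma normc_sqr z : normc z ^+ 2 = complex.Re z ^+ 2 + complex.Im z ^+ 2.
Proof. by case: z => a b /=; rewrite sqr_sqrtr// addr_ge0 ?sqr_ge0. Qed.

(** The norm of [R[i]] takes its values in [R[i]]; here tolerance and radius are real, so that real
    arithmetic applies. *)
Definition has_cderiv f z a : Prop :=
  forall e : R, 0 < e -> exists2 d : R, 0 < d & forall w, normc (w - z) <= d ->
    normc (f w - f z - a * (w - z)) <= e * normc (w - z).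

Lemma derivable_cderiv f z : derivable (f : R[i]^o -> R[i]^o) z 1 ->
  has_cderiv f z ('D_1 (f : R[i]^o -> R[i]^o) z).
Proof.
move=> fd e e0.
set a := 'D_1 (f : R[i]^o -> R[i]^o) z.
have eC : (0 : R[i]) < e%:C by rewrite ltcR.
have /cvgrPdist_le /(_ _ eC) [d /= d0 H] := fd.
have dE : d = (complex.Re d)%:C by rewrite RRe_real// gtr0_real.
exists (complex.Re d / 2); first by rewrite divr_gt0// -ltcR -dE.
have d0' : 0 < complex.Re d by rewrite -ltcR -dE.
move=> w wz; have [->|yx0] := eqVneq w z.
  by rewrite !subrr mulr0 subr0 !Normc.normc0 mulr0.
have yx0' : w - z != 0 by rewrite subr_eq0.
have := H (w - z); rewrite /= sub0r normrN => /(_ _ _).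
have -> : (w - z) *: 1 + z = w by rewrite /GRing.scale/= mulr1 subrK.
move=> G.
have {}G : `|a - (w - z)^-1 * (f w - f z)| <= e%:C.
  apply: G => //; rewrite normcE dE ltcR; lra.
rewrite -lecR rmorphM/= -!normcE.
rewrite (_ : f w - _ - _ = (w - z) * - (a - (w - z)^-1 * (f w - f z))); last by field.
by rewrite normrM normrN mulrC ler_wpM2r.
Qed.

(** Multiplication by [a] is a real 2 by 2 matrix whose rows are the two gradients; the
    Cauchy-Riemann equations are read off from them. *)
Lemma has_cderiv_gradient f (x y : R) a : has_cderiv f (x +i* y) a ->
  has_gradient (fun x y => complex.Re (f (x +i* y))) x y (complex.Re a) (- complex.Im a) /\
  has_gradient (fun x y => complex.Im (f (x +i* y))) x y (complex.Im a) (complex.Re a).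
Proof.
case: a => al be fd; split=> e e0; have [d d0 H] := fd e e0.
all: exists (d / 2); first by rewrite divr_gt0.
all: move=> s t sx ty.
all: have N : normc ((s +i* t) - (x +i* y)) <= `|s - x| + `|t - y|
  by have := normc_le_abs ((s +i* t) - (x +i* y)).
all: have {}H : normc (f (s +i* t) - f (x +i* y) - (al +i* be) * ((s +i* t) - (x +i* y)))
  <= e * (`|s - x| + `|t - y|)
  by apply: (le_trans (H _ _)); [lra|rewrite ler_pM2l].
- apply: le_trans H; apply: le_trans (abs_Re_le _).
  case: (f (s +i* t)) => a1 b1; case: (f (x +i* y)) => a2 b2 /=.
  by rewrite le_eqVlt; apply/orP; left; apply/eqP; congr (`| _ |); ring.
- apply: le_trans H; apply: le_trans (abs_Im_le _).
  case: (f (s +i* t)) => a1 b1; case: (f (x +i* y)) => a2 b2 /=.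
  by rewrite le_eqVlt; apply/orP; left; apply/eqP; congr (`| _ |); ring.
Qed.

(* [polar s t] is the complex exponential of s + i t. *)
Definition polar (s t : R) : R[i] := (expR s * cos t) +i* (expR s * sin t).

(** The shared [a] is the Cauchy-Riemann equation in logarithmic polar coordinates: the derivative
    of the real part in log-radius equals that of the imaginary part in angle. This is the gradient
    hypothesis of [goursat]. *)
Lemma polar_cauchy_riemann f (s t : R) : derivable (f : R[i]^o -> R[i]^o) (polar s t) 1 ->
  exists a b c, has_gradient (fun s t => complex.Re (f (polar s t))) s t a b /\
    has_gradient (fun s t => complex.Im (f (polar s t))) s t c a.
Proof.
move=> /derivable_cderiv.
set D := 'D_1 (f : R[i]^o -> R[i]^o) _; case: D => [al be] /has_cderiv_gradient [/= g1 g2].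
have gX := has_gradient_prod (is_derive_expR s) (is_derive_cos t).
have gY := has_gradient_prod (is_derive_expR s) (is_derive_sin t).
have h1 := @has_gradient_comp _ _ (fun s t => expR s * cos t)
  (fun s t => expR s * sin t) _ _ _ _ _ _ _ _ g1 gX gY.
have h2 := @has_gradient_comp _ _ (fun s t => expR s * cos t)
  (fun s t => expR s * sin t) _ _ _ _ _ _ _ _ g2 gX gY.
exists (al * (expR s * cos t) + - be * (expR s * sin t)); do 2 eexists; split; first exact: h1.
move: h2; set c := (X in has_gradient _ _ _ _ X -> _).
by rewrite (_ : c = (al * (expR s * cos t) + - be * (expR s * sin t))); [exact|rewrite /c; ring].
Qed.

End ComplexDerivative.

(** * Averages of bounded functions *)

Section BoundedFunctions.
Context d (T : measurableType d) (R : realType).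
Implicit Types g h : T -> R.

(** Such functions are integrable for every probability and are closed under products, so averages
    can be manipulated without separate integrability arguments. *)
Definition bounded_mfun g : Prop :=
  measurable_fun setT g /\ exists M, forall x, `|g x| <= M.

Lemma bmf_cst (c : R) : bounded_mfun (cst c).
Proof. by split => //; exists `|c|. Qed.

Lemma bmfD g h : bounded_mfun g -> bounded_mfun h -> bounded_mfun (fun x => g x + h x).
Proof.
move=> [mg [M gM]] [mh [N hN]]; split; first exact: measurable_funD.
by exists (M + N) => x; rewrite (le_trans (ler_normD _ _))// lerD.
Qed.

Lemma bmfM g h : bounded_mfun g -> bounded_mfun h -> bounded_mfun (fun x => g x * h x).
Proof.
move=> [mg [M gM]] [mh [N hN]]; split; first exact: measurable_funM.
by exists (M * N) => x; rewrite normrM ler_pM.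
Qed.

Lemma bmfZ (c : R) g : bounded_mfun g -> bounded_mfun (fun x => c * g x).
Proof. exact: (bmfM (bmf_cst c)). Qed.

Lemma bmfB g h : bounded_mfun g -> bounded_mfun h -> bounded_mfun (fun x => g x - h x).
Proof.
move=> [mg [M gM]] [mh [N hN]]; split; first exact: measurable_funB.
by exists (M + N) => x; rewrite (le_trans (ler_normB _ _))// lerD.
Qed.

Lemma bmf_norm g : bounded_mfun g -> bounded_mfun (fun x => `|g x|).
Proof.
move=> [mg [M gM]]; split; first exact: measurableT_comp.
by exists M => x; rewrite normr_id.
Qed.

Lemma bmf_sum (I : Type) (s : seq I) (Q : pred I) (F : I -> T -> R) :
  (forall i, bounded_mfun (F i)) -> bounded_mfun (fun x => \sum_(i <- s | Q i) F i x).
Proof.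
move=> FP; elim: s => [|i s IH].
  by rewrite (_ : (fun x => _) = cst 0); [exact: bmf_cst|apply/funext => x; rewrite big_nil].
have [Qi|/negPf Qi] := boolP (Q i).
  rewrite (_ : (fun x => _) = (fun x => F i x + \sum_(j <- s | Q j) F j x)); first exact: bmfD.
  by apply/funext => x; rewrite big_cons Qi.
rewrite (_ : (fun x => _) = (fun x => \sum_(j <- s | Q j) F j x))//.
by apply/funext => x; rewrite big_cons Qi.
Qed.

Lemma bmf_indic (A : set T) : measurable A -> bounded_mfun (\1_A).
Proof. by move=> mA; split => //; exists 1 => x; rewrite indicE; case: (x \in A); rewrite ?normr1 ?normr0. Qed.

Variable P : probability T R.

Lemma bmf_integrable g : bounded_mfun g -> P.-integrable setT (EFin \o g).
Proof.
move=> [mg [M gM]]; apply: measurable_bounded_integrable => //.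
  by rewrite ltey_eq fin_num_measure.
exists M; split; rewrite ?num_real// => N MN x _ /=.
by apply: le_trans (gM x) _; exact: ltW.
Qed.

Definition avg g : R := \int[P]_x g x.

Lemma avg_cst c : avg (cst c) = c.
Proof.
rewrite /avg Rintegral_cst//; set p := (X in fine X).
by rewrite (_ : p = 1%E) ?mulr1//; exact: probability_setT.
Qed.

Lemma eq_avg g h : g =1 h -> avg g = avg h.
Proof. by move=> /funext ->. Qed.

Lemma avgD g h : bounded_mfun g -> bounded_mfun h ->
  avg (fun x => g x + h x) = avg g + avg h.
Proof. by move=> /bmf_integrable ? /bmf_integrable ?; exact: RintegralD. Qed.

Lemma avgB g h : bounded_mfun g -> bounded_mfun h ->
  avg (fun x => g x - h x) = avg g - avg h.
Proof. by move=> /bmf_integrable ? /bmf_integrable ?; exact: RintegralB. Qed.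

Lemma avgZ (c : R) g : bounded_mfun g -> avg (fun x => c * g x) = c * avg g.
Proof. by move=> /bmf_integrable ?; exact: RintegralZl. Qed.

Lemma avg_ge0 g : (forall x, 0 <= g x) -> 0 <= avg g.
Proof. by move=> g0; exact: Rintegral_ge0. Qed.

Lemma le_avg g h : bounded_mfun g -> bounded_mfun h -> (forall x, g x <= h x) ->
  avg g <= avg h.
Proof. by move=> /bmf_integrable ? /bmf_integrable ? gh; exact: le_Rintegral. Qed.

Lemma avg_norm g : bounded_mfun g -> `|avg g| <= avg (fun x => `|g x|).
Proof. by move=> /bmf_integrable ?; exact: le_normr_Rintegral. Qed.

Lemma avg_sum (I : Type) (s : seq I) (Q : pred I) (F : I -> T -> R) :
  (forall i, bounded_mfun (F i)) ->
  avg (fun x => \sum_(i <- s | Q i) F i x) = \sum_(i <- s | Q i) avg (F i).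
Proof.
move=> FP; elim: s => [|i s IH].
  by rewrite big_nil -[RHS](avg_cst 0); apply: eq_avg => x; rewrite big_nil.
rewrite big_cons; case: ifP => Qi; rewrite -IH; last first.
  by apply: eq_avg => x; rewrite big_cons Qi.
rewrite -avgD//; last exact: bmf_sum.
by apply: eq_avg => x; rewrite big_cons Qi.
Qed.

Lemma EFin_avg g : bounded_mfun g -> (avg g)%:E = (\int[P]_x (g x)%:E)%E.
Proof. by move=> /bmf_integrable ?; rewrite fineK//; exact: integrable_fin_num. Qed.

Lemma avg_indic (A : set T) : measurable A -> (avg (\1_A))%:E = P A.
Proof.
by move=> mA; rewrite EFin_avg ?integral_indic ?setIT//; exact: bmf_indic.
Qed.

Lemma avg_dct (g_ : nat -> T -> R) g (M : R) :
  (forall n, measurable_fun setT (g_ n)) -> measurable_fun setT g ->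
  (forall n x, `|g_ n x| <= M) ->
  {ae P, forall x, g_ n x @[n --> \oo] --> g x} ->
  avg (g_ n) @[n --> \oo] --> avg g.
Proof.
move=> mg_ mg gM cvg.
have M0 : 0 <= M by apply: le_trans (gM 0%N point).
have [] := @dominated_convergence _ _ _ P setT measurableT
  (fun n x => (g_ n x)%:E) (EFin \o g) (cst M%:E).
- by move=> n; exact/measurable_EFinP.
- exact/measurable_EFinP.
- by apply: filterS cvg => x gx _; apply: cvg_EFin => //; exact: nearW.
- exact: finite_measure_integrable_cst.
- by apply: aeW => x n _ /=; rewrite lee_fin.
move=> ig _ H.
have fin : (\int[P]_x (EFin \o g) x)%E \is a fin_num by exact: integrable_fin_num.
by apply: fine_cvg; rewrite fineK.
Qed.

Lemma ae_eq_avg g h : bounded_mfun g -> bounded_mfun h ->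
  {ae P, forall x, g x = h x} -> avg g = avg h.
Proof.
move=> [mg _] [mh _] gh; congr fine; apply: ae_eq_integral => //.
- exact/measurable_EFinP.
- exact/measurable_EFinP.
- by apply: filterS gh => x ->.
Qed.

End BoundedFunctions.

(** * Limits and compactness in the complex plane *)

Section ComplexContinuity.
Context (R : realType).
Implicit Types (z w : R[i]).

Lemma normcBC z w : normc (z - w) = normc (w - z).
Proof. by rewrite -normcN opprB. Qed.

Lemma normc_triangle z w : normc z <= normc w + normc (z - w).
Proof. by rewrite -{1}(subrK w z) addrC normcD. Qed.

Lemma cvg_complex (T : Type) (F : set_system T) (FF : Filter F) (f g : T -> R) (a b : R) :
  f x @[x --> F] --> a -> g x @[x --> F] --> b ->
  (f x +i* g x : R[i]^o) @[x --> F] --> (a +i* b : R[i]^o).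
Proof.
move=> fa gb; apply/cvgrPdist_le => e e0.
have eE : e = (complex.Re e)%:C by rewrite RRe_real// gtr0_real.
have e0' : 0 < complex.Re e by rewrite -ltcR -eE.
near=> x; rewrite eE normcE lecR; apply: (le_trans (normc_le_abs _)) => /=.
rewrite [complex.Re e]splitr lerD//; near: x.
- by move/cvgrPdist_le : fa => /(_ (complex.Re e / 2)); apply; rewrite divr_gt0.
- by move/cvgrPdist_le : gb => /(_ (complex.Re e / 2)); apply; rewrite divr_gt0.
Unshelve. all: by end_near. Qed.

Lemma cvg_normcP (T : Type) (F : set_system T) (FF : Filter F) (f : T -> R[i]) z :
  (f x : R[i]^o) @[x --> F] --> (z : R[i]^o) <->
  normc (z - f x) @[x --> F] --> (0 : R).
Proof.
split=> [fz|fz].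
- apply/cvgr0Pnorm_le => e e0.
  have eC : (0 : R[i]) < e%:C by rewrite ltcR.
  move/cvgrPdist_le : fz => /(_ _ eC); apply: filterS => x.
  by rewrite normcE lecR ger0_norm// normc_ge0.
- apply/cvgrPdist_le => e e0.
  have eE : e = (complex.Re e)%:C by rewrite RRe_real// gtr0_real.
  have e0' : 0 < complex.Re e by rewrite -ltcR -eE.
  move/cvgr0Pnorm_le : fz => /(_ _ e0'); apply: filterS => x.
  by rewrite ger0_norm ?normc_ge0// eE => H; rewrite normcE lecR.
Qed.

Lemma cvg_Re (T : Type) (F : set_system T) (FF : Filter F) (f : T -> R[i]) z :
  (f x : R[i]^o) @[x --> F] --> (z : R[i]^o) ->
  complex.Re (f x) @[x --> F] --> complex.Re z.
Proof.
move=> /cvg_normcP fz; apply/cvgrPdist_le => e e0.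
move/cvgr0Pnorm_le : fz => /(_ _ e0); apply: filterS => x.
rewrite ger0_norm ?normc_ge0//; apply: le_trans.
by rewrite -raddfB abs_Re_le.
Qed.

Lemma cvg_Im (T : Type) (F : set_system T) (FF : Filter F) (f : T -> R[i]) z :
  (f x : R[i]^o) @[x --> F] --> (z : R[i]^o) ->
  complex.Im (f x) @[x --> F] --> complex.Im z.
Proof.
move=> /cvg_normcP fz; apply/cvgrPdist_le => e e0.
move/cvgr0Pnorm_le : fz => /(_ _ e0); apply: filterS => x.
rewrite ger0_norm ?normc_ge0//; apply: le_trans.
by rewrite -raddfB abs_Im_le.
Qed.

Lemma cvg_normc (T : Type) (F : set_system T) (FF : Filter F) (f : T -> R[i]) z :
  (f x : R[i]^o) @[x --> F] --> (z : R[i]^o) ->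
  normc (f x) @[x --> F] --> normc z.
Proof.
move=> /cvg_normcP fz; apply/cvgrPdist_le => e e0.
move/cvgr0Pnorm_le : fz => /(_ _ e0); apply: filterS => x.
rewrite ger0_norm ?normc_ge0//; apply: le_trans.
have := normc_triangle z (f x); have := normc_triangle (f x) z.
by rewrite (normcBC (f x) z) ler_norml => ? ?; apply/andP; split; lra.
Qed.

(** Compactness of the closed disc is obtained in [R * R], where it is a closed subset of a
    square. *)
Lemma disc_bounded (h : R[i] -> R[i]) :
  (forall z, normc z <= 1 -> {for z, continuous (h : R[i]^o -> R[i]^o)}) ->
  exists M, forall z, normc z <= 1 -> normc (h z) <= M.
Proof.
move=> hc.
pose K := [set p : R * R | p.1 ^+ 2 + p.2 ^+ 2 <= 1].
pose H (p : R * R) := normc (h (p.1 +i* p.2)).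
have Kn (p : R * R) : K p -> normc (p.1 +i* p.2) <= 1.
  by rewrite /K /= => pK; rewrite -sqrtr1 ler_sqrt.
have cK : compact K.
  apply: (@subclosed_compact _ K (`[-1, 1]%classic `*` `[-1, 1]%classic)).
  - have -> : K = (fun p : R * R => p.1 ^+ 2 + p.2 ^+ 2) @^-1` [set x | x <= 1] by [].
    apply: closed_comp; last exact: closed_le.
    move=> p _; apply: cvgD; rewrite !expr2.
      by apply: cvgM; exact: cvg_fst.
    by apply: cvgM; exact: cvg_snd.
  - by apply: compact_setX; exact: segment_compact.
  - move=> [x y]; rewrite /K /= => xy; rewrite !in_itv/= -!ler_norml.
    have := sqr_ge0 x; have := sqr_ge0 y; move=> ? ?.
    by split; rewrite -(@ler_pXn2r _ 2%N) ?nnegrE// ?real_normK ?num_real// expr1n; lra.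
have cH : {within K, continuous H}.
  apply: continuous_in_subspaceT => p /[!inE] pK; apply: cvg_normc.
  apply: (@cvg_comp _ _ _ (fun p : R * R => (p.1 +i* p.2 : R[i]^o)) (h : R[i]^o -> R[i]^o) _
    (nbhs (p.1 +i* p.2 : R[i]^o))).
    by apply: cvg_complex; [exact: cvg_fst|exact: cvg_snd].
  exact: (hc _ (Kn _ pK)).
have /compact_bounded[M [_ MP]] := continuous_compact cH cK.
exists (M + 1) => -[x y] xy.
have := MP (M + 1); rewrite ltrDl ltr01 => /(_ isT) /(_ (H (x, y))).
rewrite /H /= => HM; apply: le_trans (ler_norm _) _; apply: HM.
exists (x, y) => //; rewrite /K /=.
by move: xy => /=; rewrite -(@ler_pXn2r _ 2%N) ?nnegrE ?sqrtr_ge0// expr1n sqr_sqrtr ?addr_ge0 ?sqr_ge0.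
Qed.

End ComplexContinuity.

(** * The mean value property *)

Section CircleAverage.
Context (R : realType).
Local Notation leb := (@lebesgue_measure R).

Lemma pi2_gt0 : 0 < 2 * pi :> R.
Proof. by rewrite mulr_gt0// pi_gt0. Qed.

Definition circ : probability (measurableTypeR R) R := uniform_prob pi2_gt0.

Lemma avg_lebesgue (g : R -> R) : bounded_mfun g ->
  avg circ g = (2 * pi)^-1 * \int[leb]_(t in `[0, 2 * pi]) g t.
Proof.
move=> bg; have [mg [M gM]] := bg.
have ib (h : R -> R) : bounded_mfun h -> leb.-integrable `[0, 2 * pi] (EFin \o h).
  move=> [mh [N hN]]; apply: measurable_bounded_integrable => //.
  - by rewrite /= lebesgue_measure_itv/= lte_fin pi2_gt0 -EFinB ltry.
  - exact: measurable_funTS.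
  - exists N; split; rewrite ?num_real// => N' NN' x _ /=.
    by apply: le_trans (hN x) _; exact: ltW.
have bc := @bmf_cst _ (measurableTypeR R) R M.
(* The change of density is applied to a nonnegative integrand; the shift [M] has the same mean on
   both sides and cancels at the end. *)
have g0 x : 0 <= g x + M by have := gM x; rewrite ler_norml => /andP[]; lra.
have : (avg circ (fun t => g t + M))%:E = ((2 * pi)^-1 * \int[leb]_(t in `[0, 2 * pi]) (g t + M))%:E.
  rewrite EFin_avg; last exact: (bmfD bg bc).
  rewrite integral_uniform//; last by apply/measurable_EFinP; apply: measurable_funD.
  rewrite subr0 EFinM; congr (_ * _)%E; rewrite fineK//.
  by apply: integrable_fin_num => //; apply: (ib (fun t => g t + M)); exact: (bmfD bg bc).
move=> [].
rewrite (avgD circ bg bc) avg_cst RintegralD//=; [|exact: ib|exact: (ib (cst M))].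
rewrite Rintegral_cst//= lebesgue_measure_itv/= lte_fin pi2_gt0 -EFinB/= subr0.
move=> H; apply: (@addIr _ M); rewrite H mulrDr; congr (_ + _).
by rewrite mulrCA mulVf ?mulr1// gt_eqF// pi2_gt0.
Qed.

Definition prim (a : R) (g : R -> R) (x : R) : R := \int[leb]_(t in `[a, x]) g t.

Lemma prim_integrable (a b : R) (g : R -> R) : (forall y, a <= y <= b -> {for y, continuous g}) ->
  leb.-integrable `[a, b] (EFin \o g).
Proof.
move=> gc; apply: continuous_compact_integrable; first exact: segment_compact.
apply: continuous_in_subspaceT => y /[!inE]/=; rewrite in_itv/=; exact: gc.
Qed.

Lemma prim_is_derive (a b x : R) (g : R -> R) : a < x -> x < b ->
  (forall y, a <= y <= b -> {for y, continuous g}) -> is_derive x 1 (prim a g) (g x).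
Proof.
move=> ax xb gc.
have [|dP dE] := continuous_FTC1_closed xb (prim_integrable gc) ax.
  by apply: gc; rewrite !ltW.
apply: DeriveDef; [exact: dP|by rewrite -dE derive1E].
Qed.

Lemma primB (a b c : R) (g : R -> R) : a < b -> b <= c ->
  (forall y, a <= y <= c -> {for y, continuous g}) ->
  prim a g c - prim a g b = \int[leb]_(t in `[b, c]) g t.
Proof.
move=> ab bc gc; rewrite /prim Rintegral_itvB ?bnd_simp//; last 2 first.
- exact: prim_integrable.
- exact: ltW.
apply: Rintegral_itv_obnd_cbnd.
apply: (integrableS _ _ _ (prim_integrable gc)) => //.
by apply: subset_itvr; rewrite bnd_simp ltW.
Qed.

End CircleAverage.

Section MeanValue.
Context (R : realType).
Implicit Types (z w : R[i]).
Local Notation leb := (@lebesgue_measure R).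

Lemma normc_cis (t : R) : normc (cis t) = 1.
Proof. by rewrite /cis /= addrC -sqrtr1; congr Num.sqrt; rewrite -(cos2Dsin2 t) addrC. Qed.

Lemma normc_realM (r : R) z : 0 <= r -> normc (r%:C * z) = r * normc z.
Proof.
move=> r0; rewrite normcM; congr (_ * _).
by rewrite /= expr0n addr0 sqrtr_sqr ger0_norm.
Qed.

Lemma polarE (s t : R) : polar s t = (expR s)%:C * cis t.
Proof. by rewrite /polar /cis; apply/eqP; rewrite eq_complex /= !mul0r subr0 addr0 !eqxx. Qed.

Lemma cvg_cis (t : R) : (cis x : R[i]^o) @[x --> t] --> (cis t : R[i]^o).
Proof. by apply: cvg_complex; [exact: continuous_cos|exact: continuous_sin]. Qed.

Lemma cvg_realC (r : R) : (x%:C : R[i]^o) @[x --> r] --> (r%:C : R[i]^o).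
Proof. by apply: cvg_complex; [exact: cvg_id|exact: cvg_cst]. Qed.

Variable k : R[i] -> R[i].
Variables (r0 r1 : R).
(* Differentiability may fail at 0 and on the circle of radius [r1], where
   continuity is enough: this accommodates difference quotients. *)
Hypothesis r0_gt1 : 1 < r0.
Hypothesis r1_ge0 : 0 <= r1.
Hypothesis r1_lt1 : r1 < 1.
Hypothesis kc : forall z, normc z < r0 -> {for z, continuous (k : R[i]^o -> R[i]^o)}.
Hypothesis kd : forall z, 0 < normc z -> normc z < r0 -> normc z != r1 ->
  derivable (k : R[i]^o -> R[i]^o) z 1.

Let u (s t : R) := complex.Re (k (polar s t)).
Let w (s t : R) := complex.Im (k (polar s t)).

Let k_comp (T : Type) (F : set_system T) (FF : Filter F) (f : T -> R[i]) z :
  normc z < r0 -> (f x : R[i]^o) @[x --> F] --> (z : R[i]^o) ->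
  (k (f x) : R[i]^o) @[x --> F] --> (k z : R[i]^o).
Proof.
move=> z0 fz; apply: (@cvg_comp _ _ _ f (k : R[i]^o -> R[i]^o) _ (nbhs (z : R[i]^o))).
  exact: fz.
exact: (kc z0).
Qed.

Let normc_polar (s t : R) : normc (polar s t) = expR s.
Proof. by rewrite polarE normc_realM ?expR_ge0// normc_cis mulr1. Qed.

Let k_cont1 z : normc z <= 1 -> {for z, continuous (k : R[i]^o -> R[i]^o)}.
Proof. by move=> z1; apply: kc; exact: le_lt_trans z1 r0_gt1. Qed.

Let u_cont s t : expR s < r0 -> {for t, continuous (u s)}.
Proof.
move=> s0; apply: cvg_Re; apply: k_comp; first by rewrite normc_polar.
apply: cvg_complex; apply: cvgM; try exact: cvg_cst.
  exact: continuous_cos.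
exact: continuous_sin.
Qed.

Let w_cont s t : expR s < r0 -> {for s, continuous (w^~ t)}.
Proof.
move=> s0; apply: cvg_Im; apply: k_comp; first by rewrite normc_polar.
apply: cvg_complex; apply: cvgM; try exact: cvg_cst.
  exact: continuous_expR.
exact: continuous_expR.
Qed.

Let bmf_u s : expR s <= 1 -> bounded_mfun (u s).
Proof.
move=> s1; split.
  apply: continuous_measurable_fun => t; apply: u_cont; exact: le_lt_trans s1 r0_gt1.
have [M MP] := disc_bounded k_cont1.
exists M => t; apply: (le_trans (abs_Re_le _)); apply: MP.
by rewrite normc_polar.
Qed.

(** In the coordinates of [polar] the annulus becomes a rectangle of height one period. [goursat]
    equates the increment of the circle integral of [u] with the integral of [w] over the top side
    minus that over the bottom side, and these agree by periodicity. *)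
Let const_annulus (s1 s2 : R) : s1 < s2 -> expR s2 <= 1 ->
  (forall s, s1 <= s <= s2 -> expR s != r1) -> avg (circ R) (u s1) = avg (circ R) (u s2).
Proof.
move=> s12 s2r ex.
have s1r : expR s1 <= 1 by apply: le_trans s2r; rewrite ler_expR ltW.
rewrite !avg_lebesgue; try exact: bmf_u.
congr (_ * _).
have pi2 := pi2_gt0 R.
have r0p : 0 < r0 by exact: lt_trans ltr01 r0_gt1.
have er s : s <= s2 -> expR s < r0.
  by move=> ss2; apply: le_lt_trans r0_gt1; apply: le_trans s2r; rewrite ler_expR.
have ucc s y : s <= s2 -> {for y, continuous (u s)} by move=> ?; apply: u_cont; exact: er.
(* The primitives start at -1, before the rectangle, so that they have two-sided derivatives on all
   of [0, 2 pi]. *)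
rewrite -(@primB R (-1) 0 (2 * pi) (u s1)); [|lra|exact: ltW|by move=> y _; apply: ucc; exact: ltW].
rewrite -(@primB R (-1) 0 (2 * pi) (u s2)); [|lra|exact: ltW|by move=> y _; apply: ucc].
(* Room to the right of [s2], for the same reason: [w] must be continuous slightly past the
   rectangle. *)
have [s3 s23 s3r] : exists2 s3, s2 < s3 & expR s3 < r0.
  have s2l : s2 < ln r0 by rewrite -ltr_expR lnK ?posrE//; exact: er.
  exists ((s2 + ln r0) / 2); first by lra.
  rewrite -[ltRHS](@lnK _ r0) ?posrE ?ltr_expR//; lra.
have wcc s y : s <= s3 -> {for s, continuous (w^~ y)}.
  by move=> ss3; apply: w_cont; apply: le_lt_trans s3r; rewrite ler_expR.
have H : rect_diff (fun s => prim (-1) (u s)) s1 0 (s2 - s1) (2 * pi) =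
    rect_diff (fun s t => prim (s1 - 1) (w^~ t) s) s1 0 (s2 - s1) (2 * pi).
  apply: (@goursat R _ _ u w).
  - by rewrite subr_ge0 ltW.
  - exact: ltW.
  - move=> x y; rewrite addrC subrK => /andP[x1 x2] /andP[y1 y2].
    by apply: (@prim_is_derive _ _ (2 * pi + 1)); [lra|lra|move=> ? _; apply: ucc].
  - move=> x y; rewrite addrC subrK => /andP[x1 x2] /andP[y1 y2].
    by apply: (@prim_is_derive _ _ s3); [lra|lra|move=> z /andP[? ?]; apply: wcc].
  - move=> x y; rewrite addrC subrK => /andP[x1 x2] _.
    apply: polar_cauchy_riemann; apply: kd; rewrite normc_polar.
    + exact: expR_gt0.
    + exact: er.
    + by apply: ex; rewrite x1.
move: H; rewrite /rect_diff !add0r (addrC s1) subrK.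
have -> : w^~ (2 * pi) = w^~ 0.
  apply/funext => s; rewrite /w /polar sin0 cos0.
  by rewrite !mulr_natl cos2pi sin2pi.
move: (prim (-1) (u s2) (2 * pi)) (prim (-1) (u s2) 0) (prim (-1) (u s1) (2 * pi))
  (prim (-1) (u s1) 0) (prim (s1 - 1) (w^~ 0) s2) (prim (s1 - 1) (w^~ 0) s1).
by move=> A B C D E F H; apply/esym/subr0_eq; rewrite -[RHS](subrr (E - F)); lra.
Qed.

Let psi (r : R) := avg (circ R) (fun t => complex.Re (k (r%:C * cis t))).

Let psi_cvg (r : nat -> R) (l : R) : (forall n, 0 <= r n <= 1) -> r n @[n --> \oo] --> l ->
  psi (r n) @[n --> \oo] --> psi l.
Proof.
move=> r01 rl.
have lE : l = limn r by apply/esym/cvg_lim.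
have /andP[l0 l1] : 0 <= l <= 1.
  rewrite lE; apply/andP; split.
    by apply: limr_ge; [exact: cvgP rl|apply: nearW => n; have /andP[] := r01 n].
  by apply: limr_le; [exact: cvgP rl|apply: nearW => n; have /andP[] := r01 n].
have [M MP] := disc_bounded k_cont1.
have mk x : 0 <= x <= 1 -> measurable_fun setT (fun t => complex.Re (k (x%:C * cis t))).
  move=> /andP[x0 x1].
  apply: continuous_measurable_fun => t; apply: cvg_Re; apply: k_comp.
    by rewrite normc_realM ?normc_cis ?mulr1//; exact: le_lt_trans x1 r0_gt1.
  by apply: cvgM; [exact: cvg_cst|exact: cvg_cis].
apply: (@avg_dct _ _ _ _ _ _ M).
- by move=> n; exact: mk.
- by apply: mk; rewrite l0.
- move=> n t; apply: (le_trans (abs_Re_le _)); apply: MP.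
  by have /andP[? ?] := r01 n; rewrite normc_realM ?normc_cis ?mulr1.
- apply: aeW => t; apply: cvg_Re; apply: k_comp.
    by rewrite normc_realM ?normc_cis ?mulr1//; exact: le_lt_trans l1 r0_gt1.
  apply: cvgM; last exact: cvg_cst.
  apply: (cvg_comp _ _ rl); exact: cvg_realC.
Qed.

Let psi_eq (a b : R) : 0 < a -> a < b -> b <= 1 -> r1 < a \/ b < r1 -> psi a = psi b.
Proof.
move=> a0 ab b1 h.
have b0 : 0 < b by lra.
have E r : 0 < r -> psi r = avg (circ R) (u (ln r)).
  by move=> rp; apply: eq_avg => t; rewrite /u polarE lnK ?posrE.
rewrite (E a a0) (E b b0); apply: const_annulus.
- by rewrite ltr_ln ?posrE.
- by rewrite lnK ?posrE.
- move=> s /andP[s1 s2].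
  have e1 : a <= expR s by rewrite -[a]lnK ?posrE// ler_expR.
  have e2 : expR s <= b by rewrite -[b]lnK ?posrE// ler_expR.
  by apply/eqP => e3; lra.
Qed.

(** One-sided continuity of the circle means, used to reach the radii 0 and [r1], at which [k] may
    fail to be differentiable. *)
Let psi_limit (a b c : R) : 0 <= a <= 1 -> 0 <= b <= 1 -> (forall x, 0 < x < 1 -> psi (a + x * (b - a)) = c) ->
  psi a = c.
Proof.
move=> /andP[a0 a1] /andP[b0 b1] H.
have h n : 0 < (n.+2%:R : R)^-1 < 1.
  by rewrite invr_gt0 ltr0n /= invf_lt1 ?ltr0n// ltr1n.
have cv : psi (a + n.+2%:R^-1 * (b - a)) @[n --> \oo] --> psi a.
  apply: psi_cvg.
    move=> n; have := h n; move: (n.+2%:R^-1) => q /andP[q0 q1].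
    have := mulr_ge0 (ltW q0) b0; have := mulr_ge0 (_ : 0 <= 1 - q) a0.
    have := mulr_ge0 (ltW q0) (_ : 0 <= 1 - b); have := mulr_ge0 (_ : 0 <= 1 - q) (_ : 0 <= 1 - a).
    by rewrite !subr_ge0 => /(_ (ltW q1) a1) ? /(_ b1) ? /(_ (ltW q1)) ? ?; apply/andP; split; lra.
  rewrite -[X in _ --> X]addr0 -[X in _ --> _ + X](mul0r (b - a)).
  apply: cvgD; first exact: cvg_cst.
  apply: cvgM; last exact: cvg_cst.
  by have := @cvg_harmonic R; rewrite -cvg_shiftS; exact.
have E : (fun n : nat => psi (a + n.+2%:R^-1 * (b - a))) = cst c by apply/funext => n; exact: H.
rewrite E in cv.
by rewrite -(cvg_lim (@Rhausdorff R) cv) lim_cst.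
Qed.

Theorem mean_value : avg (circ R) (fun t => complex.Re (k (cis t))) = complex.Re (k 0).
Proof.
have r1_0 := r1_ge0; have r1_1 := r1_lt1.
have -> : avg (circ R) (fun t => complex.Re (k (cis t))) = psi 1.
  by apply: eq_avg => t; rewrite mul1r.
have -> : complex.Re (k 0) = psi 0.
  rewrite /psi -[LHS](avg_cst (circ R)); apply: eq_avg => t /=.
  by rewrite mul0r.
(* The circle of radius [r1] is crossed by limits: from outside [psi r1 = psi 1], from inside
   [psi r1 = psi (r1 / 2)], and the latter value is [psi 0]. *)
have e1 : psi r1 = psi 1.
  apply: (@psi_limit _ 1); [lra|lra|move=> x /andP[? ?]].
  by apply: psi_eq; [nra|nra|nra|left; nra].
rewrite -e1; have [->//|r10] := eqVneq r1 0.
have r1p : 0 < r1 by lra.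
have e2 : psi r1 = psi (r1 / 2).
  apply: (@psi_limit _ (r1 / 2)); [lra|lra|move=> x /andP[? ?]].
  by apply/esym; apply: psi_eq; [nra|nra|nra|right; nra].
rewrite e2; apply/esym; apply: (@psi_limit _ (r1 / 2)); [lra|lra|move=> x /andP[? ?]].
by apply: psi_eq; [nra|nra|nra|right; nra].
Qed.

End MeanValue.

(** * Difference quotients of holomorphic functions *)

Section Holomorphic.
Context (R : realType).
Implicit Types (z w : R[i]) (f g : R[i] -> R[i]).

Definition cderivable f z : Prop := derivable (f : R[i]^o -> R[i]^o) z 1.

Definition ccontinuous f z : Prop := {for z, continuous (f : R[i]^o -> R[i]^o)}.

Lemma cderivable_cst (c : R[i]) z : cderivable (fun=> c) z.
Proof. exact: derivable_cst. Qed.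

Lemma cderivable_id z : cderivable (fun w => w) z.
Proof. exact: derivable_id. Qed.

Lemma cderivableD f g z : cderivable f z -> cderivable g z ->
  cderivable (fun w => f w + g w) z.
Proof. exact: derivableD. Qed.

Lemma cderivableB f g z : cderivable f z -> cderivable g z ->
  cderivable (fun w => f w - g w) z.
Proof. exact: derivableB. Qed.

Lemma cderivableM f g z : cderivable f z -> cderivable g z ->
  cderivable (fun w => f w * g w) z.
Proof. exact: derivableM. Qed.

Lemma cderivableV f z : f z != 0 -> cderivable f z -> cderivable (fun w => (f w)^-1) z.
Proof. exact: derivableV. Qed.

Lemma cderivable_comp f g z : cderivable g z -> cderivable f (g z) ->
  cderivable (fun w => f (g w)) z.
Proof.
move=> /derivable1_diffP gz /derivable1_diffP fz; apply/derivable1_diffP.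
exact: (differentiable_comp gz fz).
Qed.

Lemma cderivable_continuous f z : cderivable f z -> ccontinuous f z.
Proof. by move=> /derivable1_diffP; exact: differentiable_continuous. Qed.

Lemma near_neq z w : w != z -> \forall x \near (w : R[i]^o), x != z.
Proof.
move=> wz.
have d0 : 0 < `|w - z| by rewrite normr_gt0 subr_eq0.
have /cvgrPdist_lt : (x : R[i]^o) @[x --> (w : R[i]^o)] --> (w : R[i]^o) by exact: cvg_id.
move=> /(_ _ d0); apply: filterS => x wx; apply/eqP => xz.
by move: wx; rewrite xz ltxx.
Qed.

Lemma ccontinuousM f g z : ccontinuous f z -> ccontinuous g z ->
  ccontinuous (fun w => f w * g w) z.
Proof. by move=> fz gz; exact: (@continuousM R[i] R[i]^o f g z fz gz). Qed.

Lemma near_ccontinuous f g z : (\forall w \near (z : R[i]^o), f w = g w) ->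
  ccontinuous f z -> ccontinuous g z.
Proof.
move=> fg fz; have gz : (f z : R[i]^o) = g z := nbhs_singleton fg.
have : (g w : R[i]^o) @[w --> (z : R[i]^o)] --> (g z : R[i]^o); last by [].
rewrite -gz; apply: cvg_trans fz; apply: (@near_eq_cvg _ _ _ (nbhs_filter (z : R[i]^o))).
by apply: filterS fg => w /= ->.
Qed.

(** The value at [z] makes the quotient continuous there; differentiability is obtained only
    elsewhere, which [mean_value] tolerates on the circle through [z]. *)
Definition dslope g z w : R[i] :=
  if w == z then 'D_1 (g : R[i]^o -> R[i]^o) z else (g w - g z) / (w - z).

Lemma dslopeE g z w : w != z -> dslope g z w = (g w - g z) / (w - z).
Proof. by rewrite /dslope => /negPf ->. Qed.

Lemma dslope_near g z w : w != z ->
  \forall x \near (w : R[i]^o), (g x - g z) / (x - z) = dslope g z x.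
Proof. by move=> /near_neq; apply: filterS => x xz; rewrite dslopeE. Qed.

Lemma quotient_cderivable g z w : w != z -> cderivable g w ->
  cderivable (fun x => (g x - g z) / (x - z)) w.
Proof.
move=> wz gw; have h1 := cderivableB gw (@cderivable_cst (g z) w).
have h2 := cderivableB (@cderivable_id w) (@cderivable_cst z w).
have wz0 : w - z != 0 by rewrite subr_eq0.
have h3 := @cderivableV (fun x => x - z) w wz0 h2.
exact (@cderivableM (fun x => g x - g z) (fun x => (x - z)^-1) w h1 h3).
Qed.

Lemma dslope_cderivable g z w : w != z -> cderivable g w -> cderivable (dslope g z) w.
Proof.
move=> wz gw; have h := quotient_cderivable wz gw.
exact: (@near_eq_derivable _ R[i]^o R[i]^o _ _ _ _ (dslope_near g wz) h).
Qed.

Lemma dslope_continuous g z w : cderivable g z -> ccontinuous g w -> ccontinuous (dslope g z) w.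
Proof.
move=> gz gw; have [->{w gw}|wz] := eqVneq w z; last first.
  apply: (near_ccontinuous (dslope_near _ wz)); apply: ccontinuousM.
    apply: (@continuousB R[i] R[i]^o R[i]^o g (fun=> g z) w gw); exact: cst_continuous.
  have h2 := cderivableB (@cderivable_id w) (@cderivable_cst z w).
  have wz0 : w - z != 0 by rewrite subr_eq0.
  exact (@cderivable_continuous _ w (@cderivableV (fun x => x - z) w wz0 h2)).
apply/(@cvg_normcP _ _ _ (nbhs_filter (z : R[i]^o))).
apply/(@cvgr0Pnorm_le _ _ _ _ (nbhs_filter (z : R[i]^o))) => e e0.
have [d d0 H] := derivable_cderiv gz e0.
have : \forall x \near (z : R[i]^o), `|z - x| <= d%:C.
  have /cvgrPdist_le : (x : R[i]^o) @[x --> (z : R[i]^o)] --> (z : R[i]^o) by exact: cvg_id.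
  by apply; rewrite ltcR.
apply: filterS => x; rewrite normcE lecR normcBC => xz.
rewrite ger0_norm ?normc_ge0//.
have dzz : dslope g z z = 'D_1 (g : R[i]^o -> R[i]^o) z by rewrite /dslope eqxx.
rewrite dzz /dslope; have [xz0|xz0] := eqVneq x z; first by rewrite subrr Normc.normc0 ltW.
rewrite normcBC.
have xz0' : x - z != 0 by rewrite subr_eq0.
have n0 : 0 < normc (x - z).
  by rewrite lt_neqAle normc_ge0 andbT eq_sym; apply: contra_neq xz0' => /Normc.eq0_normc.
rewrite -(ler_pM2r n0) -normcM.
by rewrite mulrBl divfK//; exact: H.
Qed.

End Holomorphic.

(** * The Poisson formula *)

Section Poisson.
Context (R : realType).
Implicit Types (z w : R[i]) (f g : R[i] -> R[i]).

Definition poisson z (t : R) : R := (1 - normc z ^+ 2) / normc (cis t - z) ^+ 2.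

Lemma normc_sqrE z : (normc z ^+ 2)%:C = z * conjc z.
Proof.
case: z => a b /=; rewrite sqr_sqrtr ?addr_ge0 ?sqr_ge0//.
by apply/eqP; rewrite eq_complex /= !expr2; apply/andP; split; apply/eqP; ring.
Qed.

Lemma normc_conj z : normc (conjc z) = normc z.
Proof. by case: z => a b /=; rewrite sqrrN. Qed.

Lemma cis_conj (t : R) : cis t * conjc (cis t) = 1.
Proof. by rewrite -normc_sqrE normc_cis expr1n. Qed.

Lemma normc_neq0 z : 0 < normc z -> z != 0.
Proof. by apply: contraTneq => ->; rewrite Normc.normc0 ltxx. Qed.

Lemma normc_gt0 z : z != 0 -> 0 < normc z.
Proof.
move=> z0; rewrite lt_neqAle normc_ge0 andbT eq_sym.
by apply: contra_neq z0 => /Normc.eq0_normc.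
Qed.

Lemma normc_lt1_neq0 z : normc z < 1 -> 1 - z != 0.
Proof. by move=> z1; rewrite subr_eq0; apply: contraTneq z1 => <-; rewrite Normc.normc1 ltxx. Qed.

Lemma cis_sub_neq0 z (t : R) : normc z < 1 -> cis t - z != 0.
Proof. by move=> z1; rewrite subr_eq0; apply: contraTneq z1 => <-; rewrite normc_cis ltxx. Qed.

(** On the circle the conjugate of [cis t] is its inverse, which turns the squared distance to [z]
    into a rational expression in [cis t]. *)
Lemma poissonE z (t : R) : normc z < 1 ->
  (poisson z t)%:C = (1 - z * conjc z) * cis t / ((cis t - z) * (1 - conjc z * cis t)).
Proof.
move=> z1.
have n1 : normc (conjc z * cis t) < 1 by rewrite normcM normc_cis mulr1 normc_conj.
have h1 := normc_lt1_neq0 n1; have h2 := cis_sub_neq0 t z1.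
have -> : (poisson z t)%:C = (1 - normc z ^+ 2)%:C / (normc (cis t - z) ^+ 2)%:C.
  exact: (fmorph_div (real_complex R)).
have -> : (1 - normc z ^+ 2)%:C = 1 - z * conjc z.
  by rewrite -normc_sqrE; exact: (rmorphB (real_complex R)).
rewrite normc_sqrE.
have h3 : cis t != 0 by apply: normc_neq0; rewrite normc_cis.
have -> : conjc (cis t - z) = conjc (cis t) - conjc z by exact: rmorphB.
have -> : conjc (cis t) = (cis t)^-1 by apply: (mulfI h3); rewrite cis_conj divff.
by field; rewrite h1 h2 h3.
Qed.

(** The conjugate falls on [z], not on [cis t]: the right side is the real part of a function
    holomorphic in the variable [cis t], to which [mean_value] applies. *)
Lemma poisson_Re z (t : R) : normc z < 1 ->
  poisson z t = complex.Re ((1 + conjc z * cis t) / (1 - conjc z * cis t)).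
Proof.
move=> z1.
have n1 : normc (conjc z * cis t) < 1 by rewrite normcM normc_cis mulr1 normc_conj.
have h1 := normc_lt1_neq0 n1.
have Re2 (x : R[i]) : (complex.Re x)%:C = (x + conjc x) / 2.
  by rewrite ReJ_add; field.
have Ec (a : R[i]) : conjc ((1 + a) / (1 - a)) = (1 + conjc a) / (1 - conjc a).
  by rewrite (fmorph_div (conjc : R[i] -> R[i])) rmorphD rmorphB rmorph1.
have Em : conjc (conjc z * cis t) = z * conjc (cis t) by rewrite -{2}(conjcK z); exact: (rmorphM (conjc : R[i] -> R[i])).
apply: complexI; rewrite poissonE// Re2 Ec Em.
have h3 : cis t != 0 by apply: normc_neq0; rewrite normc_cis.
have -> : conjc (cis t) = (cis t)^-1 by apply: (mulfI h3); rewrite cis_conj divff.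
have h2 := cis_sub_neq0 t z1.
have h4 : 1 - z / cis t != 0 by rewrite -(mulIr_eq0 _ (mulIf h3)) mulrBl mul1r divfK.
by field; rewrite h1 h2 h3.
Qed.

End Poisson.

Section PoissonFormula.
Context (R : realType).
Implicit Types (z w : R[i]) (f g : R[i] -> R[i]).

Lemma Re_mulr w (r : R) : complex.Re (w * r%:C) = complex.Re w * r.
Proof. by case: w => a b /=; rewrite mulr0 subr0. Qed.

Lemma normc_cis_sub z (t : R) : 1 - normc z <= normc (cis t - z) <= 1 + normc z.
Proof.
have := normc_triangle (cis t) z; have := normcD (cis t) (- z).
by rewrite normcN normc_cis => ? ?; apply/andP; split; lra.
Qed.

Lemma poisson_le z (t : R) : normc z < 1 -> poisson z t <= (1 + normc z) / (1 - normc z).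
Proof.
move=> z1; have /andP[] := normc_cis_sub z t; rewrite /poisson.
have := normc_ge0 z; move: (normc z) (normc (cis t - z)) z1 => r n r1 r0 n1 n2.
have n0 : 0 < n by lra.
rewrite ler_pdivrMr ?exprn_gt0// mulrAC ler_pdivlMr ?subr_gt0//.
have : (1 - r) ^+ 2 <= n ^+ 2 by rewrite !expr2; apply: ler_pM; lra.
nra.
Qed.

Lemma poisson_ge z (t : R) : normc z < 1 -> (1 - normc z) / (1 + normc z) <= poisson z t.
Proof.
move=> z1; have /andP[] := normc_cis_sub z t; rewrite /poisson.
have := normc_ge0 z; move: (normc z) (normc (cis t - z)) z1 => r n r1 r0 n1 n2.
have n0 : 0 < n by lra.
rewrite ler_pdivlMr ?exprn_gt0// mulrAC ler_pdivrMr; last lra.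
have : n ^+ 2 <= (1 + r) ^+ 2 by rewrite !expr2; apply: ler_pM; lra.
nra.
Qed.

Lemma poisson_gt0 z (t : R) : normc z < 1 -> 0 < poisson z t.
Proof.
move=> z1; apply: lt_le_trans (poisson_ge t z1).
by rewrite divr_gt0 ?subr_gt0// ltr_pwDl// normc_ge0.
Qed.

(** Uniform in [t]; the bound is twice the quantity that [hratio_contraction] shrinks, and this is
    how contraction becomes decorrelation. *)
Lemma poisson_sub1 z (t : R) : normc z < 1 ->
  `|poisson z t - 1| <= 2 * (normc z / (1 - normc z)).
Proof.
move=> z1; have := poisson_le t z1; have := poisson_ge t z1; have := normc_ge0 z.
move: (normc z) (poisson z t) z1 => r p r1 r0.
rewrite ler_pdivrMr ?ler_pdivlMr ?subr_gt0; [|lra..] => h1 h2.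
have AE : 2 * (r / (1 - r)) * (1 - r) = 2 * r by field; rewrite gt_eqF// subr_gt0.
have r10 : 0 < 1 - r by rewrite subr_gt0.
rewrite ler_norml; apply/andP; split; rewrite -(ler_pM2r r10) ?mulNr AE; last lra.
have [p1|p1] := leP 1 p; last by nra.
by have := mulr_ge0 (_ : 0 <= p - 1) (ltW r10); rewrite subr_ge0 => /(_ p1); lra.
Qed.

Lemma measurable_poisson z : normc z < 1 -> measurable_fun setT (poisson z).
Proof.
move=> z1; apply: continuous_measurable_fun => t.
apply: cvgM; first exact: cvg_cst.
apply: cvgV.
  by rewrite expf_neq0// gt_eqF//; have /andP[+ _] := normc_cis_sub z t; apply: lt_le_trans; rewrite subr_gt0.
have h : normc (cis x - z) @[x --> t] --> normc (cis t - z).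
  apply: cvg_normc; apply: (@cvgB R[i] R[i]^o); [exact: cvg_cis|exact: cvg_cst].
by rewrite expr2; apply: cvgM.
Qed.

Lemma bmf_poisson z : normc z < 1 -> bounded_mfun (poisson z).
Proof.
move=> z1; split; first exact: measurable_poisson.
exists ((1 + normc z) / (1 - normc z)) => t.
by rewrite ger0_norm ?poisson_le// ltW// poisson_gt0.
Qed.

Let one_sub_cderivable z (r0 : R) w : normc w < r0 -> normc z * r0 <= 1 ->
  cderivable (fun x => (1 - conjc z * x)^-1) w.
Proof.
move=> wr zr.
have h0 : 1 - conjc z * w != 0.
  apply: normc_lt1_neq0; rewrite normcM normc_conj.
  have := normc_ge0 z; have := normc_ge0 w.
  have [->|z0] := eqVneq (normc z) 0; first by rewrite mul0r.
  by move=> w0 z0'; apply: lt_le_trans zr; rewrite ltr_pM2l// lt_neqAle eq_sym z0.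
have h1 := cderivableM (@cderivable_cst R (conjc z) w) (@cderivable_id R w).
have h2 := cderivableB (@cderivable_cst R 1 w) h1.
exact (@cderivableV R (fun x => 1 - conjc z * x) w h0 h2).
Qed.

Let radius z : normc z < 1 -> exists2 r : R, 1 < r & normc z * r <= 1.
Proof.
move=> z1; exists (2 / (1 + normc z)); have := normc_ge0 z; move: (normc z) z1 => r r1 r0.
  by rewrite ltr_pdivlMr ?mul1r; lra.
by rewrite mulrA ler_pdivrMr ?mul1r; lra.
Qed.

Lemma avg_poisson z : normc z < 1 -> avg (circ R) (poisson z) = 1.
Proof.
move=> z1; have [r r1 zr] := radius z1.
pose k w := (1 + conjc z * w) * (1 - conjc z * w)^-1.
have kd w : normc w < r -> cderivable k w.
  move=> wr; have h1 := cderivableM (@cderivable_cst R (conjc z) w) (@cderivable_id R w).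
  have h2 := cderivableD (@cderivable_cst R 1 w) h1.
  exact (@cderivableM R (fun x => 1 + conjc z * x) _ w h2 (one_sub_cderivable wr zr)).
have -> : 1 = complex.Re (k 0) by rewrite /k mulr0 addr0 subr0 invr1 mulr1.
rewrite -(@mean_value R k r 0).
- by apply: eq_avg => t; rewrite poisson_Re.
- exact: r1.
- exact: lexx.
- exact: ltr01.
- by move=> w wr; apply: cderivable_continuous; exact: kd.
- by move=> w _ wr _; exact: kd.
Qed.

(** The mean value property is applied to w (g(w) - g(z)) / (w - z) / (1 - conj(z) w). It vanishes
    at 0, and on the circle it is (g - g(z)) times the Poisson kernel, up to the factor 1 - |z|^2.
    The point 0 is exempted from differentiability so that [g] may be a dilate of f(z) / z. *)
Theorem poisson_formula g z (r0 : R) : 1 < r0 -> normc z < 1 ->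
  (forall w, normc w < r0 -> ccontinuous g w) ->
  (forall w, normc w < r0 -> w != 0 -> cderivable g w) ->
  cderivable g z ->
  avg (circ R) (fun t => complex.Re (g (cis t)) * poisson z t) = complex.Re (g z).
Proof.
move=> r01 z1 gc gd gz; have [r r1 zr] := radius z1.
pose k w := w * dslope g z w * (1 - conjc z * w)^-1.
have : avg (circ R) (fun t => complex.Re (k (cis t))) = complex.Re (k 0).
  apply: (@mean_value R k (Num.min r r0) (normc z)).
  - by rewrite lt_min r1.
  - exact: normc_ge0.
  - exact: z1.
  - move=> w; rewrite lt_min => /andP[wr wr0].
    have h1 := cderivable_continuous (one_sub_cderivable wr zr).
    have h2 := dslope_continuous gz (gc w wr0).
    have h3 := cderivable_continuous (@cderivable_id R w).
    exact (ccontinuousM (ccontinuousM h3 h2) h1).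
  - move=> w w0; rewrite lt_min => /andP[wr wr0] wz.
    have wz' : w != z by apply: contra_neq wz => ->.
    have w0' : w != 0 by exact: normc_neq0.
    have h1 := one_sub_cderivable wr zr.
    have h2 := dslope_cderivable wz' (gd w wr0 w0').
    exact (cderivableM (cderivableM (@cderivable_id R w) h2) h1).
have -> : complex.Re (k 0) = 0 by rewrite /k !mul0r.
have c0 : 0 < 1 - normc z ^+ 2 by rewrite subr_gt0 expr_lt1// normc_ge0.
have kE t : complex.Re (k (cis t)) = (1 - normc z ^+ 2)^-1 *
    (complex.Re (g (cis t)) * poisson z t - complex.Re (g z) * poisson z t).
  apply: (mulfI (lt0r_neq0 c0)); rewrite mulVKf ?lt0r_neq0//.
  have cz : cis t != z by rewrite -subr_eq0; exact: cis_sub_neq0.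
  rewrite -!Re_mulr -raddfB/= -mulrBl mulrC -Re_mulr; congr complex.Re.
  have -> : (1 - normc z ^+ 2)%:C = 1 - z * conjc z.
    by rewrite -normc_sqrE; exact: (rmorphB (real_complex R)).
  rewrite poissonE// /k dslopeE//.
  have h2 := cis_sub_neq0 t z1.
  have h1 : 1 - conjc z * cis t != 0.
    by apply: normc_lt1_neq0; rewrite normcM normc_cis mulr1 normc_conj.
  by field; rewrite h1 h2.
have [M MP] : exists M, forall w, normc w <= 1 -> normc (g w) <= M.
  by apply: disc_bounded => w w1; apply: gc; exact: le_lt_trans r01.
have bg : bounded_mfun (fun t => complex.Re (g (cis t))).
  split; last first.
    by exists M => t; apply: (le_trans (abs_Re_le _)); apply: MP; rewrite normc_cis.
  apply: continuous_measurable_fun => t; apply: cvg_Re.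
  apply: (@cvg_comp _ _ _ (@cis R : R -> R[i]^o) (g : R[i]^o -> R[i]^o) _ (nbhs (cis t : R[i]^o))).
    exact: cvg_cis.
  by apply: gc; rewrite normc_cis.
have bp := bmf_poisson z1.
have b1 := bmfM bg bp; have b2 := bmfZ (complex.Re (g z)) bp.
rewrite (funext kE) => H.
have : (1 - normc z ^+ 2)^-1 * (avg (circ R) (fun t => complex.Re (g (cis t)) * poisson z t)
    - complex.Re (g z) * avg (circ R) (poisson z)) = 0.
  rewrite -(@avgZ _ _ _ (circ R) _ _ bp) -(@avgB _ _ _ (circ R) _ _ b1 b2).
  by rewrite -(@avgZ _ _ _ (circ R) _ _ (bmfB b1 b2)).
by rewrite avg_poisson// mulr1 => /eqP; rewrite mulf_eq0 invr_eq0 gt_eqF//= subr_eq0 => /eqP.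
Qed.

End PoissonFormula.

(** * Boundary maps of inner functions *)

Section Argument.
Context (R : realType).
Implicit Types (z w : R[i]).

Definition arg z : R :=
  if 0 <= complex.Im z then acos (complex.Re z) else 2 * pi - acos (complex.Re z).

Lemma cis_arg z : normc z = 1 -> cis (arg z) = z.
Proof.
case: z => x y n1; have : x ^+ 2 + y ^+ 2 = 1.
  by have := normc_sqr (x +i* y); rewrite n1 expr1n => /= <-.
move=> xy; have x2 : x ^+ 2 <= 1 by have := sqr_ge0 y; lra.
have x1 : -1 <= x <= 1.
  by rewrite -ler_norml -(@ler_pXn2r _ 2%N) ?nnegrE// real_normK ?num_real// expr1n.
have cx : cos (acos x) = x by rewrite acosK// in_itv/=.
have y2 : 1 - x ^+ 2 = y ^+ 2 by lra.
rewrite /arg /cis /=; have [y0|y0] := leP 0 y.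
  by rewrite cx sin_acos// y2 sqrtr_sqr ger0_norm.
have -> : 2 * pi - acos x = - acos x + pi *+ 2 by rewrite mulr_natl addrC.
rewrite cosD2pi sinD2pi cosN sinN cx sin_acos// y2 sqrtr_sqr ltr0_norm//.
by rewrite opprK.
Qed.

Lemma arg_itv z : normc z = 1 -> 0 <= arg z < 2 * pi.
Proof.
case: z => x y n1; have : x ^+ 2 + y ^+ 2 = 1.
  by have := normc_sqr (x +i* y); rewrite n1 expr1n => /= <-.
move=> xy; have x2 : x ^+ 2 <= 1 by have := sqr_ge0 y; lra.
have x1 : -1 <= x <= 1.
  by rewrite -ler_norml -(@ler_pXn2r _ 2%N) ?nnegrE// real_normK ?num_real// expr1n.
have p0 := pi_gt0 R; have a0 := acos_ge0 x1; have ap := acos_lepi x1.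
rewrite /arg /=; have [y0|y0] := leP 0 y; first by apply/andP; split; lra.
have x1' : x < 1.
  rewrite lt_neqAle; have /andP[_ ->] := x1; rewrite andbT.
  apply/eqP => x1e; have : y ^+ 2 = 0 by move: xy; rewrite x1e expr1n; lra.
  by move=> /eqP; rewrite sqrf_eq0 lt_eqF.
have := @acos_gt0 _ x; have /andP[-> _] := x1; rewrite x1' => /(_ isT) ?.
by apply/andP; split; lra.
Qed.

(** Continuity is used on the open interval; the two endpoints are added as singletons. *)
Lemma measurable_acos : measurable_fun `[(-1 : R), 1]%classic (@acos R).
Proof.
have -> : `[(-1 : R), 1]%classic = [set -1] `|` `](-1), 1[%classic `|` [set 1].
  by rewrite setU1itv ?bnd_simp ?setUitv1 ?bnd_simp//; lra.
apply/measurable_funU => //; first exact: measurableU.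
split; last exact: measurable_fun_set1.
apply/measurable_funU => //; split; first exact: measurable_fun_set1.
apply: open_continuous_measurable_fun; first exact: interval_open.
by move=> x; rewrite inE/= in_itv/=; exact: continuous_acos.
Qed.

Lemma measurable_arg d (T : measurableType d) (x y : T -> R) :
  measurable_fun setT x -> measurable_fun setT y -> (forall t, -1 <= x t <= 1) ->
  measurable_fun setT (fun t => arg (x t +i* y t)).
Proof.
move=> mx my x1; rewrite /arg /=.
have ma : measurable_fun setT (fun t => acos (x t)).
  apply: (@measurable_comp _ _ _ _ _ _ `[(-1 : R), 1]%classic) => //.
    by move=> _ [t _ <-]; rewrite /= in_itv/=.
  exact: measurable_acos.
apply: measurable_fun_ifT => //; first exact: measurable_fun_ler.
by apply: measurable_funB => //; exact: measurable_cst.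
Qed.

End Argument.

Section CircleMeasure.
Context (R : realType).
Local Notation leb := (@lebesgue_measure R).

Lemma circE (A : set R) : measurable A ->
  circ R A = ((2 * pi)^-1%:E * leb (A `&` `[0%R, (2 * pi)%R]))%E.
Proof.
move=> mA; rewrite /circ /= /uniform_prob integral_uniform_pdf.
rewrite (eq_integral (fun=> (2 * pi)^-1%:E)); last first.
  by move=> x; rewrite inE/= => -[_]; rewrite in_itv/= /uniform_pdf subr0 => ->.
by rewrite integral_cst//; exact: measurableI.
Qed.

Lemma circ_off : circ R (~` `[0%R, (2 * pi)%R[%classic) = 0%E.
Proof.
rewrite circE; last exact: measurableC.
rewrite (_ : _ `&` _ = [set 2 * pi]); first by rewrite lebesgue_measure_set1 mule0.
apply/seteqP; split => x /=; rewrite !in_itv/=.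
  by move=> [/negP]; rewrite negb_and -!ltNge -leNgt => /orP[] ? /andP[? ?]; lra.
move=> ->; rewrite ltxx andbF lexx ltW ?pi2_gt0//.
Qed.

(** [circ] is carried by [0, 2 pi], whose right endpoint is null. This is the bridge to
    [ae_circle]. *)
Lemma ae_circP (Q : R -> Prop) :
  {ae leb, forall t, 0 <= t < 2 * pi -> Q t} <-> {ae circ R, forall t, Q t}.
Proof.
split=> [[N [mN N0 NQ]]|[N [mN N0 NQ]]].
- exists (N `|` ~` `[0%R, (2 * pi)%R[%classic); split.
  + by apply: measurableU => //; exact: measurableC.
  + apply: null_set_setU => //; [exact: measurableC| |exact: circ_off].
    apply: (eq_trans (circE mN)); rewrite (_ : leb (N `&` _) = 0%E) ?mule0//.
    apply/eqP; rewrite eq_le measure_ge0 andbT -N0 le_measure ?inE//.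
    by apply: measurableI.
  + move=> t /= nQ; have [tI|tI] := pselect (0 <= t < 2 * pi); last first.
      by right; rewrite /= in_itv/=.
    by left; apply: NQ => /= H; apply: nQ; exact: H.
- exists (N `&` `[0%R, (2 * pi)%R]); split.
  + exact: measurableI.
  + have /eqP := eq_trans (esym (circE mN)) N0; rewrite mule_eq0 => /orP[|/eqP//].
    by rewrite eqe invr_eq0 gt_eqF// pi2_gt0.
  + move=> t /= /not_implyP[/andP[t0 t1] nQ]; split; first exact: NQ.
    by rewrite /= in_itv/= t0 ltW.
Qed.

End CircleMeasure.

Section BoundaryMap.
Context (R : realType).
Implicit Types (z w : R[i]) (f : R[i] -> R[i]).

Lemma normc_lt1P z : (`|z| < 1) = (normc z < 1).
Proof. by rewrite normcE ltcR. Qed.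

(** Starting at [n.+2] keeps every radius at least 1/2, as [rkernel_far] requires. *)
Definition radii (n : nat) : R := 1 - n.+2%:R^-1.

Lemma radii_itv n : 0 < radii n < 1.
Proof.
have : 0 < (n.+2%:R : R)^-1 < 1 by rewrite invr_gt0 ltr0n /= invf_lt1 ?ltr0n// ltr1n.
by rewrite /radii; move: (n.+2%:R^-1) => q /andP[? ?]; apply/andP; split; lra.
Qed.

Lemma cvg_radii : radii n @[n --> \oo] --> (1 : R).
Proof.
rewrite -[X in _ --> X]subr0; apply: cvgB; first exact: cvg_cst.
by have := @cvg_harmonic R; rewrite -cvg_shiftS; exact.
Qed.

Lemma radii_at_left : radii n @[n --> \oo] --> (1 : R)^'-.
Proof.
move=> A [e /= e0 eA]; have /cvgrPdist_lt /(_ _ e0) := cvg_radii.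
apply: filterS => n H; apply: eA => //=.
by have /andP[] := radii_itv n.
Qed.

Lemma inner_cderivable f z : inner_function f -> normc z < 1 -> cderivable f z.
Proof. by move=> [_ fh _] z1; apply: fh; rewrite normc_lt1P. Qed.

Lemma inner_lt1 f z : inner_function f -> normc z < 1 -> normc (f z) < 1.
Proof. by move=> [fD _ _]; rewrite -!normc_lt1P; exact: fD. Qed.

Lemma normc_radius (r t : R) : 0 <= r -> normc (r%:C * cis t) = r.
Proof. by move=> r0; rewrite normc_realM// normc_cis mulr1. Qed.

(* Radial limits are taken along [radii], which is enough for dominated convergence. *)
Definition is_boundary_map f (T : R -> R) : Prop :=
  [/\ measurable_fun setT T, forall t, 0 <= T t < 2 * pi &
    {ae circ R, forall t, radial_extension f (cis t) = cis (T t) /\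
      (f ((radii n)%:C * cis t) : R[i]^o) @[n --> \oo] --> (cis (T t) : R[i]^o)}].

(** [T] is the argument of the radial limit. Off the exceptional null set that limit is a pointwise
    limit of continuous functions, whence measurability. *)
Lemma boundary_map_exists f : inner_function f -> exists T, is_boundary_map f T.
Proof.
move=> fI; have [_ _ /ae_circP[N [mN N0 NP]]] := fI.
pose rad t := radial_extension f (cis t).
have radP t : ~ N t -> (f ((radii n)%:C * cis t) : R[i]^o) @[n --> \oo] --> (rad t : R[i]^o) /\
    normc (rad t) = 1.
  move=> Nt; have [] : cvg (along_radius f (cis t)) /\ `|radial_extension f (cis t)| = 1.
    by apply: contrapT => H; apply: Nt; apply: NP.
  move=> cv; rewrite normcE => /complexI ->; split => //.
  exact: (cvg_comp _ _ radii_at_left cv).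
have mf n (h : R[i] -> R) : (forall (F : set_system R) (FF : Filter F) (u : R -> R[i]) z,
     (u x : R[i]^o) @[x --> F] --> (z : R[i]^o) -> h (u x) @[x --> F] --> h z) ->
   measurable_fun setT (fun t => h (f ((radii n)%:C * cis t))).
  move=> hc; apply: continuous_measurable_fun => t; apply: hc.
  have /andP[r0 r1] := radii_itv n.
  apply: (@cvg_comp _ _ _ (fun x => ((radii n)%:C * cis x) : R[i]^o) (f : R[i]^o -> R[i]^o) _
    (nbhs ((radii n)%:C * cis t : R[i]^o))).
    by apply: cvgM; [exact: cvg_cst|exact: cvg_cis].
  by apply: cderivable_continuous; apply: inner_cderivable => //; rewrite normc_radius// ltW.
(* On the null set the default value is the point 1, so that [x t +i* y t] is a unit vector for
   every [t] and its argument lies in [0, 2 pi). *)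
pose x t := if t \in N then 1 else complex.Re (rad t).
pose y t := if t \in N then 0 else complex.Im (rad t).
have mN' : measurable_fun setT (fun t => t \in N).
  apply: (measurable_fun_bool true); rewrite setTI (_ : _ @^-1` _ = N)//.
  by apply/seteqP; split => t /= Nt; [exact/set_mem/Nt|exact/mem_set].
have mx : measurable_fun setT x.
  apply: measurable_fun_if => //.
  apply: (@measurable_fun_cvg _ _ _ _ (fun n t => complex.Re (f ((radii n)%:C * cis t)))).
    by move=> n; apply: measurable_funTS; apply: (mf n) => *; exact: cvg_Re.
  move=> t [_ /=] /negbT; rewrite notin_setE => Nt.
  by apply: cvg_Re; have [] := radP t Nt.
have my : measurable_fun setT y.
  apply: measurable_fun_if => //.
  apply: (@measurable_fun_cvg _ _ _ _ (fun n t => complex.Im (f ((radii n)%:C * cis t)))).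
    by move=> n; apply: measurable_funTS; apply: (mf n) => *; exact: cvg_Im.
  move=> t [_ /=] /negbT; rewrite notin_setE => Nt.
  by apply: cvg_Im; have [] := radP t Nt.
have xyE t : ~ N t -> x t +i* y t = rad t.
  by rewrite /x /y -notin_setE => /negPf ->; case: (rad t).
have xy1 t : normc (x t +i* y t) = 1.
  have [Nt|Nt] := pselect (N t); last by rewrite xyE//; have [] := radP t Nt.
  by rewrite /x /y mem_set//; exact: Normc.normc1.
exists (fun t => arg (x t +i* y t)); split.
- apply: measurable_arg => // t; rewrite -ler_norml.
  by have := abs_Re_le (x t +i* y t); rewrite xy1.
- by move=> t; exact: arg_itv.
- exists N; split => // t /= H; apply: contrapT => Nt; apply: H.
  by rewrite cis_arg// xyE//; split => //; have [] := radP t Nt.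
Qed.

End BoundaryMap.

Section BoundaryPoisson.
Context (R : realType).
Implicit Types (z w : R[i]) (f : R[i] -> R[i]).

(** The Herglotz kernel: its real part extends [poisson w] harmonically into the disc, and being
    holomorphic it can be composed with [f]. *)
Definition herglotz w z : R[i] := (1 + conjc w * z) * (1 - conjc w * z)^-1.

Lemma herglotz_cderivable_mul w z : normc w * normc z < 1 -> cderivable (herglotz w) z.
Proof.
move=> wz.
have h0 : 1 - conjc w * z != 0 by apply: normc_lt1_neq0; rewrite normcM normc_conj.
have h1 := cderivableM (@cderivable_cst R (conjc w) z) (@cderivable_id R z).
have h2 := cderivableB (@cderivable_cst R 1 z) h1.
have h3 := cderivableD (@cderivable_cst R 1 z) h1.
have h4 := @cderivableV R (fun x => 1 - conjc w * x) z h0 h2.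
exact (@cderivableM R (fun x => 1 + conjc w * x) _ z h3 h4).
Qed.

Lemma herglotz_cderivable w z : normc w < 1 -> normc z <= 1 -> cderivable (herglotz w) z.
Proof.
move=> w1 z1; apply: herglotz_cderivable_mul.
by apply: le_lt_trans w1; rewrite ler_piMr ?normc_ge0.
Qed.

Lemma avg_poisson_poisson z w : normc z < 1 -> normc w < 1 ->
  avg (circ R) (fun t => poisson w t * poisson z t) = complex.Re (herglotz w z).
Proof.
move=> z1 w1; have w0 := normc_ge0 w.
have d x : normc x < 2 / (1 + normc w) -> cderivable (herglotz w) x.
  move=> xr; apply: herglotz_cderivable_mul; have x0 := normc_ge0 x.
  have {}xr : normc x * (1 + normc w) < 2 by rewrite -ltr_pdivlMr// ltr_pwDl.
  have [x1|x1] := leP (normc x) 1; last by lra.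
  by apply: le_lt_trans w1; rewrite ler_piMr.
have r1 : 1 < 2 / (1 + normc w) by rewrite ltr_pdivlMr; lra.
rewrite -(@poisson_formula R (herglotz w) z _ r1 z1).
- by congr avg; apply/funext => t; rewrite -poisson_Re.
- by move=> x xr; apply: cderivable_continuous; exact: d.
- by move=> x xr _; exact: d.
- by apply: d; exact: lt_trans r1.
Qed.

Lemma poisson_herglotz w (t : R) : normc w < 1 -> poisson w t = complex.Re (herglotz w (cis t)).
Proof. exact: poisson_Re. Qed.

Lemma Re_herglotz_le w z : normc w < 1 -> normc z <= 1 ->
  `|complex.Re (herglotz w z)| <= 2 / (1 - normc w).
Proof.
move=> w1 z1; apply: (le_trans (abs_Re_le _)); rewrite /herglotz normcM.
have wz : normc (conjc w * z) <= normc w.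
  by rewrite normcM normc_conj ler_piMr ?normc_ge0.
have h1 : normc (1 + conjc w * z) <= 2.
  by apply: (le_trans (normcD _ _)); rewrite Normc.normc1; lra.
have h2 : 1 - normc w <= normc (1 - conjc w * z).
  have := normc_triangle 1 (conjc w * z); rewrite Normc.normc1; lra.
rewrite Normc.normcV ler_pM ?normc_ge0 ?invr_ge0 ?normc_ge0//.
by rewrite lef_pV2 ?posrE ?subr_gt0//; apply: lt_le_trans h2; rewrite subr_gt0.
Qed.

Lemma cvg_herglotz w (u : nat -> R[i]) z : normc w < 1 -> normc z <= 1 ->
  (u n : R[i]^o) @[n --> \oo] --> (z : R[i]^o) ->
  complex.Re (herglotz w (u n)) @[n --> \oo] --> complex.Re (herglotz w z).
Proof.
move=> w1 z1 uz; apply: cvg_Re.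
apply: (@cvg_comp _ _ _ (u : nat -> R[i]^o) (herglotz w : R[i]^o -> R[i]^o) _ (nbhs (z : R[i]^o))).
  exact: uz.
by apply: cderivable_continuous; exact: herglotz_cderivable.
Qed.

Variables (f : R[i] -> R[i]) (T : R -> R).
Hypothesis f_inner : inner_function f.
Hypothesis fT : is_boundary_map f T.

Let dilate_cderivable n z : normc z * radii R n < 1 -> cderivable (fun x => f ((radii R n)%:C * x)) z.
Proof.
have /andP[r0 r1] := radii_itv R n => zr.
have h1 := cderivableM (@cderivable_cst R (radii R n)%:C z) (@cderivable_id R z).
apply: (@cderivable_comp R f (fun x => (radii R n)%:C * x) z h1).
by apply: inner_cderivable => //; rewrite normc_realM ?ltW// mulrC.
Qed.

Lemma poisson_dilate n z w : normc z < 1 -> normc w < 1 ->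
  avg (circ R) (fun t => complex.Re (herglotz w (f ((radii R n)%:C * cis t))) * poisson z t) =
  complex.Re (herglotz w (f ((radii R n)%:C * z))).
Proof.
move=> z1 w1; have /andP[r0 r1] := radii_itv R n.
pose g x := herglotz w (f ((radii R n)%:C * x)).
have gd x : normc x < (radii R n)^-1 -> cderivable g x.
  move=> xr; have xr' : normc x * radii R n < 1 by rewrite -ltr_pdivlMr// mul1r.
  apply: (cderivable_comp (dilate_cderivable xr')).
  apply: herglotz_cderivable => //; apply/ltW/inner_lt1 => //.
  by rewrite normc_realM ?ltW// mulrC.
have r1' : 1 < (radii R n)^-1 by rewrite invf_gt1.
apply: (@poisson_formula R g z (radii R n)^-1 r1' z1).
- by move=> x xr; apply: cderivable_continuous; exact: gd.
- by move=> x xr _; exact: gd.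
- by apply: gd; exact: lt_trans r1'.
Qed.

(** Both sides equal the real part of [herglotz w (f z)]: the left one as the limit of
    [poisson_dilate] along [radii], the right one by [avg_poisson_poisson]. *)
Theorem boundary_poisson z w : normc z < 1 -> normc w < 1 ->
  avg (circ R) (fun t => poisson w (T t) * poisson z t) =
  avg (circ R) (fun t => poisson w t * poisson (f z) t).
Proof.
move=> z1 w1; have [mT _ fTae] := fT.
have fz1 := inner_lt1 f_inner z1.
have lim1 : avg (circ R) (fun t => complex.Re (herglotz w (f ((radii R n)%:C * cis t))) * poisson z t)
   @[n --> \oo] --> avg (circ R) (fun t => poisson w (T t) * poisson z t).
  have mp v : normc v < 1 -> measurable_fun setT (poisson v) by exact: measurable_poisson.
  apply: (@avg_dct _ _ _ _ _ _ (2 / (1 - normc w) * ((1 + normc z) / (1 - normc z)))).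
  - move=> n; apply: measurable_funM; last exact: mp.
    apply: continuous_measurable_fun => t; apply: cvg_Re.
    have /andP[r0 r1] := radii_itv R n.
    have c1 : (((radii R n)%:C * cis x) : R[i]^o) @[x --> t] --> ((radii R n)%:C * cis t : R[i]^o).
      by apply: cvgM; [exact: cvg_cst|exact: cvg_cis].
    have nr : normc ((radii R n)%:C * cis t) < 1 by rewrite normc_radius// ltW.
    have h1 := inner_cderivable f_inner nr.
    have h2 := herglotz_cderivable w1 (ltW (inner_lt1 f_inner nr)).
    have := cderivable_continuous (@cderivable_comp R (herglotz w) f _ h1 h2).
    by move=> h3; exact: (cvg_comp _ _ c1 h3).
  - by apply: measurable_funM; [apply: measurableT_comp => //; exact: mp|exact: mp].
  - move=> n t; rewrite normrM ler_pM//.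
      apply: Re_herglotz_le => //; apply/ltW/inner_lt1 => //.
      by have /andP[r0 r1] := radii_itv R n; rewrite normc_radius// ltW.
    by rewrite ger0_norm ?poisson_le// ltW// poisson_gt0.
  - apply: (@filterS _ _ (ae_filter_ringOfSetsType (circ R)) _ _ _ fTae) => t [_ ct]; apply: cvgM; last exact: cvg_cst.
    by rewrite poisson_herglotz//; apply: cvg_herglotz => //; rewrite normc_cis.
have lim2 : complex.Re (herglotz w (f ((radii R n)%:C * z))) @[n --> \oo] -->
    complex.Re (herglotz w (f z)).
  apply: cvg_herglotz => //; first exact: ltW.
  have c1 : (((radii R n)%:C * z) : R[i]^o) @[n --> \oo] --> (z : R[i]^o).
    rewrite -[X in _ --> X]mul1r; apply: cvgM; last exact: cvg_cst.
    by apply: (cvg_comp _ _ (@cvg_radii R)); exact: cvg_realC.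
  exact: (cvg_comp _ _ c1 (cderivable_continuous (inner_cderivable f_inner z1))).
have E n := poisson_dilate n z1 w1.
rewrite (funext E) in lim1.
rewrite -(cvg_lim (@Rhausdorff R) lim1) (cvg_lim (@Rhausdorff R) lim2).
by rewrite avg_poisson_poisson.
Qed.

End BoundaryPoisson.

(** * Measures with a density, and extension from indicators to bounded functions *)

Section Density.
Context d (T : measurableType d) (R : realType) (mu : {measure set T -> \bar R}).
Variables (g : T -> R) (mg : measurable_fun setT g) (g0 : forall x, 0 <= g x).

(** Carrying [mg] and [g0] as arguments lets the measure structure be inferred from the term. *)
Definition density (mg : measurable_fun setT g) (g0 : forall x, 0 <= g x) (A : set T) : \bar R :=
  (\int[mu]_(x in A) (g x)%:E)%E.

Local Notation nu := (density mg g0).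

Let density0 : nu set0 = 0%E.
Proof. by rewrite /density integral_set0. Qed.

Let density_ge0 A : (0 <= nu A)%E.
Proof. by apply: integral_ge0 => x _; rewrite lee_fin. Qed.

Let density_sigma_additive : semi_sigma_additive nu.
Proof.
move=> /= F mF tF mUF; rewrite /density; apply: cvg_toP.
  apply: ereal_nondecreasing_is_cvgn => m n mn.
  apply: lee_sum_nneg_natr => // k _ _.
  by apply: integral_ge0 => /= x Fkx; rewrite lee_fin.
rewrite ge0_integral_bigcup//=.
- by apply/measurable_EFinP; exact: measurable_funTS.
- by move=> x _; rewrite lee_fin.
Qed.

HB.instance Definition _ := isMeasure.Build _ _ _ nu
  density0 density_ge0 density_sigma_additive.

End Density.

Section BoundedInduction.
Context d (T : measurableType d) (R : realType).
Implicit Types g h : T -> R.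
Import HBNNSimple.

(** A functional class argument: indicators give simple functions, and these approximate a
    nonnegative bounded function from below. *)
Lemma bounded_mfun_ind (C : (T -> R) -> Prop) :
  (forall A, measurable A -> C (\1_A)) ->
  (forall g h, bounded_mfun g -> bounded_mfun h -> C g -> C h -> C (fun x => g x + h x)) ->
  (forall c g, bounded_mfun g -> C g -> C (fun x => c * g x)) ->
  (forall (g_ : nat -> T -> R) g M, (forall n, C (g_ n)) ->
    (forall n, measurable_fun setT (g_ n)) -> measurable_fun setT g ->
    (forall n x, `|g_ n x| <= M) -> (forall x, g_ n x @[n --> \oo] --> g x) -> C g) ->
  forall g, bounded_mfun g -> C g.
Proof.
move=> Cind CD CZ Clim.
have Csum (n : nat) (F : nat -> T -> R) : (forall i, bounded_mfun (F i)) -> (forall i, C (F i)) ->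
    C (fun x => \sum_(i < n) F i x).
  move=> bF CF; elim: n => [|n IH].
    rewrite (_ : (fun x => _) = \1_set0); first exact: Cind.
    by apply/funext => x; rewrite big_ord0 indic0.
  rewrite (_ : (fun x => _) = (fun x => \sum_(i < n) F i x + F n x)).
    by apply: CD => //; exact: bmf_sum.
  by apply/funext => x; rewrite big_ord_recr.
have Cge0 g : bounded_mfun g -> (forall x, 0 <= g x) -> C g.
  move=> bg g0; have [mg [M gM]] := bg.
  have meg : measurable_fun setT (EFin \o g) by exact/measurable_EFinP.
  pose h := nnsfun_approx measurableT meg.
  have hg x : h n x @[n --> \oo] --> g x.
    have := @cvg_nnsfun_approx _ _ _ _ measurableT _ meg (fun x _ => g0 x) x Logic.I.
    by move=> /fine_cvgP[_].
  have hnd x : nondecreasing_seq (h ^~ x).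
    by move=> m n mn; exact/lefP/nd_nnsfun_approx.
  apply: (Clim (fun n => h n) g M) => //.
  - move=> n; pose s := finmap.enum_fset (fset_set (range (h n))).
    have -> : (h n : T -> R) = (fun x => \sum_(i < (size s)) (s`_i * \1_(h n @^-1` [set s`_i]) x)).
      by apply/funext => x; exact: fimfunEord.
    have := Csum (size s) (fun i x => s`_i * \1_(h n @^-1` [set s`_i]) x); apply=> i.
      by apply: bmfZ; apply: bmf_indic; exact: measurable_funPTI.
    apply: CZ; first by apply: bmf_indic; exact: measurable_funPTI.
    by apply: Cind; exact: measurable_funPTI.
  - move=> n x; rewrite ger0_norm//.
    apply: (@le_trans _ _ (g x)); last by apply: le_trans (ler_norm _) (gM x).
    rewrite -(cvg_lim (@Rhausdorff R) (hg x)).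
    by apply: nondecreasing_cvgn_le => //; exact: cvgP (hg x).
(* A general [g] is the nonnegative function [g + M] minus [M] times the indicator of the whole
   space. *)
move=> g bg; have [mg [M gM]] := bg.
have bM := @bmf_cst _ T R M; have bM' := @bmf_cst _ T R (- M).
have bgM := bmfD bg bM.
have gM0 x : 0 <= g x + M by have := gM x; rewrite ler_norml => /andP[]; lra.
rewrite (_ : g = (fun x => (g x + M) + (- M) * \1_setT x)).
  apply: CD => //; first by apply: bmfZ; exact: bmf_indic.
    exact: Cge0.
  by apply: CZ; [exact: bmf_indic|exact: Cind].
by apply/funext => x; rewrite indicT mulr1 addrK.
Qed.

End BoundedInduction.

Section Fubini.
Context d1 d2 (T1 : measurableType d1) (T2 : measurableType d2) (R : realType).
Variables (P1 : probability T1 R) (P2 : probability T2 R) (F : T1 * T2 -> R).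
Hypothesis bF : bounded_mfun F.

Lemma bmf_sectionl x : bounded_mfun (fun y => F (x, y)).
Proof.
have [mF [M FM]] := bF; split; last by exists M.
by apply: measurableT_comp mF _; exact: pair1_measurable.
Qed.

Lemma bmf_sectionr y : bounded_mfun (fun x => F (x, y)).
Proof.
have [mF [M FM]] := bF; split; last by exists M.
by apply: measurableT_comp mF _; exact: pair2_measurable.
Qed.

Lemma avg_fubini :
  avg P1 (fun x => avg P2 (fun y => F (x, y))) = avg P2 (fun y => avg P1 (fun x => F (x, y))).
Proof.
have [mF [M FM]] := bF.
have iF : (P1 \x P2)%E.-integrable setT (EFin \o F).
  apply: measurable_bounded_integrable => //.
  - set p := (X in (X < _)%E); rewrite (_ : p = 1%E) ?ltry// /p -setXTT.
    apply: (eq_trans (product_measure1E _ _ measurableT measurableT)).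
    rewrite -[RHS]mule1; congr (_ * _)%E; exact: probability_setT.
  - by exists M; split; rewrite ?num_real// => N MN x _ /=; apply: le_trans (FM x) _; exact: ltW.
have := Fubini iF; rewrite /avg /Rintegral => FE; congr fine.
apply: (eq_trans (eq_trans _ FE)); apply: eq_integral => x _ /=.
  exact: EFin_avg (bmf_sectionl x).
by apply/esym; exact: EFin_avg (bmf_sectionr x).
Qed.

End Fubini.

(** * The Poisson kernel as a function of the angle *)

Section RadialKernel.
Context (R : realType).
Implicit Types (r s t x : R).

(** The denominator is |1 - r e^(ix)|^2, split into two nonnegative terms that measure depth and
    angular distance. *)
Definition rkernel r x : R := (1 - r ^+ 2) / ((1 - r) ^+ 2 + 2 * r * (1 - cos x)).

Lemma poisson_rkernel r s t : 0 <= r -> poisson (r%:C * cis s) t = rkernel r (t - s).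
Proof.
move=> r0; rewrite /poisson normc_realM// normc_cis mulr1 /rkernel normc_sqr /=.
congr (_ / _); rewrite cosB.
have := cos2Dsin2 s; have := cos2Dsin2 t; rewrite !mul0r subr0 addr0.
move: (cos s) (sin s) (cos t) (sin t) => a b c d h1 h2.
have -> : (c - r * a) ^+ 2 + (d - r * b) ^+ 2 =
  (c ^+ 2 + d ^+ 2) - 2 * r * (c * a + d * b) + r ^+ 2 * (a ^+ 2 + b ^+ 2) by ring.
by rewrite h1 h2; ring.
Qed.

Lemma rkernelN r x : rkernel r (- x) = rkernel r x.
Proof. by rewrite /rkernel cosN. Qed.

Lemma rkernel_denom r x : 0 <= r < 1 -> 0 < (1 - r) ^+ 2 + 2 * r * (1 - cos x).
Proof.
move=> /andP[r0 r1]; rewrite ltr_pwDl ?exprn_gt0 ?subr_gt0//.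
by rewrite mulr_ge0 ?subr_ge0 ?cos_le1// mulr_ge0.
Qed.

Lemma rkernel_ge0 r x : 0 <= r < 1 -> 0 <= rkernel r x.
Proof.
move=> r01; apply: divr_ge0; last exact/ltW/rkernel_denom.
by have /andP[r0 r1] := r01; rewrite subr_ge0 expr_le1// ltW.
Qed.

Lemma continuous_rkernel r : 0 <= r < 1 -> continuous (rkernel r).
Proof.
move=> r01 x; apply: cvgM; first exact: cvg_cst.
apply: cvgV; first by rewrite gt_eqF// rkernel_denom.
apply: cvgD; first exact: cvg_cst.
apply: cvgM; first exact: cvg_cst.
by apply: cvgB; [exact: cvg_cst|exact: continuous_cos].
Qed.

Lemma rkernel_le r x : 0 <= r < 1 -> rkernel r x <= (1 + r) / (1 - r).
Proof.
move=> r01; have /andP[r0 r1] := r01; rewrite /rkernel ler_pdivrMr ?rkernel_denom//.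
rewrite mulrAC ler_pdivlMr ?subr_gt0//; have := cos_le1 x; move: (cos x) => c c1.
have -> : (1 - r ^+ 2) * (1 - r) = (1 + r) * (1 - r) ^+ 2 by ring.
by rewrite ler_pM2l ?ltr_pwDl// lerDl mulr_ge0 ?subr_ge0// mulr_ge0.
Qed.

(** The numerator is at most 2 (1 - r), and since 2 r >= 1 the denominator is at least 1 - c. Away
    from angle 0 the kernel thus tends to 0 with 1 - r. *)
Lemma rkernel_far r x c : 1 / 2 <= r < 1 -> c < 1 -> cos x <= c ->
  rkernel r x <= 2 * (1 - r) / (1 - c).
Proof.
move=> /andP[r0 r1] c1 xc; rewrite /rkernel ler_pdivlMr ?subr_gt0// mulrAC.
rewrite ler_pdivrMr; last by rewrite rkernel_denom//; apply/andP; split; lra.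
have h : (1 - c) <= (1 - r) ^+ 2 + 2 * r * (1 - cos x).
  have : 0 <= (1 - r) ^+ 2 by exact: sqr_ge0.
  by nra.
apply: (@le_trans _ _ (2 * (1 - r) * (1 - c))); last by rewrite ler_pM2l// mulr_gt0 ?subr_gt0.
by rewrite ler_pM2r ?subr_gt0//; nra.
Qed.

Lemma cos_far (a x : R) : 0 < a -> a <= `|x| <= 2 * pi - a -> cos x <= cos a.
Proof.
move=> a0 /andP[ax xa]; have -> : cos x = cos `|x|.
  by have [//|] := ger0P x; rewrite cosN.
move: ax xa; move: `|x| => {}x ax xa; have p0 := pi_gt0 R.
have api : a <= pi by lra.
have [xp|xp] := leP x pi.
  have [->//|neq] := eqVneq x a; apply/ltW.
  have lt : a < x by rewrite lt_neqAle eq_sym neq.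
  by rewrite ltr_cos// ?in_itv/=; apply/andP; split; lra.
have -> : cos x = cos (2 * pi - x).
  by rewrite mulr_natl -[LHS]cosN -[LHS]cosD2pi addrC.
have [->//|neq] := eqVneq (2 * pi - x) a; apply/ltW.
have lt : a < 2 * pi - x by rewrite lt_neqAle eq_sym neq /=; lra.
by rewrite ltr_cos// ?in_itv/=; apply/andP; split; lra.
Qed.

Lemma cos_lt1 (a : R) : 0 < a <= pi -> cos a < 1.
Proof.
move=> /andP[a0 ap]; rewrite -cos0 ltr_cos// in_itv/=; first by rewrite lexx pi_ge0.
by rewrite ltW.
Qed.

Lemma avg_rkernel r t : 0 <= r < 1 -> avg (circ R) (fun s => rkernel r (t - s)) = 1.
Proof.
move=> /andP[r0 r1]; have n1 : normc (r%:C * cis t) < 1 by rewrite normc_radius.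
rewrite -(avg_poisson n1); congr avg; apply/funext => s.
by rewrite poisson_rkernel// -rkernelN opprB.
Qed.

Lemma radii_ge n : 1 / 2 <= radii R n < 1.
Proof.
have : 0 < (n.+2%:R : R)^-1 <= 2^-1 by rewrite invr_gt0 ltr0n /= lef_pV2 ?posrE ?ltr0n// ler_nat.
by rewrite /radii; move: (n.+2%:R^-1) => q /andP[? ?]; apply/andP; split; lra.
Qed.

Lemma cvg_rkernel_far (c : R) (u : nat -> R) : c < 1 ->
  (forall n, 0 <= u n <= 2 * (1 - radii R n) / (1 - c)) -> u n @[n --> \oo] --> (0 : R).
Proof.
move=> c1 uP; apply: (@squeeze_cvgr _ _ _ _ (cst 0) (fun n => 2 * (1 - radii R n) / (1 - c))).
- by apply: nearW.
- exact: cvg_cst.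
- have -> : (0 : R) = 2 * (1 - 1) / (1 - c) by rewrite subrr mulr0 mul0r.
  apply: cvgM; last exact: cvg_cst.
  apply: cvgM; first exact: cvg_cst.
  by apply: cvgB; [exact: cvg_cst|exact: cvg_radii].
Qed.

End RadialKernel.

(** * Uniqueness of measures with given Poisson integrals *)

Section PoissonUniqueness.
Context (R : realType).
Variables (T p q : R -> R).
Hypothesis mT : measurable_fun setT T.
Hypothesis T_itv : forall t, 0 <= T t < 2 * pi.
Hypotheses (bp : bounded_mfun p) (bq : bounded_mfun q).
Hypotheses (p_gt0 : forall t, 0 < p t) (q_gt0 : forall t, 0 < q t).
Hypothesis poissonT : forall w, normc w < 1 ->
  avg (circ R) (fun t => poisson w (T t) * p t) = avg (circ R) (fun t => poisson w t * q t).
Implicit Types (phi psi : R -> R).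

(** Equality of the integrals of [phi] against two measures: the image under [T] of the one with
    density [p], and the one with density [q]. *)
Let transfer phi := avg (circ R) (fun t => phi (T t) * p t) = avg (circ R) (fun t => phi t * q t).

Lemma bmf_comp phi (S : R -> R) : bounded_mfun phi -> measurable_fun setT S ->
  bounded_mfun (fun t => phi (S t)).
Proof.
move=> [mphi [M pM]] mS; split; last by exists M.
exact: measurableT_comp.
Qed.

Let ae_itv (Q : R -> Prop) : (forall t, 0 <= t < 2 * pi -> Q t) -> {ae circ R, forall t, Q t}.
Proof. by move=> H; apply/ae_circP; apply: aeW. Qed.

Let ae_point (a : R) : {ae circ R, forall t, t != a}.
Proof.
exists [set a]; split => //; last by move=> t /= /negP/negPn/eqP.
by apply: (eq_trans (circE _)) => //; rewrite (_ : lebesgue_measure _ = 0%E) ?mule0//;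
  apply/eqP; rewrite eq_le measure_ge0 andbT -(lebesgue_measure_set1 a) le_measure ?inE//;
  apply: measurableI.
Qed.

Let transfer_itv phi psi : bounded_mfun phi -> bounded_mfun psi ->
  (forall t, 0 <= t < 2 * pi -> phi t = psi t) -> transfer phi -> transfer psi.
Proof.
move=> bphi bpsi E; rewrite /transfer => H.
have -> : (fun t => psi (T t) * p t) = (fun t => phi (T t) * p t).
  by apply/funext => t; rewrite E.
rewrite H; apply: ae_eq_avg; [exact: bmfM|exact: bmfM|].
by apply: ae_itv => t tI; rewrite E.
Qed.

(** Convergence is demanded separately at [T t] and at [t], because at this stage [T] is not yet
    known to pull null sets back to null sets. *)
Let transfer_lim (phi_ : nat -> R -> R) phi (M : R) :
  (forall n, transfer (phi_ n)) -> (forall n, measurable_fun setT (phi_ n)) ->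
  measurable_fun setT phi -> (forall n t, `|phi_ n t| <= M) ->
  {ae circ R, forall t, phi_ n (T t) @[n --> \oo] --> phi (T t)} ->
  {ae circ R, forall t, phi_ n t @[n --> \oo] --> phi t} -> transfer phi.
Proof.
move=> Hn mn mphi bM cT c.
have [mp [Mp pM]] := bp; have [mq [Mq qM]] := bq.
have l1 : avg (circ R) (fun t => phi_ n (T t) * p t) @[n --> \oo] -->
    avg (circ R) (fun t => phi (T t) * p t).
  apply: (@avg_dct _ _ _ _ _ _ (M * Mp)).
  - by move=> n; apply: measurable_funM => //; exact: measurableT_comp.
  - by apply: measurable_funM => //; exact: measurableT_comp.
  - by move=> n t; rewrite normrM ler_pM.
  - apply: (@filterS _ _ (ae_filter_ringOfSetsType (circ R)) _ _ _ cT) => t ct.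
    by apply: cvgM => //; exact: cvg_cst.
have l2 : avg (circ R) (fun t => phi_ n t * q t) @[n --> \oo] -->
    avg (circ R) (fun t => phi t * q t).
  apply: (@avg_dct _ _ _ _ _ _ (M * Mq)).
  - by move=> n; apply: measurable_funM; [exact: mn|exact: mq].
  - by apply: measurable_funM; [exact: mphi|exact: mq].
  - by move=> n t; rewrite normrM ler_pM.
  - apply: (@filterS _ _ (ae_filter_ringOfSetsType (circ R)) _ _ _ c) => t ct.
    by apply: cvgM => //; exact: cvg_cst.
rewrite (funext Hn) in l1.
by rewrite /transfer -(cvg_lim (@Rhausdorff R) l1) (cvg_lim (@Rhausdorff R) l2).
Qed.

Let radii01 n : 0 <= radii R n < 1.
Proof. by have /andP[r0 ->] := radii_itv R n; rewrite ltW. Qed.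

Let transfer_kernel n s : transfer (fun t => rkernel (radii R n) (t - s)).
Proof.
have /andP[r0 r1] := radii01 n.
have := @poissonT ((radii R n)%:C * cis s); rewrite normc_radius// => /(_ r1).
rewrite /transfer.
have -> : poisson ((radii R n)%:C * cis s) = (fun t => rkernel (radii R n) (t - s)).
  by apply/funext => t; rewrite poisson_rkernel.
exact.
Qed.

Let bmf_kernel n (s : R) : bounded_mfun (fun t : R => rkernel (radii R n) (t - s)).
Proof.
have /andP[r0 r1] := radii01 n.
have -> : (fun t => rkernel (radii R n) (t - s)) = poisson ((radii R n)%:C * cis s).
  by apply/funext => t; rewrite poisson_rkernel.
by apply: bmf_poisson; rewrite normc_radius.
Qed.

Let transferZ c phi : bounded_mfun phi -> transfer phi -> transfer (fun t => c * phi t).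
Proof.
move=> bphi H; rewrite /transfer.
rewrite (_ : (fun t => c * phi (T t) * p t) = (fun t => c * (phi (T t) * p t))); last first.
  by apply/funext => t; rewrite mulrA.
rewrite (_ : (fun t => c * phi t * q t) = (fun t => c * (phi t * q t))); last first.
  by apply/funext => t; rewrite mulrA.
rewrite (@avgZ _ _ _ (circ R) c _ (bmfM (bmf_comp bphi mT) bp)).
by rewrite (@avgZ _ _ _ (circ R) c _ (bmfM bphi bq)) H.
Qed.

Let transferD phi psi : bounded_mfun phi -> bounded_mfun psi ->
  transfer phi -> transfer psi -> transfer (fun t => phi t + psi t).
Proof.
move=> bphi bpsi H1 H2; rewrite /transfer.
rewrite (_ : (fun t => _ * p t) = (fun t => phi (T t) * p t + psi (T t) * p t)); last first.
  by apply/funext => t; rewrite mulrDl.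
rewrite (_ : (fun t => _ * q t) = (fun t => phi t * q t + psi t * q t)); last first.
  by apply/funext => t; rewrite mulrDl.
rewrite (@avgD _ _ _ (circ R) _ _ (bmfM (bmf_comp bphi mT) bp) (bmfM (bmf_comp bpsi mT) bp)).
by rewrite (@avgD _ _ _ (circ R) _ _ (bmfM bphi bq) (bmfM bpsi bq)) H1 H2.
Qed.

Let kernel_offdiag (s t : R) : 0 <= s < 2 * pi -> 0 <= t < 2 * pi -> t != s ->
  exists2 c, c < 1 & cos (t - s) <= c.
Proof.
move=> /andP[s0 s1] /andP[t0 t1] ts.
pose a := Num.min `|t - s| (2 * pi - `|t - s|).
have ts0 : 0 < `|t - s| by rewrite normr_gt0 subr_eq0.
have ts2 : `|t - s| < 2 * pi by rewrite ltr_norml; apply/andP; split; lra.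
have a0 : 0 < a by rewrite lt_min ts0 subr_gt0.
have /andP[a1 a2] : (a <= `|t - s|) && (a <= 2 * pi - `|t - s|) by rewrite /a !ge_min !lexx orbT.
exists (cos a); first by apply: cos_lt1; rewrite a0/=; lra.
by apply: cos_far => //; rewrite a1/=; lra.
Qed.

(* The kernels normalised to height 1 converge boundedly to the indicator of a point. *)
Let atomT (a : R) : 0 <= a < 2 * pi -> {ae circ R, forall t, T t != a}.
Proof.
move=> aI.
have ma : measurable_fun setT (\1_[set a] : R -> R) by exact: measurable_indic.
have H : transfer (\1_[set a]).
  pose c n : R := (1 - radii R n) / (1 + radii R n).
  have c0 n : 0 <= c n.
    by have /andP[? ?] := radii01 n; rewrite /c divr_ge0; lra.
  have lim t : 0 <= t < 2 * pi -> c n * rkernel (radii R n) (t - a) @[n --> \oo] --> (\1_[set a] t : R).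
    move=> tI; have [->|ta] := eqVneq t a.
      rewrite indicE mem_set//= (_ : (fun n => _) = cst 1); first exact: cvg_cst.
      apply/funext => n /=; rewrite subrr /rkernel cos0 subrr mulr0 addr0 /c.
      have /andP[? ?] := radii01 n.
      by field; apply/andP; split; rewrite gt_eqF//; lra.
    rewrite indicE memNset//=; last by apply/eqP.
    have [c' c1 cc] := kernel_offdiag aI tI ta.
    apply: (cvg_rkernel_far c1) => n; rewrite (mulr_ge0 (c0 n) (rkernel_ge0 _ (radii01 n)))/=.
    apply: le_trans (rkernel_far (radii_ge R n) c1 cc).
    rewrite ler_piMl ?rkernel_ge0// /c.
    by have /andP[? ?] := radii01 n; rewrite ler_pdivrMr ?mul1r; lra.
  apply: (@transfer_lim (fun n t => c n * rkernel (radii R n) (t - a)) _ 1) => //.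
  - by move=> n; apply: transferZ.
  - by move=> n; have [] := bmfZ (c n) (bmf_kernel n a).
  - move=> n t; rewrite ger0_norm; last by apply: mulr_ge0; [exact: c0|exact: rkernel_ge0].
    have /andP[r0 r1] := radii01 n.
    apply: (@le_trans _ _ (c n * ((1 + radii R n) / (1 - radii R n)))).
      by rewrite ler_wpM2l// rkernel_le.
    by rewrite /c le_eqVlt; apply/orP; left; apply/eqP; field; apply/andP; split; rewrite gt_eqF//; lra.
  - by apply: ae_itv => t _; exact: lim (T_itv t).
  - by apply: ae_itv => t; exact: lim.
have bi : bounded_mfun (\1_[set a] : R -> R) by exact: bmf_indic.
have Z : avg (circ R) (fun t => \1_[set a] (T t) * p t) = 0.
  rewrite H -[RHS](@avg_cst _ _ _ (circ R)); apply: ae_eq_avg.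
  - exact: bmfM.
  - exact: bmf_cst.
  - apply: (@filterS _ _ (ae_filter_ringOfSetsType (circ R)) _ _ _ (ae_point a)) => t ta.
    by rewrite indicE memNset ?mul0r//=; exact/eqP.
have bip := bmfM (bmf_comp bi mT) bp; have [mip _] := bip.
(* A nonnegative integrand with zero integral vanishes almost everywhere; as [p] is positive, the
   indicator itself vanishes. *)
have : (\int[circ R]_t `|(\1_[set a] (T t) * p t)%:E| = 0)%E.
  rewrite (eq_integral (fun t : measurableTypeR R => (\1_[set a] (T t) * p t)%:E)); last first.
    by move=> t _; rewrite gee0_abs// lee_fin mulr_ge0 ?indicE// ltW.
  by rewrite -(@EFin_avg _ _ _ (circ R) _ bip) Z.
move=> /ae_eq_integral_abs => /(_ measurableT (proj2 (measurable_EFinP _ _) mip)).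
apply: (@filterS _ _ (ae_filter_ringOfSetsType (circ R))) => t /(_ Logic.I) [] /eqP.
rewrite mulf_eq0 (gt_eqF (p_gt0 t)) orbF indicE => /eqP H0.
by apply/eqP => Tta; move: H0; rewrite mem_set//= => /eqP; rewrite oner_eq0.
Qed.

(** The Poisson integral of the indicator of [J] on the circle of radius [radii R n]: a
    superposition of kernels that tends to the indicator off the endpoints. *)
Let radial_avg (J : set R) n t := avg (circ R) (fun s => \1_J s * rkernel (radii R n) (t - s)).

Let bmf_pair (J : set R) n (S h : R -> R) : measurable J -> measurable_fun setT S -> bounded_mfun h ->
  bounded_mfun (fun ts : measurableTypeR R * measurableTypeR R =>
    \1_J ts.2 * rkernel (radii R n) (S ts.1 - ts.2) * h ts.1).
Proof.
move=> mJ mS [mh [M hM]]; have r01 := radii01 n.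
have mf : measurable_fun setT (fst : measurableTypeR R * measurableTypeR R -> measurableTypeR R) by exact: measurable_fst.
have ms : measurable_fun setT (snd : measurableTypeR R * measurableTypeR R -> measurableTypeR R) by exact: measurable_snd.
split; last first.
  exists (1 * ((1 + radii R n) / (1 - radii R n)) * M) => -[t s] /=.
  rewrite normrM; apply: ler_pM; [exact: normr_ge0|exact: normr_ge0| |exact: hM].
  rewrite normrM; apply: ler_pM; [exact: normr_ge0|exact: normr_ge0| |].
    by rewrite indicE; case: (_ \in _); rewrite ?normr1 ?normr0.
  by rewrite ger0_norm; [exact: rkernel_le|exact: rkernel_ge0].
apply: measurable_funM; last exact: measurableT_comp mh mf.
apply: measurable_funM; first by apply: measurableT_comp ms; exact: measurable_indic.
apply: (@measurableT_comp _ _ _ _ _ _ (rkernel (radii R n)) _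
  (fun ts : measurableTypeR R * measurableTypeR R => S ts.1 - ts.2)).
  by apply: continuous_measurable_fun; exact: continuous_rkernel.
by apply: measurable_funB ms; exact: measurableT_comp mS mf.
Qed.

Let radial_avg_fubini (J : set R) n (S h : R -> R) : measurable J -> measurable_fun setT S ->
  bounded_mfun h ->
  avg (circ R) (fun t => radial_avg J n (S t) * h t) =
  avg (circ R) (fun s => \1_J s * avg (circ R) (fun t => rkernel (radii R n) (S t - s) * h t)).
Proof.
move=> mJ mS bh.
have bK s : bounded_mfun (fun t => rkernel (radii R n) (S t - s)).
  exact: (bmf_comp (bmf_kernel n s) mS).
have bK' t : bounded_mfun (fun s => \1_J s * rkernel (radii R n) (t - s)).
  apply: bmfM; first exact: bmf_indic.
  rewrite (_ : (fun s => _) = (fun s => rkernel (radii R n) (s - t))); first exact: bmf_kernel.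
  by apply/funext => s; rewrite -rkernelN opprB.
have := @avg_fubini _ _ _ _ _ (circ R) (circ R) _ (bmf_pair n mJ mS bh).
rewrite /=; set l := avg _ _; set r := avg _ _ => E.
have -> : avg (circ R) (fun t => radial_avg J n (S t) * h t) = l.
  rewrite /l; congr avg; apply/funext => t; rewrite /radial_avg mulrC -(@avgZ _ _ _ (circ R) _ _ (bK' (S t))).
  by congr avg; apply/funext => s; rewrite mulrC.
rewrite E /r; congr avg; apply/funext => s; rewrite -(@avgZ _ _ _ (circ R) _ _ (bmfM (bK s) bh)).
by congr avg; apply/funext => t; rewrite mulrA.
Qed.

(** By Fubini the integral over the pole [s] comes outside, and for each fixed [s] the identity is
    [transfer_kernel]. *)
Let transfer_radial_avg (J : set R) n : measurable J -> transfer (radial_avg J n).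
Proof.
move=> mJ; rewrite /transfer (radial_avg_fubini n mJ mT bp).
rewrite (radial_avg_fubini n mJ (@measurable_id _ _ setT) bq).
by congr avg; apply/funext => s; congr (_ * _); exact: transfer_kernel.
Qed.

Let bmf_radial (J : set R) n t : measurable J ->
  bounded_mfun (fun s : R => \1_J s * rkernel (radii R n) (t - s)).
Proof.
move=> mJ; apply: bmfM; first exact: bmf_indic.
rewrite (_ : (fun s => _) = (fun s => rkernel (radii R n) (s - t))); first exact: bmf_kernel.
by apply/funext => s; rewrite -rkernelN opprB.
Qed.

Let radial_avg_itv (J : set R) n t : measurable J -> 0 <= radial_avg J n t <= 1.
Proof.
move=> mJ; apply/andP; split.
  by apply: avg_ge0 => s; rewrite mulr_ge0 ?rkernel_ge0// indicE.
rewrite -(avg_rkernel t (radii01 n)); apply: le_avg.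
- exact: bmf_radial.
- rewrite (_ : (fun s => _) = (fun s => rkernel (radii R n) (s - t))); first exact: bmf_kernel.
  by apply/funext => s; rewrite -rkernelN opprB.
- move=> s; rewrite ler_piMl ?rkernel_ge0// indicE; by case: (_ \in _).
Qed.

Let measurable_radial_avg (J : set R) n : measurable J -> measurable_fun setT (radial_avg J n).
Proof.
move=> mJ.
have [mF _] := bmf_pair n mJ (@measurable_id _ _ setT) (@bmf_cst _ _ _ 1).
have := @measurable_fun_fubini_tonelli_F _ _ (measurableTypeR R) (measurableTypeR R) R (circ R)
  (fun ts => (\1_J ts.2 * rkernel (radii R n) (ts.1 - ts.2) * 1)%:E)
  (proj2 (measurable_EFinP _ _) mF).
move=> /(_ _)/wrap[]; first by move=> [t s]; rewrite lee_fin mulr1 mulr_ge0 ?rkernel_ge0// indicE.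
rewrite /fubini_F /= => H.
have := measurableT_comp (@fine_measurable R setT measurableT) H.
by apply: eq_measurable_fun => t _ /=; congr fine; apply: eq_integral => s _; rewrite mulr1.
Qed.

Let radial_avg_far (J : set R) n t c : measurable J -> c < 1 ->
  (forall s, J s -> cos (t - s) <= c) -> radial_avg J n t <= 2 * (1 - radii R n) / (1 - c).
Proof.
move=> mJ c1 cJ; rewrite -[leRHS](avg_cst (circ R)); apply: le_avg.
- exact: bmf_radial.
- exact: bmf_cst.
- move=> s; rewrite indicE; have [sJ|sJ] := boolP (s \in J).
    by rewrite mul1r; apply: rkernel_far => //; [exact: radii_ge|apply: cJ; exact: set_mem].
  have /andP[? ?] := radii01 n.
  by rewrite mul0r divr_ge0 ?mulr_ge0//; lra.
Qed.

(** With [x] between [s] and [t], the direct way from [t] to [s] is at least [|t - x|] long, and the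
    way through angle 0 at least [t] or [2 * pi - t]. *)
Let far_sector (x t s : R) : 0 < t < 2 * pi -> t != x ->
  0 <= s <= 2 * pi -> (x <= s /\ t < x \/ s <= x /\ x < t) ->
  cos (t - s) <= cos (Num.min `|t - x| (Num.min t (2 * pi - t))).
Proof.
move=> /andP[t0 t1] tx /andP[s0 s1] h; apply: cos_far.
  by rewrite !lt_min normr_gt0 subr_eq0 tx t0 subr_gt0.
have [a1 a2 a3] : [/\ Num.min `|t - x| (Num.min t (2 * pi - t)) <= `|t - x|,
   Num.min `|t - x| (Num.min t (2 * pi - t)) <= t &
   Num.min `|t - x| (Num.min t (2 * pi - t)) <= 2 * pi - t].
  by split; rewrite !ge_min lexx ?orbT.
move: (Num.min _ _) a1 a2 a3 => a a1 a2 a3.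
case: h => -[h1 h2].
  have e1 : `|t - x| = x - t by rewrite ltr0_norm ?subr_lt0// opprB.
  have -> : `|t - s| = s - t by rewrite ltr0_norm ?subr_lt0 ?opprB//; lra.
  by apply/andP; split; lra.
have e1 : `|t - x| = t - x by rewrite gtr0_norm ?subr_gt0.
have -> : `|t - s| = t - s by rewrite gtr0_norm ?subr_gt0//; lra.
by apply/andP; split; lra.
Qed.

Let radial_avg_cvg (x t : R) : 0 <= x < 2 * pi -> 0 < t < 2 * pi -> t != x ->
  radial_avg `]x, 2 * pi[ n t @[n --> \oo] --> (\1_(`]x, 2 * pi[) t : R).
Proof.
move=> /andP[x0 x1] tI tx; have /andP[t0 t1] := tI.
pose a := Num.min `|t - x| (Num.min t (2 * pi - t)).
have a0 : 0 < a by rewrite !lt_min normr_gt0 subr_eq0 tx t0 subr_gt0.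
have api : a <= pi.
  have [t2 t3] : a <= t /\ a <= 2 * pi - t by split; rewrite !ge_min lexx !orbT.
  lra.
have ca : cos a < 1 by apply: cos_lt1; rewrite a0.
have [tltx|xltt] := ltP t x.
  rewrite indicE memNset//=; last by rewrite in_itv/= => /andP[]; lra.
  apply: (cvg_rkernel_far ca) => n.
  have /andP[-> _] := radial_avg_itv n t (measurable_itv `]x, 2 * pi[); rewrite /=.
  apply: radial_avg_far => // s; rewrite /= in_itv/= => /andP[s1 s2].
  by apply: far_sector => //; [apply/andP; split; lra|left; split; lra].
have {}xltt : x < t by rewrite lt_neqAle eq_sym tx.
rewrite indicE mem_set/=; last by rewrite in_itv/= xltt t1.
(* For [t] inside the arc the complement is the far set. The two indicators add up to 1 on [0, 2
   pi), and the kernel has mean 1. *)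
have E n : radial_avg `]x, 2 * pi[ n t = 1 - radial_avg `[0, x] n t.
  suff H : radial_avg `]x, 2 * pi[ n t + radial_avg `[0, x] n t = 1.
    by apply/esym/eqP; rewrite subr_eq; apply/eqP.
  rewrite -[RHS](avg_rkernel t (radii01 n)).
  have b1 := bmf_radial n t (measurable_itv `]x, 2 * pi[).
  have b2 := bmf_radial n t (measurable_itv `[0, x]).
  apply: (eq_trans (esym (@avgD _ _ _ (circ R) _ _ b1 b2))); apply: ae_eq_avg.
  - exact: bmfD.
  - rewrite (_ : (fun s => _) = (fun s => rkernel (radii R n) (s - t))); first exact: bmf_kernel.
    by apply/funext => s; rewrite -rkernelN opprB.
  - apply: ae_itv => s /andP[s0 s1]; rewrite -mulrDl !indicE.
    have [xs|xs] := ltP x s.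
      by rewrite mem_set ?memNset ?addr0 ?mul1r//= in_itv/= ?xs// s0/= leNgt xs.
    by rewrite memNset ?mem_set ?add0r ?mul1r//= in_itv/= ?s0// ltNge xs.
rewrite (funext E) -[X in _ --> X]subr0; apply: cvgB; first exact: cvg_cst.
apply: (cvg_rkernel_far ca) => n.
have /andP[-> _] := radial_avg_itv n t (measurable_itv `[0, x]); rewrite /=.
apply: radial_avg_far => // s; rewrite /= in_itv/= => /andP[s1 s2].
by apply: far_sector => //; [apply/andP; split; lra|right; split; lra].
Qed.

Let transfer_oo (x : R) : 0 <= x < 2 * pi -> transfer (\1_(`]x, 2 * pi[)).
Proof.
move=> xI.
have m0 : (0 : R) <= (0 : R) < 2 * (pi : R) by rewrite lexx pi2_gt0.
apply: (@transfer_lim (radial_avg `]x, 2 * pi[) _ 1).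
- by move=> n; apply: transfer_radial_avg.
- by move=> n; apply: measurable_radial_avg.
- exact: measurable_indic.
- move=> n t; have /andP[h0 h1] := radial_avg_itv n t (measurable_itv `]x, 2 * pi[).
  by rewrite ger0_norm.
(* The arc has its endpoints at 0 and [x], where convergence may fail. On the side of [T] these
   values are excluded by [atomT], on the other side because points are null. *)
- apply: (@filterS2 _ _ (ae_filter_ringOfSetsType (circ R)) _ _ _ _ (atomT m0) (atomT xI)) => t T0 Tx.
  by apply: radial_avg_cvg => //; have /andP[? ->] := T_itv t; rewrite lt_neqAle eq_sym T0 andbT.
- have tI : {ae circ R, forall t, 0 <= t < 2 * pi} by exact: ae_itv.
  apply: (@filterS3 _ _ (ae_filter_ringOfSetsType (circ R)) _ _ _ _ _ (ae_point 0) (ae_point x) tI) => t T0 Tx.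
  move=> /andP[t0 t1]; apply: radial_avg_cvg => //; rewrite t1 lt_neqAle eq_sym T0 andbT//.
Qed.

Let transfer_cst c : transfer (cst c).
Proof.
have := @poissonT 0; rewrite Normc.normc0 => /(_ ltr01).
have -> : poisson 0 = cst (1 : R).
  apply/funext => t; rewrite /poisson Normc.normc0 subr0 normc_cis expr0n subr0 expr1n.
  by rewrite divr1.
move=> H; have := @transferZ c _ (@bmf_cst _ _ _ 1) H.
by rewrite (_ : (fun t => c * _) = cst c)//; apply/funext => t /=; rewrite mulr1.
Qed.

Let transfer_ray (x : R) : transfer (\1_(`]x, +oo[)).
Proof.
have bi (A : set R) : measurable A -> bounded_mfun (\1_A : R -> R) by exact: bmf_indic.
have [x0|x0] := ltP x 0.
  apply: (@transfer_itv (cst 1) _ _ _ _ (transfer_cst 1)); [exact: bmf_cst|exact: bi|].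
  move=> t /andP[t0 t1] /=; rewrite indicE mem_set//= in_itv/= andbT; exact: lt_le_trans t0.
have [x1|x1] := leP (2 * pi) x.
  apply: (@transfer_itv (cst 0) _ _ _ _ (transfer_cst 0)); [exact: bmf_cst|exact: bi|].
  by move=> t /andP[t0 t1] /=; rewrite indicE memNset//= in_itv/= andbT => xt; lra.
have xI : 0 <= x < 2 * pi by rewrite x0.
apply: (@transfer_itv _ _ _ _ _ (transfer_oo xI)); [exact: bi|exact: bi|].
move=> t /andP[t0 t1]; rewrite !indicE; have [xt|xt] := ltP x t.
  by rewrite !mem_set//= in_itv/= xt.
by rewrite !memNset//= in_itv/= ltNge xt.
Qed.

(** The rays []x, +oo[] are stable under intersection and generate the Borel sets, so [transfer_ray]
    makes the two measures equal; [bounded_mfun_ind] then passes to functions. *)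
Theorem poisson_unique (phi : R -> R) : bounded_mfun phi ->
  avg (circ R) (fun t => phi (T t) * p t) = avg (circ R) (fun t => phi t * q t).
Proof.
have [mp _] := bp; have [mq _] := bq.
pose T' : measurableTypeR R -> measurableTypeR R := T.
pose push : {measure set (measurableTypeR R) -> \bar R} :=
  pushforward (density (circ R) mp (fun t => ltW (p_gt0 t))) T'.
pose m1 := push mT.
pose m2 : {measure set (measurableTypeR R) -> \bar R} := density (circ R) mq (fun t => ltW (q_gt0 t)).
have bi (A : set R) : measurable A -> bounded_mfun (\1_A : R -> R) by exact: bmf_indic.
have m1E A : measurable A -> m1 A = (avg (circ R) (fun t => \1_A (T t) * p t))%:E.
  move=> mA; rewrite (@EFin_avg _ _ _ (circ R) _ (bmfM (bmf_comp (bi _ mA) mT) bp)).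
  rewrite /m1 /= /pushforward /density integral_mkcond; apply: eq_integral => t _.
  rewrite patchE indicE /=; have [TA|TA] := pselect (A (T t)).
    by rewrite !mem_set//= mul1r.
  by rewrite !memNset//= mul0r.
have m2E A : measurable A -> m2 A = (avg (circ R) (fun t => \1_A t * q t))%:E.
  move=> mA; rewrite (@EFin_avg _ _ _ (circ R) _ (bmfM (bi _ mA) bq)).
  rewrite /m2 /= /density integral_mkcond; apply: eq_integral => t _.
  by rewrite patchE indicE /=; case: (_ \in _); rewrite ?mul1r ?mul0r.
have ray_measurable x : measurable (`]x, +oo[%classic : set R) by [].
have key A : measurable A -> m1 A = m2 A.
  move=> mA.
  pose g (n : nat) := `](- n%:R : R), +oo[%classic.
  apply: (@measure_unique _ R (measurableTypeR R) (@RGenOInfty.G R) g _ _ _ _ m1 m2); last exact: mA.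
  - exact: RGenOInfty.measurableE.
  - move=> _ _ [x ->] [y ->]; exists (Num.max x y).
    apply/seteqP; split => t /=; rewrite !in_itv/= !andbT gt_max.
      by move=> [-> ->].
    by move=> /andP[].
  - by move=> n; exists (- n%:R).
  - apply/seteqP; split => // t _; exists (Num.bound `|t|) => //=.
    have := archi_boundP (normr_ge0 t); rewrite /g /= in_itv/= andbT ltr_norml.
    by move=> /andP[].
  - move=> _ [x ->]; rewrite m1E// m2E//; congr EFin; exact: transfer_ray.
  - move=> n; have := m1E _ (ray_measurable (- n%:R)); rewrite /g => ->.
    exact: ltry.
move=> bphi; apply: (@bounded_mfun_ind _ (measurableTypeR R) R transfer _ _ _ _ phi bphi).
- move=> A mA; have := key A mA; rewrite m1E// m2E// => -[]; exact.
- by move=> phi1 phi2 b1 b2; exact: transferD.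
- by move=> c phi1 b1; exact: transferZ.
- move=> phi_ phi1 M Hn mn m bM lim; apply: (@transfer_lim phi_ phi1 M Hn mn m bM).
    by apply: ae_itv => t _; exact: lim.
  by apply: ae_itv => t _; exact: lim.
Qed.

End PoissonUniqueness.

Section Transfer.
Context (R : realType).
Implicit Types (z w c : R[i]) (f : R[i] -> R[i]).

Theorem boundary_transfer f (T : R -> R) z (phi : R -> R) :
  inner_function f -> is_boundary_map f T -> normc z < 1 -> bounded_mfun phi ->
  avg (circ R) (fun t => phi (T t) * poisson z t) = avg (circ R) (fun t => phi t * poisson (f z) t).
Proof.
move=> fI fT z1 bphi; have [mT T_itv _] := fT; have fz1 := inner_lt1 fI z1.
apply: (@poisson_unique R T _ _ mT T_itv (bmf_poisson z1) (bmf_poisson fz1)) => //.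
- by move=> t; exact: poisson_gt0.
- by move=> t; exact: poisson_gt0.
- by move=> w w1; exact: boundary_poisson.
Qed.

(** Mean values bound real parts; a rotation turns such bounds into bounds on moduli. *)
Lemma unit_align w : exists2 c, normc c = 1 & complex.Re (c * w) = normc w.
Proof.
have [->|w0] := eqVneq w 0.
  by exists 1; rewrite ?Normc.normc1// mulr0 Normc.normc0.
have n0 := normc_gt0 w0.
have nC : (normc w)%:C != 0 :> R[i] by rewrite -normcE normr_eq0.
exists (conjc w / (normc w)%:C).
  have nn : normc (normc w)%:C = normc w.
    by rewrite -[(normc w)%:C]mulr1 normc_realM ?normc_ge0// Normc.normc1 mulr1.
  by rewrite normcM normc_conj Normc.normcV nn divff// gt_eqF.
rewrite mulrAC (mulrC _ w) -normc_sqrE expr2.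
have -> : (normc w * normc w)%:C = (normc w)%:C * (normc w)%:C :> R[i] by exact: (rmorphM (real_complex R)).
by rewrite mulfK.
Qed.

End Transfer.

(** * The contraction estimate *)

Section Schwarz.
Context (R : realType).
Implicit Types (z w c : R[i]).
Variable f : R[i] -> R[i].
Hypotheses (f_inner : inner_function f) (f0 : f 0 = 0).
(* The quotient f(z) / z, extended by f'(0) at 0. *)
Let k := dslope f 0.

Let kE z : f z = z * k z.
Proof.
have [->|z0] := eqVneq z 0; first by rewrite mul0r f0.
by rewrite /k dslopeE// f0 !subr0 mulrC divfK.
Qed.

Let k_cont z : normc z < 1 -> ccontinuous k z.
Proof.
move=> z1; apply: dslope_continuous.
  by apply: inner_cderivable => //; rewrite Normc.normc0 ltr01.
exact: cderivable_continuous (inner_cderivable f_inner z1).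
Qed.

Let k_deriv z : normc z < 1 -> z != 0 -> cderivable k z.
Proof. by move=> z1 z0; apply: dslope_cderivable => //; exact: inner_cderivable. Qed.

Let k_le z : z != 0 -> normc z < 1 -> normc (k z) <= (normc z)^-1.
Proof.
move=> z0 z1; have n0 := normc_gt0 z0.
rewrite -(ler_pM2l n0) divff ?gt_eqF// -normcM -kE.
exact/ltW/inner_lt1.
Qed.

Let radii_itv' n := radii_itv R n.

(** The dilation makes the quotient regular past the unit circle, and [c] selects the direction in
    which its modulus is read as a real part. *)
Let kn c n z := c * k ((radii R n)%:C * z).

Let kn_cont c n z : normc z < (radii R n)^-1 -> ccontinuous (kn c n) z.
Proof.
have /andP[r0 r1] := radii_itv' n => zr.
have h : normc ((radii R n)%:C * z) < 1.
  by rewrite normc_realM ?ltW// mulrC -ltr_pdivlMr// mul1r.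
apply: ccontinuousM; first exact: cst_continuous.
have h1 := cderivableM (@cderivable_cst R (radii R n)%:C z) (@cderivable_id R z).
have h2 := cderivable_continuous h1.
exact: (continuous_comp h2 (k_cont h)).
Qed.

Let kn_deriv c n z : normc z < (radii R n)^-1 -> z != 0 -> cderivable (kn c n) z.
Proof.
have /andP[r0 r1] := radii_itv' n => zr z0.
have h : normc ((radii R n)%:C * z) < 1.
  by rewrite normc_realM ?ltW// mulrC -ltr_pdivlMr// mul1r.
have h0 : (radii R n)%:C * z != 0.
  by apply: normc_neq0; rewrite normc_realM ?ltW// mulr_gt0// normc_gt0.
have h1 := cderivableM (@cderivable_cst R (radii R n)%:C z) (@cderivable_id R z).
have h2 := @cderivable_comp R k _ z h1 (k_deriv h h0).
exact (cderivableM (@cderivable_cst R c z) h2).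
Qed.

Let inv_radii n : 1 < (radii R n)^-1.
Proof. by have /andP[r0 r1] := radii_itv' n; rewrite invf_gt1. Qed.

Let kn_le c n (t : R) : normc c = 1 -> `|complex.Re (kn c n (cis t))| <= (radii R n)^-1.
Proof.
have /andP[r0 r1] := radii_itv' n => c1.
apply: (le_trans (abs_Re_le _)); rewrite /kn normcM c1 mul1r.
have nr : normc ((radii R n)%:C * cis t) = radii R n by rewrite normc_radius// ltW.
rewrite -{2}nr; apply: k_le; last by rewrite nr.
by apply: normc_neq0; rewrite nr.
Qed.

Let kn_bmf c n : normc c = 1 -> bounded_mfun (fun t => complex.Re (kn c n (cis t))).
Proof.
move=> c1; split; last by exists (radii R n)^-1 => t; exact: kn_le.
apply: continuous_measurable_fun => t; apply: cvg_Re.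
have h : normc (cis t) < (radii R n)^-1 by rewrite normc_cis.
exact: (cvg_comp _ _ (@cvg_cis R t) (kn_cont (c := c) h)).
Qed.

Let kn_mean c n : avg (circ R) (fun t => complex.Re (kn c n (cis t))) = complex.Re (c * k 0).
Proof.
have -> : c * k 0 = kn c n 0 by rewrite /kn mulr0.
apply: (@mean_value R (kn c n) (radii R n)^-1 0 (inv_radii n) (lexx 0) ltr01).
- by move=> z zr; exact: kn_cont.
- by move=> z z0 zr _; apply: kn_deriv => //; exact: normc_neq0.
Qed.

(** The Schwarz lemma by averaging: on the circle [kn] is bounded by 1 / r, hence so is its mean,
    and r tends to 1. *)
Let k0_le c : normc c = 1 -> complex.Re (c * k 0) <= 1.
Proof.
move=> c1.
have H n : complex.Re (c * k 0) <= (radii R n)^-1.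
  rewrite -(kn_mean c n) -[leRHS](avg_cst (circ R)); apply: le_avg; [exact: kn_bmf|exact: bmf_cst|].
  by move=> t; apply: le_trans (ler_norm _) _; exact: kn_le.
have l : (radii R n)^-1 @[n --> \oo] --> (1 : R).
  rewrite -[X in _ --> X]invr1; apply: cvgV; [exact: oner_neq0|exact: cvg_radii].
rewrite -(cvg_lim (@Rhausdorff R) l); apply: limr_ge; first exact: cvgP l.
exact: nearW.
Qed.

(** The function 1 / r - Re [kn] is nonnegative on the circle. Its Poisson integral at [z] is at
    least its mean times (1 - |z|) / (1 + |z|), which is at least (1 - |z|) / 2; then r tends to
    1. *)
Let harnack c z : normc c = 1 -> normc z < 1 -> z != 0 ->
  (1 - normc z) / 2 * (1 - complex.Re (c * k 0)) <= 1 - complex.Re (c * k z).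
Proof.
move=> c1 z1 z0; have nz := normc_ge0 z.
have H n : (1 - normc z) / 2 * ((radii R n)^-1 - complex.Re (c * k 0)) <=
    (radii R n)^-1 - complex.Re (kn c n z).
  have zr : normc z < (radii R n)^-1 by exact: lt_trans (inv_radii n).
  have E : avg (circ R) (fun t => complex.Re (kn c n (cis t)) * poisson z t) = complex.Re (kn c n z).
    apply: (@poisson_formula R _ _ _ (inv_radii n) z1).
    - by move=> w wr; exact: kn_cont.
    - by move=> w wr w0; exact: kn_deriv.
    - exact: kn_deriv.
  have bk := kn_bmf n c1; have bp := bmf_poisson z1.
  have br := @bmf_cst _ (measurableTypeR R) R (radii R n)^-1.
  have E1 : avg (circ R) (fun t => ((radii R n)^-1 - complex.Re (kn c n (cis t))) * poisson z t) =
      (radii R n)^-1 - complex.Re (kn c n z).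
    rewrite -E -[X in _ = X - _]mulr1 -(avg_poisson z1) -(@avgZ _ _ _ (circ R) _ _ bp).
    rewrite -(@avgB _ _ _ (circ R) _ _ (bmfZ _ bp) (bmfM bk bp)).
    by congr avg; apply/funext => t; rewrite mulrBl.
  have E2 : avg (circ R) (fun t => (1 - normc z) / 2 * ((radii R n)^-1 - complex.Re (kn c n (cis t)))) =
      (1 - normc z) / 2 * ((radii R n)^-1 - complex.Re (c * k 0)).
    rewrite (@avgZ _ _ _ (circ R) _ _ (bmfB br bk)); congr (_ * _).
    by rewrite (@avgB _ _ _ (circ R) _ _ br bk) avg_cst kn_mean.
  rewrite -E1 -E2; apply: le_avg.
  - exact: bmfZ (bmfB br bk).
  - exact: bmfM (bmfB br bk) bp.
  - move=> t; rewrite mulrC; apply: ler_wpM2l.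
      by rewrite subr_ge0; apply: le_trans (ler_norm _) (kn_le _ _ _).
    apply: le_trans (poisson_ge t z1).
    by rewrite ler_wpM2l ?subr_ge0 ?(ltW z1)// lef_pV2 ?posrE; lra.
have l : (radii R n)^-1 @[n --> \oo] --> (1 : R).
  rewrite -[X in _ --> X]invr1; apply: cvgV; [exact: oner_neq0|exact: cvg_radii].
have l2 : complex.Re (kn c n z) @[n --> \oo] --> complex.Re (c * k z).
  apply: cvg_Re; apply: cvgM; first exact: cvg_cst.
  have c2 : (((radii R n)%:C * z) : R[i]^o) @[n --> \oo] --> (z : R[i]^o).
    rewrite -[X in _ --> X]mul1r; apply: cvgM; last exact: cvg_cst.
    by apply: (cvg_comp _ _ (@cvg_radii R)); exact: cvg_realC.
  exact: (cvg_comp _ _ c2 (k_cont z1)).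
have L1 : (1 - normc z) / 2 * ((radii R n)^-1 - complex.Re (c * k 0)) @[n --> \oo] -->
    (1 - normc z) / 2 * (1 - complex.Re (c * k 0)).
  by apply: cvgM; [exact: cvg_cst|apply: cvgB => //; exact: cvg_cst].
have L2 : (radii R n)^-1 - complex.Re (kn c n z) @[n --> \oo] --> 1 - complex.Re (c * k z).
  exact: cvgB.
rewrite -(cvg_lim (@Rhausdorff R) L1) -(cvg_lim (@Rhausdorff R) L2).
by apply: ler_lim; [exact: cvgP L1|exact: cvgP L2|exact: nearW].
Qed.

Lemma schwarz_derivative : normc (dslope f 0 0) <= 1.
Proof. by have [c c1 <-] := unit_align (k 0); exact: k0_le. Qed.

Definition hratio z : R := normc z / (1 - normc z).

(** Put r = |z|, q = |k(z)| and y = 1 - q. Clearing denominators turns the claim, for r > 0, into y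
    (1 - mu r / 3) >= mu (1 - r) / 3. [harnack] gives mu (1 - r) <= 2 y, so the difference is at
    least y (1 - mu r) / 3; this is where the 3 comes from. *)
Theorem hratio_contraction (mu : R) z : normc (dslope f 0 0) = 1 - mu -> normc z < 1 ->
  hratio (f z) <= hratio z * (1 - mu / 3).
Proof.
move=> muE z1; have := schwarz_derivative; have := normc_ge0 (dslope f 0 0).
rewrite muE => m0 m1.
have [->|z0] := eqVneq z 0; first by rewrite f0 /hratio Normc.normc0 !mul0r.
rewrite /hratio kE normcM.
have [c c1 cE] := unit_align (k z).
have h := harnack c1 z1 z0; rewrite cE in h.
have h0 : complex.Re (c * k 0) <= 1 - mu.
  rewrite -muE; apply: le_trans (ler_norm _) _; apply: le_trans (abs_Re_le _) _.
  by rewrite normcM c1 mul1r.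
have r0 := normc_ge0 z; have k0 := normc_ge0 (k z).
move: (normc z) (normc (k z)) (complex.Re _) z1 h h0 r0 k0 => r q x r1 h h0 r0 q0.
have hq : (1 - r) / 2 * mu <= 1 - q.
  apply: le_trans h; rewrite ler_wpM2l; lra.
have p0 : 0 <= (1 - r) / 2 * mu by apply: mulr_ge0; lra.
have q1 : q <= 1 by lra.
have rq : r * q <= r by rewrite ler_piMr.
rewrite ler_pdivrMr; last lra.
have -> : r / (1 - r) * (1 - mu / 3) * (1 - r * q) = r * ((1 - mu / 3) * (1 - r * q)) / (1 - r).
  by field; rewrite subr_eq0 gt_eqF.
rewrite ler_pdivlMr; last lra.
rewrite -mulrA ler_wpM2l//.
have y0 : 0 <= 1 - q by lra.
have h1 : 0 <= (1 - (1 - mu)) * (r * (1 - q)) by rewrite !mulr_ge0//; lra.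
have h2 : 0 <= (1 - mu) * (r * (1 - q)) by rewrite !mulr_ge0//.
have h3 : 0 <= (1 - q) * (1 - r) by rewrite mulr_ge0//; lra.
by lra.
Qed.

End Schwarz.

(** * Poisson bumps supported in arcs *)

Section ArcBump.
Context (R : realType).
Implicit Types (a b c d t x s : R).

Lemma cisD t s : cis (t + s) = cis t * cis s.
Proof. by rewrite /cis cosD sinD; apply/eqP; rewrite eq_complex /= eqxx addrC mulrC (mulrC (sin s)) eqxx. Qed.

Lemma cis_period t : cis (t + 2 * pi) = cis t.
Proof. by rewrite /cis mulr_natl cosD2pi sinD2pi. Qed.

(** On [0, pi / 4] the cosine is at least 1/2, so the mean value theorem gives sin (x / 2) >= x / 4,
    and the double-angle formula multiplies this by 2 cos (x / 2) >= 1. *)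
Lemma sin_ge_quarter x : 0 <= x <= pi / 2 -> x / 4 <= sin x.
Proof.
move=> /andP[x0 xp]; have [->|xn0] := eqVneq x 0; first by rewrite mul0r sin0.
have x0' : 0 < x by rewrite lt_neqAle eq_sym xn0.
have p0 := pi_gt0 R.
have x2 : 0 < x / 2 by lra.
have sc : {within `[0, x / 2], continuous (@sin R)}.
  by apply: continuous_subspaceT; exact: continuous_sin.
have [s + sE] := @MVT R (@sin R) (@cos R) 0 (x / 2) x2 (fun y _ => is_derive_sin y) sc.
rewrite in_itv/= => /andP[s0 s1].
have c0 : 0 <= cos s by apply: cos_ge0_pihalf; apply/andP; split; lra.
have half u : 0 <= u <= pi / 4 -> 1 / 2 <= cos u.
  move=> /andP[u0 u1]; have c0' : 0 <= cos u by apply: cos_ge0_pihalf; apply/andP; split; lra.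
  have : 0 <= cos (u + u) by apply: cos_ge0_pihalf; apply/andP; split; lra.
  rewrite cosD -!expr2; have := cos2Dsin2 u; move: (cos u) (sin u) c0' => C S C0 h1 h2.
  have [//|cl] := leP (1 / 2) C.
  have := mulr_ge0 C0 (_ : 0 <= 1 / 2 - C); rewrite subr_ge0 mulrBr => /(_ (ltW cl)).
  rewrite -expr2; lra.
have cs : 1 / 2 <= cos s by apply: half; apply/andP; split; lra.
have h1 : x / 4 <= sin (x / 2).
  by move: sE; rewrite sin0 subr0 subr0 => ->; nra.
apply: (le_trans h1).
have -> : sin x = 2 * (sin (x / 2) * cos (x / 2)).
  by rewrite {1}(_ : x = x / 2 + x / 2); [rewrite sinD; ring|field].
have : 1 / 2 <= cos (x / 2) by apply: half; apply/andP; split; lra.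
have : 0 <= sin (x / 2) by lra.
by move: (sin _) (cos _) => S C; nra.
Qed.

Definition bump d c t : R :=
  d * (poisson ((1 - d / 4)%:C * cis c) t - 1 / 2 * poisson ((1 - d)%:C * cis c) t).

(* Far from [c] the kernel at depth d/4 is at most half of the kernel at depth d. *)
Lemma bump_le0 d c t : 0 < d <= 1 -> 2 * d ^+ 2 <= 1 - cos (t - c) -> bump d c t <= 0.
Proof.
move=> /andP[d0 d1]; rewrite /bump !poisson_rkernel; [|lra|lra].
have y2 : cos (t - c) <= 1 := cos_le1 _.
have e1 := @rkernel_denom R (1 - d / 4) (t - c).
have e2 := @rkernel_denom R (1 - d) (t - c).
rewrite /rkernel; move: e1 e2; move: (cos _) y2 => C y2 e1 e2 hy.
have {}e1 := e1 ltac:(apply/andP; split; lra).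
have {}e2 := e2 ltac:(apply/andP; split; lra).
rewrite pmulr_rle0// subr_le0 mulrA ler_pdivrMr// mulrAC ler_pdivlMr//.
move: hy; set y := 1 - C => hy.
have y0 : 0 <= y by have := sqr_ge0 d; lra.
(* The second factor is the coefficient of [y] in the difference of the two sides of [key]. *)
have A : 0 <= (y - 2 * d ^+ 2) * (2 - 3 / 4 * d + d ^+ 2 / 4).
  by apply: mulr_ge0; [lra|have := sqr_ge0 d; lra].
have B : 0 <= d ^+ 2 * (1 - d) by rewrite mulr_ge0 ?sqr_ge0//; lra.
have B' : 0 <= d ^+ 2 * d ^+ 2 by rewrite mulr_ge0 ?sqr_ge0//.
have key : (1 / 2) * (2 - d / 4) * (d ^+ 2 + 2 * (1 - d) * y) <=
  (2 - d) * (d ^+ 2 / 16 + 2 * (1 - d / 4) * y) by nra.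
have -> : (1 - (1 - d / 4) ^+ 2) * ((1 - (1 - d)) ^+ 2 + 2 * (1 - d) * y) =
  (d / 2) * ((1 / 2) * (2 - d / 4) * (d ^+ 2 + 2 * (1 - d) * y)) by field.
have -> : 1 / 2 * (1 - (1 - d) ^+ 2) * ((1 - (1 - d / 4)) ^+ 2 + 2 * (1 - d / 4) * y) =
  (d / 2) * ((2 - d) * (d ^+ 2 / 16 + 2 * (1 - d / 4) * y)) by field.
by rewrite ler_wpM2l//; lra.
Qed.

(** The choice d = sin ((b - a) / 4) makes 2 d^2 equal to 1 - cos ((b - a) / 2). The condition of
    [bump_le0] then says that [t] is at angular distance at least (b - a) / 2 from the midpoint. *)
Lemma bump_gt0_arc a b t : a < b -> b <= a + 2 * pi ->
  0 < bump (sin ((b - a) / 4)) ((a + b) / 2) t -> exists2 s, a < s < b & cis s = cis t.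
Proof.
move=> ab bpi; set c := (a + b) / 2; set d := sin _ => h.
have p0 := pi_gt0 R.
have d0 : 0 < d by apply: sin_gt0_pi; apply/andP; split; lra.
have d1 : d <= 1 by exact: sin_le1.
have hc : cos ((b - a) / 2) < cos (t - c).
  have -> : cos ((b - a) / 2) = 1 - 2 * d ^+ 2.
    rewrite (_ : (b - a) / 2 = (b - a) / 4 + (b - a) / 4); last by field.
    by rewrite cosD -!expr2 -/d; have := cos2Dsin2 ((b - a) / 4); rewrite -/d; lra.
  rewrite ltNge; apply/negP => H.
  have : bump d c t <= 0 by apply: bump_le0; [rewrite d0|lra].
  by rewrite leNgt h.
have cI : -1 <= cos (t - c) <= 1 by rewrite cos_geN1 cos_le1.
pose x := acos (cos (t - c)).
have cx : cos x = cos (t - c) by rewrite acosK// in_itv/=.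
have x0 : 0 <= x by exact: acos_ge0.
have xpi : x <= pi by exact: acos_lepi.
have xlt : x < (b - a) / 2.
  by rewrite -ltr_cos ?cx// in_itv/= ?x0//; apply/andP; split; lra.
have sx : sin x = `|sin (t - c)|.
  rewrite sin_acos// -sqrtr_sqr; congr Num.sqrt.
  by have := cos2Dsin2 (t - c); lra.
have [e e1 eE] : exists2 e, `|e| = x & cis e = cis (t - c).
  have [s0|s0] := leP 0 (sin (t - c)).
    by exists x; rewrite ?ger0_norm// /cis cx sx ger0_norm.
  by exists (- x); rewrite ?normrN ?ger0_norm// /cis cosN sinN cx sx ltr0_norm// opprK.
exists (c + e).
  have : `|e| < (b - a) / 2 by rewrite e1.
  by rewrite ltr_norml /c => /andP[? ?]; apply/andP; split; lra.
by rewrite cisD eE -cisD addrC subrK.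
Qed.

(** The subtracted kernel is positive, and the other one, at depth d / 4, is at most 8 / d. *)
Lemma bump_le d c t : 0 < d <= 1 -> bump d c t <= 8.
Proof.
move=> /andP[d0 d1]; have n1 : normc ((1 - d / 4)%:C * cis c) = 1 - d / 4 by rewrite normc_radius//; lra.
have n2 : normc ((1 - d)%:C * cis c) = 1 - d by rewrite normc_radius//; lra.
have h1 : normc ((1 - d / 4)%:C * cis c) < 1 by rewrite n1; lra.
have h2 : normc ((1 - d)%:C * cis c) < 1 by rewrite n2; lra.
have := poisson_le t h1; have := poisson_gt0 t h2.
rewrite n1 /bump (_ : 1 - (1 - d / 4) = d / 4); last by ring.
move: (poisson _ t) (poisson _ t) => P2 P1 P20.
rewrite ler_pdivlMr; last lra.
by nra.
Qed.

Lemma cis_inj s t : 0 <= s < 2 * pi -> 0 <= t < 2 * pi -> cis s = cis t -> s = t.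
Proof.
move=> /andP[s0 s1] /andP[t0 t1] /eqP; rewrite eq_complex /= => /andP[/eqP cE /eqP sE].
apply/eqP/negPn/negP => st.
pose a := Num.min `|s - t| (2 * pi - `|s - t|).
have ts0 : 0 < `|s - t| by rewrite normr_gt0 subr_eq0.
have ts2 : `|s - t| < 2 * pi by rewrite ltr_norml; apply/andP; split; lra.
have a0 : 0 < a by rewrite lt_min ts0 subr_gt0.
have /andP[a1 a2] : (a <= `|s - t|) && (a <= 2 * pi - `|s - t|) by rewrite /a !ge_min !lexx orbT.
have : cos (s - t) <= cos a by apply: cos_far => //; rewrite a1/=; lra.
rewrite cosB cE sE -!expr2 cos2Dsin2 leNgt => /negP; apply.
by apply: cos_lt1; rewrite a0/=; lra.
Qed.

(** An arc may run through angle 0. Its trace on [0, 2 pi) is covered by two translates of the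
    parameter interval, which is the source of the factor 2. *)
Lemma arc_length_le (A : set R[i]) a b (ba bb : bool) : a < b -> b <= a + 2 * pi ->
  A = @cis R @` [set` Interval (BSide ba a) (BSide bb b)] ->
  (arc_length A <= (2 * (b - a))%:E)%E.
Proof.
move=> ab bpi ->.
have cn : normc (cis a) = 1 by exact: normc_cis.
pose a0 := arg (cis a); have a0I : 0 <= a0 < 2 * pi by exact: arg_itv.
have a0E : cis a0 = cis a by exact: cis_arg.
pose J r := [set` Interval (BSide ba r) (BSide bb (r + (b - a)))].
have JE r s : J r (s - a + r) <-> [set` Interval (BSide ba a) (BSide bb b)] s.
  rewrite /J /=; case: (ba); case: (bb); rewrite !in_itv/=; split => /andP[? ?]; apply/andP; split; lra.
rewrite /arc_length.
have -> : [set t | 0 <= t < 2 * pi /\ (@cis R @` [set` Interval (BSide ba a) (BSide bb b)]) (cis t)] =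
   `[0, 2 * pi[%classic `&` (J a0 `|` J (a0 - 2 * pi)).
  have /andP[h0 h1] := a0I.
  apply/seteqP; split => t /=; rewrite in_itv/=.
  - move=> [tI [s sI st]]; split => //.
    have cs : cis (s - a + a0) = cis t.
      by rewrite cisD a0E -cisD subrK.
    have sJ r := (JE r s).2 sI.
    have : a <= s <= b by move: sI; case: (ba); case: (bb); rewrite /= in_itv/= => /andP[? ?]; apply/andP; split; lra.
    move=> /andP[as_ sb].
    have [lt|ge] := ltP (s - a + a0) (2 * pi).
      have te : s - a + a0 = t by apply: cis_inj => //; apply/andP; split; lra.
      by left; rewrite -te; exact: (sJ a0).
    have te : s - a + (a0 - 2 * pi) = t.
      apply: cis_inj => //; first by apply/andP; split; lra.
      by rewrite -cis_period -cs; congr cis; ring.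
    by right; rewrite -te; exact: (sJ (a0 - 2 * pi)).
  - move=> [tI [tJ|tJ]]; split => //.
      exists (t - a0 + a); first by apply/(JE a0); rewrite (_ : t - a0 + a - a + a0 = t)//; ring.
      by rewrite cisD -a0E -cisD subrK.
    exists (t - (a0 - 2 * pi) + a); first by apply/(JE (a0 - 2 * pi)); rewrite (_ : t - (a0 - 2 * pi) + a - a + (a0 - 2 * pi) = t)//; ring.
    rewrite (_ : t - (a0 - 2 * pi) + a = (t - a0 + a) + 2 * pi); last by ring.
    by rewrite cis_period cisD -a0E -cisD subrK.
have mJ r : measurable (J r) by exact: measurable_itv.
have lJ r : (lebesgue_measure (J r) <= (b - a)%:E)%E.
  rewrite /J lebesgue_measure_itv/= lte_fin ltrDl subr_gt0 ab -EFinB lee_fin; lra.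
apply: (@le_trans _ _ (lebesgue_measure (J a0 `|` J (a0 - 2 * pi)))).
  have mU : measurable (J a0 `|` J (a0 - 2 * pi)) by apply: measurableU; exact: mJ.
  by apply: le_measure; rewrite ?inE; [exact: measurableI|exact: mU|exact: subIsetr].
have h := @measureU2 _ _ _ (@lebesgue_measure R) _ _ (mJ a0) (mJ (a0 - 2 * pi)).
apply: (le_trans h).
have -> : ((2 * (b - a))%:E = (b - a)%:E + (b - a)%:E)%E.
  by rewrite -EFinD; congr EFin; ring.
by apply: leeD; apply: lJ.
Qed.

(** The 32 is the 2 of [arc_length_le] times 16, as [sin_ge_quarter] gives (b - a) / 16 <= d. *)
Theorem arc_bump_exists (A : set R[i]) : is_arc A -> exists d c : R,
  [/\ 0 < d <= 1, (arc_length A <= (32 * d)%:E)%E & forall t, 0 < bump d c t -> A (cis t)].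
Proof.
move=> [a [b [ba [bb [ab bpi AE]]]]]; have p0 := pi_gt0 R.
have d0 : 0 < sin ((b - a) / 4) by apply: sin_gt0_pi; apply/andP; split; lra.
exists (sin ((b - a) / 4)), ((a + b) / 2); split.
- by rewrite d0 sin_le1.
- apply: le_trans (arc_length_le ab bpi AE) _; rewrite lee_fin.
  have := @sin_ge_quarter ((b - a) / 4).
  by move=> /(_ ltac:(apply/andP; split; lra)); lra.
- move=> t /(bump_gt0_arc ab bpi)[s /andP[as_ sb] <-]; rewrite AE; exists s => //=.
  by case: (ba); case: (bb); rewrite in_itv/=; apply/andP; split; rewrite ?ltW.
Qed.

End ArcBump.

(** * Correlations along the orbit *)

Section Dynamics.
Context (R : realType).
Implicit Types (phi psi : R -> R) (z : R[i]).
Variables (f : nat -> R[i] -> R[i]) (T : nat -> R -> R) (mu : nat -> R).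
Hypothesis f_inner : forall n, inner_function (f n.+1).
Hypothesis f_0 : forall n, f n.+1 0 = 0.
Hypothesis T_bd : forall n, is_boundary_map (f n.+1) (T n).
Hypothesis f_mu : forall n, normc (dslope (f n.+1) 0 0) = 1 - mu n.+1.

(** [T n] is the boundary map of [f n.+1], so this follows the maps of indices m + 1 to m + k; with
    [m = 0] it is the angle of the orbit point of index [k]. *)
Fixpoint orbit_from (m k : nat) (t : R) : R :=
  if k is j.+1 then T (m + j) (orbit_from m j t) else t.

Fixpoint interior_from (m k : nat) z : R[i] :=
  if k is j.+1 then f (m + j).+1 (interior_from m j z) else z.

Local Notation Y := (orbit_from 0).

Lemma orbit_fromD m k t : Y (m + k) t = orbit_from m k (Y m t).
Proof. by elim: k => [|k IH]; rewrite ?addn0// addnS /= IH add0n. Qed.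

Lemma measurable_orbit m k : measurable_fun setT (orbit_from m k).
Proof.
elim: k => [|k IH] /=; first exact: measurable_id.
by have [mT _ _] := T_bd (m + k); exact: (measurableT_comp mT IH).
Qed.

Lemma bmf_orbit m k phi : bounded_mfun phi -> bounded_mfun (fun t => phi (orbit_from m k t)).
Proof. by move=> bphi; exact: (bmf_comp bphi (measurable_orbit m k)). Qed.

Lemma interior_lt1 m k z : normc z < 1 -> normc (interior_from m k z) < 1.
Proof. by move=> z1; elim: k => //= k IH; exact: inner_lt1. Qed.

Lemma interior0 m k : interior_from m k 0 = 0.
Proof. by elim: k => //= k ->. Qed.

(** The outermost map is absorbed into [phi] before the induction hypothesis is used, hence the
    induction over all [phi]. *)
Lemma orbit_transfer m k z phi : normc z < 1 -> bounded_mfun phi ->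
  avg (circ R) (fun t => phi (orbit_from m k t) * poisson z t) =
  avg (circ R) (fun t => phi t * poisson (interior_from m k z) t).
Proof.
move=> z1; elim: k phi => [//|k IH] phi bphi /=.
have [mT _ _] := T_bd (m + k).
rewrite (IH (fun t => phi (T (m + k) t)) (bmf_comp bphi mT)).
by apply: boundary_transfer => //; exact: interior_lt1.
Qed.

Lemma poisson0 (t : R) : poisson 0 t = 1.
Proof. by rewrite /poisson Normc.normc0 subr0 normc_cis expr0n subr0 expr1n divr1. Qed.

Lemma normc0_lt1 : normc (0 : R[i]) < 1.
Proof. by rewrite Normc.normc0. Qed.

Lemma orbit_preserves m k phi : bounded_mfun phi ->
  avg (circ R) (fun t => phi (orbit_from m k t)) = avg (circ R) phi.
Proof.
move=> bphi; have := orbit_transfer m k normc0_lt1 bphi; rewrite interior0.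
have E psi : (fun t => psi t * poisson 0 t) = psi by apply/funext => t; rewrite poisson0 mulr1.
by rewrite (E (fun t => phi (orbit_from m k t))) E.
Qed.

Lemma mu_itv n : 0 <= mu n.+1 <= 1.
Proof.
have := normc_ge0 (dslope (f n.+1) 0 0); have := schwarz_derivative (f_inner n) (f_0 n).
by rewrite f_mu => ? ?; apply/andP; split; lra.
Qed.

Definition decay m k : R := \prod_(j < k) (1 - mu (m + j).+1 / 3).

Lemma decay_ge0 m k : 0 <= decay m k.
Proof. by apply: prodr_ge0 => j _; have /andP[? ?] := mu_itv (m + j); lra. Qed.

Lemma hratio_interior m k z : normc z < 1 ->
  hratio (interior_from m k z) <= hratio z * decay m k.
Proof.
move=> z1; elim: k => [|k IH]; first by rewrite /decay big_ord0 mulr1.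
rewrite /= /decay big_ord_recr /= mulrA.
apply: le_trans (hratio_contraction (f_inner _) (f_0 _) (f_mu _) (interior_lt1 m k z1)) _.
by apply: ler_wpM2r => //; have /andP[? ?] := mu_itv (m + k); lra.
Qed.

(** Since the transferred kernel is close to 1 uniformly, only the L1 norm of [psi] is left. For a
    centred bump that norm is of order d, which is what makes the variance linear. *)
Lemma poisson_decorrelation m k z psi : normc z < 1 -> bounded_mfun psi ->
  `|avg (circ R) (fun t => (poisson z (Y m t) - 1) * psi (Y (m + k) t))| <=
  2 * (hratio z * decay m k) * avg (circ R) (fun t => `|psi t|).
Proof.
move=> z1 bpsi; have v1 := interior_lt1 m k z1.
have bz := bmf_poisson z1; have bv := bmf_poisson v1.
have b1 := @bmf_cst _ (measurableTypeR R) R 1.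
have bo := bmf_orbit m k bpsi.
have -> : avg (circ R) (fun t => (poisson z (Y m t) - 1) * psi (Y (m + k) t)) =
    avg (circ R) (fun t => (poisson (interior_from m k z) t - 1) * psi t).
  transitivity (avg (circ R) (fun t => (poisson z t - 1) * psi (orbit_from m k t))).
    rewrite -(orbit_preserves 0 m (bmfM (bmfB bz b1) bo)).
    by congr avg; apply/funext => t; rewrite orbit_fromD.
  have e1 := orbit_transfer m k z1 bpsi; have e2 := orbit_preserves m k bpsi.
  rewrite (_ : (fun t => (poisson z t - 1) * psi (orbit_from m k t)) =
    (fun t => psi (orbit_from m k t) * poisson z t - psi (orbit_from m k t))); last first.
    by apply/funext => t; ring.
  rewrite (@avgB _ _ _ (circ R) _ _ (bmfM bo bz) bo) e1 e2.
  rewrite -(@avgB _ _ _ (circ R) _ _ (bmfM bpsi bv) bpsi).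
  by congr avg; apply/funext => t; ring.
have h := @avg_norm _ _ _ (circ R) _ (bmfM (bmfB bv b1) bpsi).
apply: (le_trans h).
rewrite -(@avgZ _ _ _ (circ R) _ _ (bmf_norm bpsi)); apply: le_avg.
- exact: bmf_norm (bmfM (bmfB bv b1) bpsi).
- exact: bmfZ (bmf_norm bpsi).
- move=> t; rewrite normrM ler_wpM2r//; apply: le_trans (poisson_sub1 t v1) _.
  by rewrite ler_pM2l//; exact: hratio_interior.
Qed.

(** The orbit maps preserve [circ], so they pull null sets back to null sets; this gives sense to
    compositions of maps defined almost everywhere. *)
Lemma orbit_ae (Q : R -> Prop) n : {ae circ R, forall t, Q t} -> {ae circ R, forall t, Q (Y n t)}.
Proof.
move=> [N [mN N0 QN]].
have mYN : measurable (Y n @^-1` N) by rewrite -[X in measurable X]setTI; exact: measurable_orbit.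
exists (Y n @^-1` N); split => //; last by move=> t /= nQ; exact: QN.
have bN : bounded_mfun (\1_N : R -> R) by exact: bmf_indic.
have E := orbit_preserves 0 n bN.
apply: (eq_trans (esym (avg_indic (circ R) mYN))).
by rewrite (_ : \1_(Y n @^-1` N) = (fun t => \1_N (Y n t)))// E avg_indic.
Qed.

Lemma orbit_boundary_comp :
  {ae circ R, forall t n, boundary_comp f n (cis t) = cis (Y n t)}.
Proof.
have H : {ae circ R, forall t n, radial_extension (f n.+1) (cis (Y n t)) = cis (T n (Y n t))}.
  apply: ae_foralln => n.
  have [_ _ H] := T_bd n.
  apply: (@orbit_ae (fun t => radial_extension (f n.+1) (cis t) = cis (T n t))).
  by apply: (@filterS _ _ (ae_filter_ringOfSetsType (circ R)) _ _ _ H) => t [].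
apply: (@filterS _ _ (ae_filter_ringOfSetsType (circ R)) _ _ _ H) => t Ht.
by elim=> [//|n IH]; rewrite /= IH Ht add0n.
Qed.

End Dynamics.

(** * Second moments of the weighted sums, and Chebyshev's inequality *)

Section Variance.
Context (R : realType).
Implicit Types (phi psi : R -> R) (z : R[i]).
Variables (f : nat -> R[i] -> R[i]) (T : nat -> R -> R) (mu : nat -> R).
Hypothesis f_inner : forall n, inner_function (f n.+1).
Hypothesis f_0 : forall n, f n.+1 0 = 0.
Hypothesis T_bd : forall n, is_boundary_map (f n.+1) (T n).
Hypothesis f_mu : forall n, normc (dslope (f n.+1) 0 0) = 1 - mu n.+1.
Variables d c : nat -> R.
Hypothesis d_itv : forall n, 0 < d n.+1 <= 1.

Local Notation Y := (orbit_from T 0).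

(** The poles of the two kernels in [bump] are the cases r = 4 and r = 1. *)
Let centre n r : R[i] := (1 - d n.+1 / r)%:C * cis (c n.+1).

Let normc_centre n r : 1 <= r -> normc (centre n r) = 1 - d n.+1 / r.
Proof.
move=> r1; have /andP[d0 d1] := d_itv n; apply: normc_radius.
by rewrite subr_ge0 ler_pdivrMr ?mul1r; lra.
Qed.

Let centre_lt1 n r : 1 <= r -> normc (centre n r) < 1.
Proof.
move=> r1; have /andP[d0 d1] := d_itv n.
by rewrite normc_centre// ltrBlDr ltrDl divr_gt0//; lra.
Qed.

(** The product is exactly [r - d n.+1]: the factor in front of [bump] offsets the proximity of its
    poles to the circle. *)
Let hratio_centre n r : 1 <= r -> d n.+1 * hratio (centre n r) <= r.
Proof.
move=> r1; have /andP[d0 d1] := d_itv n; rewrite /hratio normc_centre//.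
have -> : d n.+1 * ((1 - d n.+1 / r) / (1 - (1 - d n.+1 / r))) = r - d n.+1.
  by field; apply/andP; split; rewrite gt_eqF//; lra.
lra.
Qed.

Let bumpE n t : bump (d n.+1) (c n.+1) t =
  d n.+1 * (poisson (centre n 4) t - 1 / 2 * poisson (centre n 1) t).
Proof. by rewrite /bump /centre divr1. Qed.

Let cbump n t : R := bump (d n.+1) (c n.+1) t - d n.+1 / 2.

Let cbumpE n t : cbump n t = d n.+1 * (poisson (centre n 4) t - 1) -
  1 / 2 * (d n.+1 * (poisson (centre n 1) t - 1)).
Proof. by rewrite /cbump bumpE; field. Qed.

Let bmf_centred n r : 1 <= r -> bounded_mfun (fun t => poisson (centre n r) t - 1).
Proof.
by move=> r1; exact: bmfB (bmf_poisson (centre_lt1 n r1)) (@bmf_cst _ (measurableTypeR R) R 1).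
Qed.

Let one_le4 : 1 <= 4 :> R. Proof. by lra. Qed.

Let bmf_cbump n : bounded_mfun (cbump n).
Proof.
rewrite (funext (cbumpE n)); apply: bmfB; apply: bmfZ; first exact: bmf_centred.
by apply: bmfZ; exact: bmf_centred.
Qed.

(** Triangle inequality with kernels of mean 1: d + d / 2 + d / 2. *)
Let avg_abs_cbump n : avg (circ R) (fun t => `|cbump n t|) <= 2 * d n.+1.
Proof.
have /andP[d0 d1] := d_itv n.
have h1 := centre_lt1 n one_le4; have h2 := centre_lt1 n (lexx 1).
have b1 := bmf_poisson h1; have b2 := bmf_poisson h2.
have bc := @bmf_cst _ (measurableTypeR R) R (d n.+1 / 2).
have bs := bmfD (bmfD (bmfZ (d n.+1) b1) (bmfZ (d n.+1 / 2) b2)) bc.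
apply: (@le_trans _ _ (avg (circ R) (fun t => d n.+1 * poisson (centre n 4) t +
    d n.+1 / 2 * poisson (centre n 1) t + d n.+1 / 2))).
  apply: (@le_avg _ _ _ (circ R) _ _ (bmf_norm (bmf_cbump n)) bs) => t; rewrite /cbump bumpE.
  have := poisson_gt0 t h1; have := poisson_gt0 t h2.
  move: (poisson (centre n 1) t) (poisson (centre n 4) t) (d n.+1) d0 => p2 p1 e e0 p20 p10 /=.
  have q1 := mulr_gt0 e0 p10; have q2 := mulr_gt0 e0 p20.
  by rewrite ler_norml; apply/andP; split; lra.
rewrite (@avgD _ _ _ (circ R) _ _ (bmfD (bmfZ (d n.+1) b1) (bmfZ (d n.+1 / 2) b2)) bc).
rewrite (@avgD _ _ _ (circ R) _ _ (bmfZ (d n.+1) b1) (bmfZ (d n.+1 / 2) b2)).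
rewrite (@avgZ _ _ _ (circ R) _ _ b1) (@avgZ _ _ _ (circ R) _ _ b2) !avg_poisson// avg_cst.
lra.
Qed.

(** The 9 is 2 * 4 + (1 / 2) * 2 * 1: [poisson_decorrelation] contributes 2, [hratio_centre]
    contributes 4 and 1, and the second kernel has weight 1/2. *)
Let correlation n k psi : bounded_mfun psi ->
  `|avg (circ R) (fun t => cbump n (Y n.+1 t) * psi (Y (n.+1 + k) t))| <=
  9 * decay mu n.+1 k * avg (circ R) (fun t => `|psi t|).
Proof.
move=> bpsi; have /andP[d0 d1] := d_itv n.
have D z := @poisson_decorrelation R f T mu f_inner f_0 T_bd f_mu n.+1 k z psi.
have b (r : R) (r1 : 1 <= r) := bmfM (bmf_orbit T_bd 0 n.+1 (bmf_centred n r1))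
  (bmf_orbit T_bd 0 (n.+1 + k) bpsi).
set E1 := avg (circ R) (fun t => (poisson (centre n 4) (Y n.+1 t) - 1) * psi (Y (n.+1 + k) t)).
set E2 := avg (circ R) (fun t => (poisson (centre n 1) (Y n.+1 t) - 1) * psi (Y (n.+1 + k) t)).
have -> : avg (circ R) (fun t => cbump n (Y n.+1 t) * psi (Y (n.+1 + k) t)) =
    d n.+1 * E1 - 1 / 2 * d n.+1 * E2.
  rewrite -(@avgZ _ _ _ (circ R) _ _ (b _ one_le4)) -(@avgZ _ _ _ (circ R) _ _ (b _ (lexx 1))).
  rewrite -(@avgB _ _ _ (circ R) _ _ (bmfZ _ (b _ one_le4)) (bmfZ _ (b _ (lexx 1)))).
  by congr avg; apply/funext => t; rewrite cbumpE; ring.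
have h1 := D _ (centre_lt1 n one_le4) bpsi; have h2 := D _ (centre_lt1 n (lexx 1)) bpsi.
have q1 := hratio_centre n one_le4; have q2 := hratio_centre n (lexx 1).
have p0 : 0 <= decay mu n.+1 k * avg (circ R) (fun t => `|psi t|).
  by rewrite mulr_ge0 ?(decay_ge0 f_inner f_0 f_mu)// avg_ge0.
apply: le_trans (ler_normB _ _) _.
rewrite (normrM _ E1) (normrM _ E2) (gtr0_norm d0) (gtr0_norm (_ : 0 < 1 / 2 * d n.+1)); last lra.
have {}h1 := ler_wpM2l (ltW d0) h1; have {}h2 := ler_wpM2l (ltW d0) h2.
have g1 := ler_wpM2r p0 q1; have g2 := ler_wpM2r p0 q2.
rewrite -/E1 in h1; rewrite -/E2 in h2.
move: h1 h2 g1 g2; move: (decay _ _ _) (avg _ _) (hratio _) (hratio _) `|E1| `|E2| => D1 A H1 H2 N1 N2.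
move=> h1 h2 g1 g2.
have -> : 9 * D1 * A = 2 * (4 * (D1 * A)) + 1 / 2 * (2 * (1 * (D1 * A))) by field.
apply: lerD; first by apply: (le_trans h1); rewrite -!mulrA; lra.
by rewrite -mulrA; lra.
Qed.

(* The weights mu_i / 3 times the later factors telescope to at most 1. *)
Let decay_sum n : \sum_(i < n) mu i.+1 * decay mu i.+1 (n - i) + mu n.+1 <= 3.
Proof.
elim: n => [|n IH].
  by rewrite big_ord0 add0r; have /andP[_ ?] := mu_itv f_inner f_0 f_mu 0; lra.
have -> : \sum_(i < n.+1) mu i.+1 * decay mu i.+1 (n.+1 - i) =
   (\sum_(i < n) mu i.+1 * decay mu i.+1 (n - i) + mu n.+1) * (1 - mu n.+2 / 3).
  have S i : (i <= n)%N -> decay mu i.+1 (n.+1 - i) = decay mu i.+1 (n - i) * (1 - mu n.+2 / 3).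
    by move=> i_n; rewrite subSn// /decay big_ord_recr /= addSn subnKC.
  rewrite big_ord_recr /= S// subnn {2}/decay big_ord0 mul1r mulrDl; congr (_ + _).
  by rewrite mulr_suml; apply: eq_bigr => i _; rewrite S ?mulrA// ltnW.
have /andP[m0 m1] := mu_itv f_inner f_0 f_mu n.+1.
have := ler_wpM2r (_ : 0 <= 1 - mu n.+2 / 3) IH; rewrite subr_ge0 => /(_ _)/wrap[]; lra.
Qed.

Let S n t : R := \sum_(i < n) mu i.+1 * cbump i (Y i.+1 t).

Let bmf_term i : bounded_mfun (fun t => mu i.+1 * cbump i (Y i.+1 t)).
Proof. by apply: bmfZ; apply: (bmf_orbit T_bd 0 i.+1); exact: bmf_cbump. Qed.

Let bmf_S n : bounded_mfun (S n).
Proof. by apply: (@bmf_sum _ _ _ _ _ _ (fun i : 'I_n => fun t => mu i.+1 * cbump i (Y i.+1 t))) => i; exact: bmf_term. Qed.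

(** The new square costs 9 * 2 = 18 times d, by [correlation] at lag 0; the cross term costs 3 * 18
    = 54 times d, by [decay_sum]. As mu^2 <= mu, the increment is at most 2 * 54 + 18 = 126 times mu
    d. *)
Let variance n : avg (circ R) (fun t => S n t ^+ 2) <= 126 * \sum_(i < n) mu i.+1 * d i.+1.
Proof.
elim: n => [|n IH].
  rewrite big_ord0 mulr0 (_ : (fun t => _) = cst 0) ?avg_cst//.
  by apply/funext => t; rewrite /S big_ord0 expr0n.
have /andP[d0 d1] := d_itv n; have /andP[m0 m1] := mu_itv f_inner f_0 f_mu n.
have bX := bmf_orbit T_bd 0 n.+1 (bmf_cbump n).
have bS := bmf_S n; have bSX := bmfM bS bX; have bXX := bmfM bX bX; have bSS := bmfM bS bS.
have E : avg (circ R) (fun t => S n.+1 t ^+ 2) = avg (circ R) (fun t => S n t * S n t) +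
   (2 * mu n.+1) * avg (circ R) (fun t => S n t * cbump n (Y n.+1 t)) +
   mu n.+1 ^+ 2 * avg (circ R) (fun t => cbump n (Y n.+1 t) * cbump n (Y n.+1 t)).
  rewrite -(@avgZ _ _ _ (circ R) _ _ bSX) -(@avgZ _ _ _ (circ R) _ _ bXX).
  rewrite -(@avgD _ _ _ (circ R) _ _ bSS (bmfZ _ bSX)).
  rewrite -(@avgD _ _ _ (circ R) _ _ (bmfD bSS (bmfZ _ bSX)) (bmfZ _ bXX)).
  by congr avg; apply/funext => t; rewrite {1}/S big_ord_recr /= -/(S n t); ring.
rewrite E big_ord_recr /= mulrDr -addrA; apply: lerD.
  by apply: le_trans IH; rewrite le_eqVlt; apply/orP; left; apply/eqP; congr avg; apply/funext => t; rewrite expr2.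
have A := avg_abs_cbump n.
have h2 : avg (circ R) (fun t => cbump n (Y n.+1 t) * cbump n (Y n.+1 t)) <= 18 * d n.+1.
  apply: le_trans (ler_norm _) _; have := correlation n 0 (bmf_cbump n).
  rewrite addn0 /decay big_ord0; lra.
have h1 : avg (circ R) (fun t => S n t * cbump n (Y n.+1 t)) <= 54 * d n.+1.
  have -> : avg (circ R) (fun t => S n t * cbump n (Y n.+1 t)) =
     \sum_(i < n) mu i.+1 * avg (circ R) (fun t => cbump i (Y i.+1 t) * cbump n (Y n.+1 t)).
    have bi i := bmfM (bmf_orbit T_bd 0 i.+1 (bmf_cbump i)) bX.
    rewrite (_ : (fun t => _) = (fun t => \sum_(i < n) mu i.+1 * (cbump i (Y i.+1 t) * cbump n (Y n.+1 t)))).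
      rewrite (@avg_sum _ _ _ (circ R) _ _ _ (fun i : 'I_n => fun t => mu i.+1 * (cbump i (Y i.+1 t) * cbump n (Y n.+1 t)))).
        by apply: eq_bigr => i _; rewrite (@avgZ _ _ _ (circ R) _ _ (bi i)).
      by move=> i; apply: bmfZ; exact: bi.
    by apply/funext => t; rewrite /S mulr_suml; apply: eq_bigr => i _; rewrite mulrA.
  apply: (@le_trans _ _ (\sum_(i < n) (mu i.+1 * decay mu i.+1 (n - i)) * (18 * d n.+1))).
    apply: ler_sum => i _; have /andP[mi0 mi1] := mu_itv f_inner f_0 f_mu i.
    rewrite -mulrA ler_wpM2l//; apply: le_trans (ler_norm _) _.
    have := correlation i (n - i) (bmf_cbump n); rewrite addSn subnKC; last exact: ltnW.
    move=> h; apply: (le_trans h).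
    have := decay_ge0 f_inner f_0 f_mu i.+1 (n - i); move: (decay _ _ _) => D D0.
    have := ler_wpM2l D0 A; lra.
  rewrite -mulr_suml; have := decay_sum n; move: (\sum_(i < n) _) => D HD.
  have := ler_wpM2r (_ : 0 <= 18 * d n.+1) (_ : D <= 3); lra.
have g1 := ler_wpM2l (_ : 0 <= 2 * mu n.+1) h1.
have m2 : mu n.+1 ^+ 2 <= mu n.+1 by rewrite expr2 ler_piMl.
have g2 := ler_wpM2l (sqr_ge0 (mu n.+1)) h2.
have g3 := ler_wpM2r (_ : 0 <= 18 * d n.+1) m2.
have := g1 ltac:(lra); have := g3 ltac:(lra); lra.
Qed.

Let bump0 n t : R := bump (d n.+1) (c n.+1) (Y n.+1 t).

Let bmf_bump0 n : bounded_mfun (bump0 n).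
Proof.
rewrite (_ : bump0 n = (fun t => cbump n (Y n.+1 t) + d n.+1 / 2)).
  exact: bmfD (bmf_orbit T_bd 0 n.+1 (bmf_cbump n)) (@bmf_cst _ (measurableTypeR R) R (d n.+1 / 2)).
by apply/funext => t; rewrite /cbump subrK.
Qed.

Let misses K : set R := \bigcap_(n in [set n | (K <= n)%N]) (bump0 n @^-1` `]-oo, 0]).

Let measurable_misses K : measurable (misses K).
Proof.
apply: bigcap_measurable; first by exists K => /=.
move=> n _; rewrite -[X in measurable X]setTI.
by have [mb _] := bmf_bump0 n; apply: mb => //; exact: measurable_itv.
Qed.

Let mass N : R := \sum_(i < N) mu i.+1 * d i.+1.

(** Only the first [K] bumps can be positive, each at most 8 with weight at most 1; subtracting the
    means d / 2 costs half the mass. *)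
Let misses_sum K N t : misses K t -> S N t <= 8 * K%:R - mass N / 2.
Proof.
move=> Kt.
have -> : S N t = \sum_(i < N) mu i.+1 * bump0 i t - mass N / 2.
  rewrite /mass mulr_suml -sumrB; apply: eq_bigr => i _; rewrite /cbump /bump0; ring.
rewrite lerD2r; apply: (@le_trans _ _ (8 * (minn N K)%:R)); last first.
  by rewrite ler_pM2l// ler_nat geq_minr.
elim: N => [|N IH]; first by rewrite big_ord0 min0n mulr0.
rewrite big_ord_recr /=.
have /andP[m0 m1] := mu_itv f_inner f_0 f_mu N.
have [KN|NK] := leqP K N.
  rewrite (minn_idPr _) ?(leqW KN)//; rewrite (minn_idPr KN) in IH.
  have := Kt _ KN; rewrite /= in_itv /= => b0; have := ler_wpM2l m0 b0; lra.
rewrite (minn_idPl _)//; rewrite (minn_idPl (ltnW NK)) in IH.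
have b8 := bump_le (c N.+1) (Y N.+1 t) (d_itv N); rewrite -natr1.
have := ler_wpM2l m0 b8; rewrite -/(bump0 N t); lra.
Qed.

Lemma misses_null K : (forall B, exists N, B <= mass N) -> circ R (misses K) = 0%E.
Proof.
move=> div; rewrite -(avg_indic (circ R) (measurable_misses K)).
have bB := bmf_indic R (measurable_misses K).
set p := avg _ _; have p0 : 0 <= p by apply: avg_ge0 => t; rewrite indicE.
apply/eqP; rewrite eqe; apply/negPn/negP => pn0.
have {pn0}p_gt0 : 0 < p by rewrite lt_def pn0.
(* The term 32 K makes 8 K - a / 2 at most - a / 4 on [misses K]. Chebyshev then gives a p <= 126 *
   16, which 17 contradicts. *)
have [N HN] := div (32 * K%:R + 126 * 17 / p).
have q0 : 0 < 126 * 17 / p by rewrite divr_gt0// mulr_gt0// ltr0n.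
have K0 : 0 <= K%:R :> R by exact: ler0n.
set a := mass N in HN; have a0 : 0 < a by lra.
have : (a / 4) ^+ 2 * p <= 126 * a.
  rewrite -(@avgZ _ _ _ (circ R) _ _ bB).
  have h := @le_avg _ _ _ (circ R) _ _ (bmfZ ((a / 4) ^+ 2) bB) (bmfM (bmf_S N) (bmf_S N)).
  apply: le_trans (h _) _ => [t|]; last first.
    by have := variance N; under eq_fun do rewrite expr2.
  rewrite indicE; have [/set_mem Kt|_] := boolP (t \in misses K); last first.
    by rewrite mulr0 -expr2 sqr_ge0.
  have := misses_sum N Kt; rewrite mulr1 -/a expr2 => hS; nra.
rewrite expr2 => H.
have H2 : a * p <= 126 * 16.
  rewrite -(ler_pM2l a0); move: H; rewrite (_ : a / 4 * (a / 4) * p = (a * (a * p)) / 16); last by field.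
  lra.
have : 126 * 17 / p * p <= a * p by rewrite ler_pM2r//; lra.
by rewrite divfK ?gt_eqF//; lra.
Qed.

Lemma bump_recurrence : (forall B, exists N, B <= mass N) ->
  {ae circ R, forall t, forall K, exists2 n, (K <= n)%N & 0 < bump (d n.+1) (c n.+1) (Y n.+1 t)}.
Proof.
move=> div; apply: ae_foralln => K.
exists (misses K); split; [exact: measurable_misses|exact: misses_null|].
move=> t /= nt n /= Kn; rewrite in_itv /= leNgt.
by apply/negP => b0; apply: nt; exists n.
Qed.

End Variance.

(** If all partial sums stayed below [B], comparison would bound the extended-real series by 32
    B. *)
Lemma mass_unbounded (R : realType) (mu d : nat -> R) (l : nat -> \bar R) :
  (forall n, (1 <= n)%N -> 0 <= mu n) -> (forall n, (1 <= n)%N -> (0 <= l n)%E) ->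
  (forall n, (1 <= n)%N -> (l n <= (32 * d n)%:E)%E) ->
  (\sum_(1 <= n <oo) (mu n)%:E * l n = +oo)%E ->
  forall B, exists N, B <= \sum_(i < N) mu i.+1 * d i.+1.
Proof.
move=> mu0 l0 ld div B; apply: contrapT => nB.
suff : (\sum_(1 <= n <oo) (mu n)%:E * l n <= (32 * B)%:E)%E by rewrite div leye_eq.
apply: lime_le.
  apply: is_cvg_ereal_nneg_natsum_cond => n n1 _; rewrite mule_ge0 ?lee_fin ?mu0 ?l0//.
near=> n.
have [m ->] : exists m, n = m.+1 by exists n.-1; rewrite prednK//; near: n; exists 1%N.
rewrite big_add1 /= big_mkord.
apply: (@le_trans _ _ (\sum_(i < m) (32 * (mu i.+1 * d i.+1))%:E)%E).
  apply: lee_sum => i _; rewrite mulrCA EFinM.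
  by apply: lee_wpmul2l; [rewrite lee_fin mu0|exact: ld].
rewrite sumEFin lee_fin -mulr_sumr ler_pM2l ?ltr0n//.
by rewrite leNgt; apply/negP => /ltW H; apply: nB; exists m.
Unshelve. all: by end_near. Qed.

Theorem theoremD (R : realType) (f : nat -> R[i] -> R[i]) (lam mu : nat -> R)
  (f_inner : forall n : nat, (1 <= n)%N -> centred_inner (f n))
  (lamE : forall n : nat, (1 <= n)%N -> `|((f n : R[i]^o -> R[i]^o)^`())%classic 0| = (lam n)%:C)
  (muE : forall n : nat, (1 <= n)%N -> lam n = 1 - mu n)
  (I : nat -> set R[i]) (I_shrink : shrinking_target I)
  (I_div : (\sum_(1 <= n <oo) (mu n)%:E * arc_length (I n) = +oo)%E) :
  ae_circle (fun zeta : R[i] => hits (fun n => boundary_comp f n zeta) I).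
Proof.
have fi n : inner_function (f n.+1) by have [] := f_inner n.+1 isT.
have f0 n : f n.+1 0 = 0 by have [] := f_inner n.+1 isT.
have [T T_bd] := choice (fun n => boundary_map_exists (fi n)).
have f_mu n : normc (dslope (f n.+1) 0 0) = 1 - mu n.+1.
  rewrite -muE//; apply: complexI; rewrite -lamE// -normcE /dslope eqxx derive1E.
  by [].
have [d0 H] := choice (fun n => arc_bump_exists (I_shrink.1 n.+1 isT)).
have [c0 {}H] := choice H.
(* [d0 n] and [c0 n] belong to the arc of index [n.+1]; the shift restores the numbering from 1,
   with a dummy value at 0. *)
pose d n := d0 n.-1; pose c n := c0 n.-1.
have d_itv n : 0 < d n.+1 <= 1 by have [] := H n.
have mu0 n : (1 <= n)%N -> 0 <= mu n.
  by case: n => // n _; have /andP[] := mu_itv fi f0 f_mu n.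
have div : forall B, exists N, B <= \sum_(i < N) mu i.+1 * d i.+1.
  apply: (@mass_unbounded _ mu d (fun n => arc_length (I n))) => //.
by case=> // n _; have [] := H n.
apply/ae_circP.
have H1 := orbit_boundary_comp fi f0 T_bd.
have H2 := bump_recurrence fi f0 T_bd f_mu c d_itv div.
apply: (@filterS2 _ _ (ae_filter_ringOfSetsType (circ R)) _ _ _ _ H1 H2) => t E hit N.
have [n Nn b0] := hit N; exists n.+1.
  by rewrite geq_max /= leqW.
by rewrite E; have [_ _] := H n; apply; exact: b0.
Qed.
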